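(* Let $G=(X,w,0,\mu)$ be a graph with killing term $\kappa=0$ and with $\mu(X):=\sum_{x\in X}\mu(x)<\infty$. Let $\phi\in\mathcal I$ with $\phi^{-1}((0,\infty))\neq\emptyset$. For a positive pointwise solution $u$ on $[0,T]\times X$ with initial datum $u_0$, say that $u$ conserves mass on $[0,T]$ if $\mathsf M_u(t)=\mathsf M_{u_0}$ for all $t\in[0,T]$. Then $G$ satisfies stochastic completeness if and only if one, and hence all, of the following statements hold: (ii) For every $T>0$, every bounded positive pointwise solution of (GPME) on $[0,T]\times X$ with initial datum $u_0\in\mathcal D_+$ conserves mass on $[0,T]$. (iii) There exist $T_0>0$ and a nonzero positive finitely supported $u_*\colon X\to\mathbb R$ such that every bounded positive pointwise solution of (GPME) on $[0,T_0]\times X$ with initial datum $u_*$ conserves mass on $[0,T_0]$. (iv) For some $T_0>0$, every bounded positive pointwise solution of (GPME) on $[0,T_0]\times X$ with zero initial datum conserves mass on $[0,T_0]$. Moreover, if $G$ does not satisfy stochastic completeness, then, for every $T>0$ and every $c\in(0,\infty)$ such that $0<\phi(c)<\sup_{\mathbb R}\phi$, there exist bounded positive pointwise solutions $u_-$ and $u_+$ of (GPME) on $[0,T]\times X$, both with constant initial datum $u_0=c$, and times $t_-,t_+\in(0,T]$ such that $$0\le u_-\le c\le u_+\quad\text{on }[0,T]\times X\qquad\text{and}\qquad \mathsf M_{u_-}(t_-)<c\,\mu(X)<\mathsf M_{u_+}(t_+).$$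
   Context: Graph with no killing: $G=(X,w,0,\mu)$ where $X$ is a countable set, $\mu\colon X\to(0,\infty)$, $w\colon X\times X\to[0,\infty)$ is symmetric with $w(x,x)=0$ and $\sum_{y\in X}w(x,y)<\infty$ for every $x\in X$. Graphs are always assumed connected: any $x,y\in X$ are joined by a finite path $x=x_0,\dots,x_N=y$ with $w(x_i,x_{i+1})>0$ for all $i$. No local finiteness is assumed. $\ell^1(X,\mu)$ is the set of $f\colon X\to\mathbb R$ with $\sum_x|f(x)|\mu(x)<\infty$; $\ell^\infty(X)$ denotes the bounded functions. ''Positive'' means $\ge0$ everywhere. $\mathcal D_+$ is the set of positive functions in $\ell^1(X,\mu)\cap\ell^\infty(X)$. For a positive function $v$ on $X$, $\mathsf M_v=\sum_{x\in X}v(x)\mu(x)\in[0,\infty]$, and $\mathsf M_u(t)=\mathsf M_{u(t,\cdot)}$. Laplacian: $\mathcal F$ is the set of $f\colon X\to\mathbb R$ with $\sum_{y}w(x,y)|f(y)|<\infty$ for every $x$; for $f\in\mathcal F$, $\Delta f(x)=\frac1{\mu(x)}\sum_{y\in X}w(x,y)(f(x)-f(y))$. Stochastic completeness: let $L$ be the positive self-adjoint operator on $\ell^2(X,\mu)$ associated with the closure of the form $Q(f,g)=\frac12\sum_{x,y}w(x,y)(f(x)-f(y))(g(x)-g(y))$ defined on finitely supported functions. The semigroup $e^{-tL}$ is positivity preserving and is extended to functions $f\ge0$ by $e^{-tL}f=\lim_n e^{-tL}f_n\in[0,\infty]$ for finitely supported $0\le f_n\uparrow f$. $G$ satisfies stochastic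 completeness if for some (and hence all) $t>0$, $e^{-tL}1=1$ pointwise on $X$. Nonlinearities: $\mathcal I$ is the set of continuous, increasing (in the weak sense: $s_1<s_2$ implies $\phi(s_1)\le\phi(s_2)$), nonconstant $\phi\colon\mathbb R\to\mathbb R$ with $\phi(0)=0$. Pointwise solutions: (GPME) is the Cauchy problem $\partial_tu+\Delta(\phi\circ u)=0$, $u|_{t=0}=u_0$. A pointwise solution on $[0,T]\times X$ with initial datum $u_0\colon X\to\mathbb R$ is a function $u\colon[0,T]\times X\to\mathbb R$ such that $\phi\circ u(t,\cdot)\in\mathcal F$ for every $t\in(0,T)$; $u(\cdot,x)\in C([0,T])\cap C^1((0,T))$ for every $x$; $\partial_tu(t,x)+\Delta(\phi\circ u(t,\cdot))(x)=0$ for all $(t,x)\in(0,T)\times X$; and $u(0,x)=u_0(x)$ for all $x$. It is bounded if $u$ is a bounded function. *)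

(* Defs.v *)
From HB Require Import structures.
From mathcomp Require Import all_boot all_order all_algebra.
From mathcomp Require Import all_classical all_reals all_analysis.

Set Implicit Arguments.
Unset Strict Implicit.
Unset Printing Implicit Defensive.

Import Order.TTheory GRing.Theory Num.Theory.
Import numFieldNormedType.Exports.

Local Open Scope classical_set_scope.
Local Open Scope ring_scope.

(** Weighted graphs without killing term. *)

Record graph (R : realType) (X : countType) := Graph {
  edge_weight : X -> X -> R;
  vertex_weight : X -> R;
  graph_nonempty : [set: X] !=set0;
  edge_weight_ge0 : forall x y, 0 <= edge_weight x y;
  edge_weight_sym : forall x y, edge_weight x y = edge_weight y x;
  edge_weight_diag : forall x, edge_weight x x = 0;
  edge_weight_summable : forall x,
    (\esum_(y in [set: X]) (edge_weight x y)%:E < +oo)%E;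
  vertex_weight_gt0 : forall x, 0 < vertex_weight x;
  graph_connected : forall x y, exists s : seq X,
    path (fun a b => 0 < edge_weight a b) x s /\ last x s = y
}.

(** Sum of an absolutely summable real family (junk value otherwise):
    [esum] is only meaningful for nonnegative terms, hence the splitting. *)
Definition tsum (R : realType) (T : choiceType) (f : T -> R) : R :=
  fine (\esum_(x in [set: T]) (Num.max (f x) 0)%:E)
  - fine (\esum_(x in [set: T]) (Num.max (- f x) 0)%:E).

Definition positive (R : realType) (X : Type) (f : X -> R) : Prop :=
  forall x, 0 <= f x.

Definition finitely_supported (R : realType) (X : Type) (f : X -> R) : Prop :=
  finite_set [set x | f x != 0].

Section Graph.
Variables (R : realType) (X : countType) (G : graph R X).
Implicit Types (f g h v : X -> R).

Let w := edge_weight G.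
Let mu := vertex_weight G.

Definition total_measure : \bar R := (\esum_(x in [set: X]) (mu x)%:E)%E.

(** Mass of a positive function. *)
Definition mass v : \bar R := (\esum_(x in [set: X]) (v x * mu x)%:E)%E.

Definition in_l1 f : Prop :=
  (\esum_(x in [set: X]) (`|f x| * mu x)%:E < +oo)%E.

Definition in_linfty f : Prop := exists M : R, forall x, `|f x| <= M.

Definition in_Dplus f : Prop := [/\ positive f, in_l1 f & in_linfty f].

(** The formal Laplacian and its domain. *)

Definition in_F f : Prop :=
  forall x, (\esum_(y in [set: X]) (w x y * `|f y|)%:E < +oo)%E.

Definition laplacian f (x : X) : R :=
  (mu x)^-1 * tsum (fun y => w x y * (f x - f y)).

(** The Hilbert space l^2(X, mu), as a space of functions on X. *)

Definition in_l2 f : Prop :=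
  (\esum_(x in [set: X]) (f x ^+ 2 * mu x)%:E < +oo)%E.

Definition l2dot f g : R := tsum (fun x => f x * g x * mu x).

Definition l2norm f : R := Num.sqrt (l2dot f f).

(** The form on finitely supported functions, and its closure. *)

Definition form f g : R :=
  2^-1 * tsum (fun p : X * X =>
    w p.1 p.2 * (f p.1 - f p.2) * (g p.1 - g p.2)).

Definition form_approx (fn : nat -> X -> R) f : Prop :=
  [/\ forall n, finitely_supported (fn n),
      l2norm (fn n \- f) @[n --> \oo] --> (0 : R)
    & forall e : R, 0 < e -> exists N, forall n m, (N <= n)%N -> (N <= m)%N ->
        form (fn n \- fn m) (fn n \- fn m) < e].

Definition closure_dom f : Prop :=
  in_l2 f /\ exists fn, form_approx fn f.

(** [closure_form f g q]: the closed form takes the value [q] at [(f, g)]. *)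
Definition closure_form f g (q : R) : Prop :=
  exists fn gn, [/\ form_approx fn f, form_approx gn g
    & form (fn n) (gn n) @[n --> \oo] --> q].

(** Graph of the operator L associated with the closed form:
    f is in D(L) and L f = g. *)
Definition operator_L f g : Prop :=
  [/\ closure_dom f, in_l2 g
    & forall h, closure_dom h -> closure_form f h (l2dot g h)].

(** e^{-tL} is the strongly continuous semigroup of bounded linear operators
    on l^2(X, mu) whose infinitesimal generator, domain included, is -L.
    This determines [P t f] for t >= 0 and f in l^2; other values of [P] are
    unconstrained. *)
Record is_heat_semigroup (P : R -> (X -> R) -> (X -> R)) : Prop := {
  heat_l2 : forall t f, 0 <= t -> in_l2 f -> in_l2 (P t f);
  heat_linear : forall t (a : R) f g, 0 <= t -> in_l2 f -> in_l2 g ->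
    P t (fun x => a * f x + g x) = (fun x => a * P t f x + P t g x);
  heat_bounded : forall t, 0 <= t -> exists C : R,
    forall f, in_l2 f -> l2norm (P t f) <= C * l2norm f;
  heat_0 : forall f, in_l2 f -> P 0 f = f;
  heat_D : forall s t f, 0 <= s -> 0 <= t -> in_l2 f ->
    P (s + t) f = P s (P t f);
  heat_continuous : forall f, in_l2 f ->
    l2norm (P t f \- f) @[t --> 0^'+] --> (0 : R);
  heat_generator : forall f g, in_l2 f -> in_l2 g ->
    (l2norm (fun x => t^-1 * (P t f x - f x) + g x) @[t --> 0^'+] --> (0 : R))
    <-> operator_L f g
}.

(** [heat_extension P t f g]: the extension of the semigroup to the function
    [f >= 0] sends it to [g], as the limit along any exhaustion of [f] by
    finitely supported functions (one always exists, X being countable). *)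
Definition heat_extension (P : R -> (X -> R) -> (X -> R)) (t : R) f
    (g : X -> \bar R) : Prop :=
  forall fn : nat -> X -> R,
    (forall n, finitely_supported (fn n)) ->
    (forall n, positive (fn n)) ->
    (forall n x, fn n x <= fn n.+1 x) ->
    (forall x, fn n x @[n --> \oo] --> f x) ->
    forall x, (P t (fn n) x)%:E @[n --> \oo] --> g x.

Definition stochastically_complete : Prop :=
  exists P, is_heat_semigroup P /\
    exists t : R, 0 < t /\ heat_extension P t (fun _ => 1) (fun _ => 1%:E).

(** Pointwise solutions of the generalized porous medium equation. Only the
    values of [u t] for t in [0, T] are relevant. *)

Definition pointwise_solution (phi : R -> R) (T : R) (u0 : X -> R)
    (u : R -> X -> R) : Prop :=
  [/\ forall t, 0 < t < T -> in_F (phi \o u t),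
      forall x, {within `[0, T], continuous (fun t => u t x)},
      forall x t, 0 < t < T -> derivable (fun s => u s x) t 1
        /\ {for t, continuous (derive1 (fun s => u s x))},
      forall t x, 0 < t < T ->
        derive1 (fun s => u s x) t + laplacian (phi \o u t) x = 0
    & forall x, u 0 x = u0 x].

Definition bounded_positive_on (T : R) (u : R -> X -> R) : Prop :=
  (exists M : R, forall t x, 0 <= t <= T -> `|u t x| <= M) /\
  (forall t x, 0 <= t <= T -> 0 <= u t x).

Definition bp_solution (phi : R -> R) (T : R) (u0 : X -> R)
    (u : R -> X -> R) : Prop :=
  pointwise_solution phi T u0 u /\ bounded_positive_on T u.

Definition conserves_mass (T : R) (u0 : X -> R) (u : R -> X -> R) : Prop :=
  forall t, 0 <= t <= T -> mass (u t) = mass u0.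

End Graph.

(** The class of nonlinearities. *)
Definition nonlinearity (R : realType) (phi : R -> R) : Prop :=
  [/\ continuous phi,
      forall s1 s2, s1 < s2 -> phi s1 <= phi s2,
      exists s1 s2, phi s1 <> phi s2
    & phi 0 = 0].

(* Main.v *)
Require Import Defs.
From HB Require Import structures.
From mathcomp Require Import all_boot all_order all_algebra.
From mathcomp Require Import all_classical all_reals all_analysis.
From mathcomp Require Import ring lra.
Set Implicit Arguments.
Unset Strict Implicit.
Unset Printing Implicit Defensive.
Import Order.TTheory GRing.Theory Num.Theory.
Import numFieldNormedType.Exports.
Local Open Scope classical_set_scope.
Local Open Scope ring_scope.

(* Call [G] recurrent if for every vertex [o] there are finitely supported [g]
   with [g o = 1] and arbitrarily small energy. When [mu] is finite, this is
   stochastic completeness: cutoffs of such [g] show [L 1 = 0], hence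
   [exp(-tL) 1 = 1]; conversely, if [exp(-TL) 1 = 1], then [h = (1 + L)^-1 1]
   has a periodic orbit, along which the norm does not increase, so that
   [<L h, h> = 0], [h] is constant, and [1] lies in the form domain.
   On a recurrent graph the equilibrium potentials [e_n] of finite sets satisfy
   [sum |L e_n| mu -> 0], and testing the equation against [e_n] gives
   conservation of mass.
   If [G] is not recurrent, solve the equation on finite sets of vertices with
   the constant boundary value [b]. In the limit this yields bounded solutions
   with the same initial datum that depend on [b]: if [phi b1 < phi b2] and [z]
   is the difference of the two solutions, then
   [W = t (phi b2 - phi b1) - int_0^t (phi u2 - phi u1)] is finitely supported
   before the limit and solves [Lap W = z], so
   [cap W(o)^2 <= Q(W, W) = <W, z>], which for small [t] bounds the mass of [z]
   from below. All the nonuniqueness statements are choices of [b1], [b2], with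
   the comparison principle. *)

(** * Absolutely summable families *)

(** Stochastic completeness provides only some family [P] with the listed properties, each [P t]
    being bounded by a constant that may depend on [t]. One direction must therefore construct the
    semigroup of [L], by resolvents and the exponential formula. The other must handle an arbitrary
    [P]: the periodic orbit argument rests on the generator and on right continuity at time zero,
    and the missing continuity of orbits from the left is what Baire supplies. The nonlinearity is
    only continuous and may be flat on intervals. It is replaced by Lipschitz functions from below,
    refined together with the finite set and the time step in a single limit; the time step shrinks
    with the largest ratio of degree to measure on the set. Solutions are not unique, so a
    comparison principle cannot be applied to the equation itself. It is proved for the discrete
    scheme, where it is a consequence of the small time step, and survives in the limit for the
    solutions constructed. The energy estimate is also discrete, because there the test function has
    finite support and the capacity bound applies to it. *)

Definition abs_summable (R : realType) (T : choiceType) (f : T -> R) : Prop :=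
  (\esum_(x in [set: T]) (`|f x|)%:E < +oo)%E.

Section Sums.
Variables (R : realType) (T : choiceType).
Implicit Types f g h : T -> R.

Lemma abs_summable_le f g :
  (forall x, `|f x| <= `|g x|) -> abs_summable g -> abs_summable f.
Proof.
move=> fg; apply: le_lt_trans; apply: le_esum => x _; by rewrite lee_fin.
Qed.

Lemma abs_summableD f g :
  abs_summable f -> abs_summable g -> abs_summable (fun x => f x + g x).
Proof.
rewrite /abs_summable => sf sg.
apply: (@le_lt_trans _ _ (\esum_(x in [set: T]) ((`|f x|)%:E + (`|g x|)%:E))%E).
  by apply: le_esum => x _; rewrite -EFinD lee_fin ler_normD.
by rewrite esumD ?lte_add_pinfty// => x _; rewrite lee_fin.
Qed.

Lemma abs_summableZ (a : R) f :
  abs_summable f -> abs_summable (fun x => a * f x).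
Proof.
rewrite /abs_summable => sf.
suff [C hC] : exists C : R, (\esum_(x in [set: T]) (`|a * f x|)%:E <= C%:E)%E.
  exact: le_lt_trans hC (ltry _).
have sff : (\esum_(x in [set: T]) (`|f x|)%:E)%E \is a fin_num.
  by rewrite ge0_fin_numE// esum_ge0// => x _; rewrite lee_fin.
exists (`|a| * fine (\esum_(x in [set: T]) (`|f x|)%:E)%E).
apply: ge_ereal_sup => _ /= [A [finA _]] <-.
rewrite fsbig_finite//= sumEFin lee_fin.
under eq_bigr do rewrite normrM.
rewrite -mulr_sumr ler_wpM2l// -lee_fin fineK// -sumEFin.
by apply: ereal_sup_ubound; exists A; [split|rewrite fsbig_finite].
Qed.

Lemma abs_summableN f : abs_summable f -> abs_summable (fun x => - f x).
Proof. by apply: abs_summable_le => x; rewrite normrN. Qed.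

Lemma abs_summableB f g :
  abs_summable f -> abs_summable g -> abs_summable (fun x => f x - g x).
Proof. by move=> sf /abs_summableN; exact: abs_summableD. Qed.

Lemma abs_summable_abs f : abs_summable f -> abs_summable (fun x => `|f x|).
Proof. by apply: abs_summable_le => x; rewrite normr_id. Qed.

Lemma abs_summable_cst0 : abs_summable (fun _ : T => 0 : R).
Proof. by rewrite /abs_summable esum1// => x _; rewrite normr0. Qed.

Let esumf f := (\esum_(x in [set: T]) (f x)%:E)%E.

Let esumf_fin f : (forall x, 0 <= f x) -> abs_summable f ->
  esumf f = (fine (esumf f))%:E.
Proof.
move=> f0; rewrite /abs_summable.
rewrite (_ : (\esum_(x in [set: T]) (`|f x|)%:E)%E = esumf f); last first.
  by apply: eq_esum => x _; rewrite ger0_norm.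
move=> sf; rewrite fineK// ge0_fin_numE// esum_ge0// => x _.
by rewrite lee_fin.
Qed.

(** The positive and negative parts of [g - h] satisfy [fp + h = fm + g], an identity between
    nonnegative families, for which [esum] is additive. All linearity of [tsum] rests on this
    independence of the decomposition. *)
Lemma tsum_split g h : (forall x, 0 <= g x) -> (forall x, 0 <= h x) ->
  abs_summable g -> abs_summable h ->
  tsum (fun x => g x - h x) = fine (esumf g) - fine (esumf h).
Proof.
move=> g0 h0 sg sh; rewrite /tsum.
set fp := fun x => Num.max (g x - h x) 0.
set fm := fun x => Num.max (- (g x - h x)) 0.
have fp0 x : 0 <= fp x by rewrite le_max lexx orbT.
have fm0 x : 0 <= fm x by rewrite le_max lexx orbT.
have sfp : abs_summable fp.
  apply: abs_summable_le (abs_summableB sg sh) => x; rewrite /fp.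
  by case: (leP (g x - h x) 0); rewrite ?normr0.
have sfm : abs_summable fm.
  apply: abs_summable_le (abs_summableB sg sh) => x; rewrite /fm.
  by case: (leP (- (g x - h x)) 0); rewrite ?normr0// normrN.
have : (esumf fp + esumf h = esumf fm + esumf g)%E.
  rewrite /esumf -!esumD; do ?by [move=> x _; rewrite lee_fin].
  apply: eq_esum => x _; rewrite -!EFinD; congr EFin; rewrite /fp /fm.
  case: (leP (g x - h x) 0); case: (leP (- (g x - h x)) 0); lra.
rewrite esumf_fin// [esumf h]esumf_fin// [esumf fm]esumf_fin//.
rewrite [esumf g]esumf_fin// -!EFinD => -[].
rewrite -/(esumf fp) -/(esumf fm); lra.
Qed.

Lemma tsum_ge0E f : (forall x, 0 <= f x) -> tsum f = fine (esumf f).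
Proof.
move=> f0; rewrite /tsum [X in _ - fine X]esum1 ?subr0.
  by congr fine; apply: eq_esum => x _; congr EFin; apply/max_idPl.
by move=> x _; congr EFin; apply/max_idPr; rewrite oppr_le0.
Qed.

Lemma tsum_ge0_EFin f : (forall x, 0 <= f x) -> abs_summable f ->
  (\esum_(x in [set: T]) (f x)%:E)%E = (tsum f)%:E.
Proof. by move=> f0 sf; rewrite tsum_ge0E// -esumf_fin. Qed.

Lemma abs_summable_ge0 f : (forall x, 0 <= f x) ->
  abs_summable f <-> (\esum_(x in [set: T]) (f x)%:E < +oo)%E.
Proof.
move=> f0; rewrite /abs_summable.
by under eq_esum do rewrite ger0_norm//.
Qed.

Lemma eq_tsum f g : (forall x, f x = g x) -> tsum f = tsum g.
Proof. by move=> fg; congr tsum; apply/funext. Qed.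

Let pos f x := Num.max (f x) 0.
Let neg f x := Num.max (- f x) 0.

Let pos_ge0 f x : 0 <= pos f x. Proof. by rewrite le_max lexx orbT. Qed.
Let neg_ge0 f x : 0 <= neg f x. Proof. by rewrite le_max lexx orbT. Qed.
Let pos_negE f x : f x = pos f x - neg f x.
Proof. rewrite /pos /neg; case: (leP (f x) 0); case: (leP (- f x) 0); lra. Qed.
Let pos_sum f : abs_summable f -> abs_summable (pos f).
Proof.
apply: abs_summable_le => x; rewrite /pos.
by case: (leP (f x) 0); rewrite ?normr0.
Qed.
Let neg_sum f : abs_summable f -> abs_summable (neg f).
Proof.
apply: abs_summable_le => x; rewrite /neg.
by case: (leP (- f x) 0); rewrite ?normr0// normrN.
Qed.
Let fine_esumD f g : (forall x, 0 <= f x) -> (forall x, 0 <= g x) ->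
  abs_summable f -> abs_summable g ->
  fine (esumf (fun x => f x + g x)) = fine (esumf f) + fine (esumf g).
Proof.
move=> f0 g0 sf sg; rewrite {1}/esumf.
under eq_esum do rewrite EFinD.
rewrite esumD; do ?by [move=> x _; rewrite lee_fin].
by rewrite -/(esumf f) -/(esumf g) esumf_fin// [esumf g]esumf_fin.
Qed.

Lemma tsumN f : tsum (fun x => - f x) = - tsum f.
Proof.
rewrite /tsum opprB; congr (_ - _); congr fine.
by apply: eq_esum => x _; rewrite opprK.
Qed.

Lemma tsumD f g : abs_summable f -> abs_summable g ->
  tsum (fun x => f x + g x) = tsum f + tsum g.
Proof.
move=> sf sg.
rewrite (@eq_tsum _ (fun x => (pos f x + pos g x) - (neg f x + neg g x))); last first.
  by move=> x; rewrite (pos_negE f) (pos_negE g); ring.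
have psf := pos_sum sf; have psg := pos_sum sg.
have nsf := neg_sum sf; have nsg := neg_sum sg.
rewrite (@tsum_split (fun x => pos f x + pos g x) (fun x => neg f x + neg g x)); first last.
- exact: abs_summableD.
- exact: abs_summableD.
- by move=> x; rewrite addr_ge0.
- by move=> x; rewrite addr_ge0.
have -> := @fine_esumD (pos f) (pos g) (pos_ge0 f) (pos_ge0 g) psf psg.
have -> := @fine_esumD (neg f) (neg g) (neg_ge0 f) (neg_ge0 g) nsf nsg.
rewrite /tsum -/(esumf (pos f)) -/(esumf (pos g)).
rewrite -/(esumf (neg f)) -/(esumf (neg g)); ring.
Qed.

Lemma tsumB f g : abs_summable f -> abs_summable g ->
  tsum (fun x => f x - g x) = tsum f - tsum g.
Proof.
by move=> sf sg; rewrite tsumD//; [rewrite tsumN|exact: abs_summableN].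
Qed.

Lemma tsum_ge0 f : (forall x, 0 <= f x) -> 0 <= tsum f.
Proof.
move=> f0; rewrite tsum_ge0E//; apply: fine_ge0; apply: esum_ge0 => x _.
by rewrite lee_fin.
Qed.

Lemma le_tsum f g : abs_summable f -> abs_summable g ->
  (forall x, f x <= g x) -> tsum f <= tsum g.
Proof.
move=> sf sg fg; rewrite -subr_ge0 -tsumB// tsum_ge0// => x.
by rewrite subr_ge0.
Qed.

Lemma ler_norm_tsum f : abs_summable f -> `|tsum f| <= tsum (fun x => `|f x|).
Proof.
move=> sf; have sa := abs_summable_abs sf.
rewrite ler_norml; apply/andP; split; last by apply: le_tsum => // x; exact: ler_norm.
rewrite -tsumN; apply: le_tsum => //; first exact: abs_summableN.
by move=> x; rewrite lerNl -normrN ler_norm.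
Qed.

Lemma abs_summable_bound (C : R) f : (forall x, 0 <= f x) ->
  (forall s : seq T, uniq s -> \sum_(x <- s) f x <= C) ->
  abs_summable f /\ tsum f <= C.
Proof.
move=> f0 fC.
have hC : (\esum_(x in [set: T]) (f x)%:E <= C%:E)%E.
  apply: ge_ereal_sup => _ /= [A [finA _]] <-.
  by rewrite fsbig_finite//= sumEFin lee_fin fC.
have sf : abs_summable f by apply/abs_summable_ge0 => //; exact: le_lt_trans hC (ltry _).
by split=> //; rewrite -lee_fin -tsum_ge0_EFin.
Qed.

Lemma sum_le_tsum f (s : seq T) : (forall x, 0 <= f x) -> abs_summable f ->
  uniq s -> \sum_(x <- s) f x <= tsum f.
Proof.
move=> f0 sf us; rewrite -lee_fin -tsum_ge0_EFin//; apply: esum_ge.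
exists [set` s]; first by split => //; exact: finite_seq.
by rewrite -fsbig_seq// sumEFin.
Qed.

Lemma le_term_tsum f x : (forall x, 0 <= f x) -> abs_summable f -> f x <= tsum f.
Proof.
by move=> f0 sf; have := @sum_le_tsum f [:: x] f0 sf isT; rewrite big_seq1.
Qed.

Lemma tsum_finite f (s : seq T) : uniq s -> (forall x, x \notin s -> f x = 0) ->
  abs_summable f /\ tsum f = \sum_(x <- s) f x.
Proof.
move=> us fs.
have H g : (forall x, 0 <= g x) -> (forall x, x \notin s -> g x = 0) ->
    abs_summable g /\ tsum g = \sum_(x <- s) g x.
  move=> g0 gs; have [sg gle] : abs_summable g /\ tsum g <= \sum_(x <- s) g x.
    apply: abs_summable_bound => // r ur.
    rewrite (bigID [in s])/= [X in _ + X]big1 ?addr0//.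
    rewrite -big_filter (perm_big [seq x <- s | x \in r]); last first.
      apply: uniq_perm; rewrite ?filter_uniq// => x.
      by rewrite !mem_filter andbC.
    by rewrite big_filter [leRHS](bigID [in r])/= lerDl sumr_ge0.
  by split => //; apply/eqP; rewrite eq_le gle/= sum_le_tsum.
have [sp tp] : abs_summable (pos f) /\ tsum (pos f) = \sum_(x <- s) pos f x.
  by apply: H => // x /fs; rewrite /pos => ->; rewrite maxxx.
have [sn tn] : abs_summable (neg f) /\ tsum (neg f) = \sum_(x <- s) neg f x.
  by apply: H => // x /fs; rewrite /neg => ->; rewrite oppr0 maxxx.
have -> : f = fun x => pos f x - neg f x by apply/funext => x; exact: pos_negE.
by split; [exact: abs_summableB|rewrite tsumB// tp tn sumrB].
Qed.

Lemma tsum0 f : (forall x, f x = 0) -> tsum f = 0.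
Proof.
by move=> f0; have [_ ->] := @tsum_finite f [::] isT (fun x _ => f0 x); rewrite big_nil.
Qed.

Lemma tsumZ (a : R) f : abs_summable f -> tsum (fun x => a * f x) = a * tsum f.
Proof.
have H b g : 0 <= b -> (forall x, 0 <= g x) -> abs_summable g ->
    tsum (fun x => b * g x) <= b * tsum g.
  move=> b0 g0 sg; apply: (@abs_summable_bound _ (fun x => b * g x) _ _).2.
    by move=> x; rewrite mulr_ge0.
  by move=> s us; rewrite -mulr_sumr ler_wpM2l// sum_le_tsum.
(* The reverse inequality is [H] for the scalar [b^-1] and the family [b * g]. *)
have K b g : 0 <= b -> (forall x, 0 <= g x) -> abs_summable g ->
    tsum (fun x => b * g x) = b * tsum g.
  move=> b0 g0 sg; have [->|bn0] := eqVneq b 0.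
    by rewrite mul0r tsum0// => x; rewrite mul0r.
  have bp : 0 < b by rewrite lt_def bn0.
  apply/eqP; rewrite eq_le H//= -ler_pdivlMl//.
  have := @H b^-1 (fun x => b * g x); rewrite invr_ge0 => /(_ b0) h.
  rewrite {1}(@eq_tsum g (fun x => b^-1 * (b * g x))); last first.
    by move=> x; rewrite mulKf.
  by apply: h => [x|]; [rewrite mulr_ge0|exact: abs_summableZ].
have P b g : 0 <= b -> abs_summable g -> tsum (fun x => b * g x) = b * tsum g.
  move=> b0 sg; have psg := pos_sum sg; have nsg := neg_sum sg.
  rewrite (@eq_tsum _ (fun x => b * pos g x - b * neg g x)); last first.
    by move=> x; rewrite (pos_negE g) mulrBr.
  rewrite (tsumB (abs_summableZ _ psg) (abs_summableZ _ nsg)) !K//.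
  rewrite -mulrBr -tsumB//; congr (_ * _).
  by apply: eq_tsum => x; rewrite -pos_negE.
move=> sf; have [a0|a0] := leP 0 a; first exact: P.
rewrite (@eq_tsum _ (fun x => - (- a * f x))); last by move=> x; rewrite mulNr opprK.
by rewrite tsumN P ?oppr_ge0 1?ltW// mulNr opprK.
Qed.

Lemma tsum_tail f (e : R) : (forall x, 0 <= f x) -> abs_summable f -> 0 < e ->
  exists2 s : seq T, uniq s &
    tsum (fun x => if x \in s then 0 else f x) <= e.
Proof.
move=> f0 sf e0.
have : ((tsum f - e)%:E < \esum_(x in [set: T]) (f x)%:E)%E.
  by rewrite tsum_ge0_EFin// lte_fin ltrBlDr ltrDl.
move=> /ereal_sup_gt[_ [A [finA _]] <-]; rewrite fsbig_finite//= sumEFin lte_fin => hA.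
exists (finmap.enum_fset (fset_set A)); first exact: finmap.fset_uniq.
set s := finmap.enum_fset (fset_set A) in hA *.
have [sg gE] := @tsum_finite (fun x => if x \in s then f x else 0) s (finmap.fset_uniq _)
  ltac:(by move=> x /negbTE ->).
have -> : tsum (fun x => if x \in s then 0 else f x) =
    tsum f - \sum_(x <- s) f x.
  rewrite [X in _ - X](_ : _ = \sum_(x <- s) if x \in s then f x else 0); last first.
    by rewrite !big_seq; apply: eq_bigr => x ->.
  rewrite -gE -tsumB//; apply: eq_tsum => x.
  by case: ifP; rewrite ?subrr ?subr0.
move: hA; lra.
Qed.

Lemma abs_summableM m (K : R) f : abs_summable m -> (forall x, `|f x| <= K) ->
  abs_summable (fun x => m x * f x).
Proof.
move=> sm fK; apply: abs_summable_le (abs_summableZ K sm) => x.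
rewrite !normrM mulrC ler_wpM2r//; exact: le_trans (fK x) (ler_norm _).
Qed.

(* Dominated convergence, in a form that is uniform in the family. *)
Lemma tsum_small m (K e : R) : (forall x, 0 <= m x) -> abs_summable m -> 0 < e ->
  exists2 s : seq T, uniq s & exists2 d : R, 0 < d & forall f,
    (forall x, `|f x| <= K) -> (forall x, x \in s -> `|f x| <= d) ->
    abs_summable (fun x => m x * f x) /\ tsum (fun x => m x * `|f x|) <= e.
Proof.
move=> m0 sm e0.
set K' := `|K| + 1; have K'0 : 0 < K' by rewrite ltr_wpDl.
have [|s us hs] := @tsum_tail m (e / (2 * K')) m0 sm; first by rewrite divr_gt0// mulr_gt0.
set M := tsum m + 1; have M0 : 0 < M by rewrite ltr_wpDl// tsum_ge0.
exists s => //; exists (e / (2 * M)); first by rewrite divr_gt0// mulr_gt0.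
move=> f fK fs.
have fK' x : `|f x| <= K'.
  by rewrite (le_trans (fK x))// (le_trans (ler_norm _))// /K' lerDl.
have smf : abs_summable (fun x => m x * f x).
  apply: abs_summable_le (abs_summableZ K' sm) => x.
  by rewrite !normrM mulrC ler_wpM2r// (gtr0_norm K'0).
split=> //.
have smt : abs_summable (fun x => if x \in s then 0 else m x).
  by apply: abs_summable_le sm => x; case: ifP; rewrite ?normr0.
have -> : tsum (fun x => m x * `|f x|) = tsum (fun x => `|m x * f x|).
  by apply: eq_tsum => x; rewrite normrM (ger0_norm (m0 x)).
apply: (@le_trans _ _ (tsum (fun x =>
    e / (2 * M) * m x + K' * (if x \in s then 0 else m x)))).
  apply: le_tsum.
  - exact: abs_summable_abs.
  - by apply: abs_summableD; apply: abs_summableZ.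
  move=> x; rewrite normrM (ger0_norm (m0 x)) mulrC; case: ifPn => xs.
    by rewrite mulr0 addr0 ler_wpM2r// fs.
  rewrite -[leLHS]add0r; apply: lerD; last by rewrite ler_wpM2r.
  by rewrite mulr_ge0// divr_ge0 ?ltW// mulr_gt0.
rewrite (tsumD (abs_summableZ _ sm) (abs_summableZ _ smt)) !tsumZ//.
rewrite [leRHS]splitr.
apply: lerD.
  apply: (@le_trans _ _ (e / (2 * M) * M)).
    by rewrite ler_wpM2l ?divr_ge0 ?ltW ?mulr_gt0// /M ltrDl.
  by rewrite le_eqVlt; apply/orP; left; apply/eqP; field; rewrite gt_eqF.
apply: (@le_trans _ _ (K' * (e / (2 * K')))); first by rewrite ler_wpM2l// ltW.
by rewrite le_eqVlt; apply/orP; left; apply/eqP; field; rewrite gt_eqF.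
Qed.

(** General filters matter: through [cvg_tsum_mul], sums pass to the limit below along an
    ultrafilter and as time tends to a given instant. *)
Lemma cvg_tsum {I : Type} (F : set_system I) {FF : Filter F} m (K : R)
    (f : I -> T -> R) :
  (forall x, 0 <= m x) -> abs_summable m ->
  (\forall i \near F, forall x, `|f i x| <= K) ->
  (forall x, f i x @[i --> F] --> (0 : R)) ->
  tsum (fun x => m x * `|f i x|) @[i --> F] --> (0 : R).
Proof.
move=> m0 sm fK f0; apply/cvgrPdist_le => e e0.
have [s us [d d0 H]] := @tsum_small m K e m0 sm e0.
have : \forall i \near F, forall x, x \in s -> `|f i x| <= d.
  elim: s {us H} => [|y s IH]; first by near=> i.
  have hy : \forall i \near F, `|f i y| <= d.
    have /cvgrPdist_le/(_ d d0) := f0 y.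
    by apply: filterS => i; rewrite sub0r normrN.
  near=> i => x; rewrite inE => /orP[/eqP ->|xs]; first by near: i.
  by move: x xs; near: i.
move=> h; near=> i.
rewrite sub0r normrN ger0_norm; last by apply: tsum_ge0 => x; rewrite mulr_ge0.
apply: (H _ _ _).2; near: i => //.
Unshelve. all: by end_near. Qed.

Lemma cvg_tsum_mul {I : Type} (F : set_system I) {FF : Filter F} m (K : R)
    (f : I -> T -> R) (g : T -> R) :
  (forall x, 0 <= m x) -> abs_summable m ->
  (forall i x, `|f i x| <= K) -> (forall x, `|g x| <= K) ->
  (forall x, f i x @[i --> F] --> g x) ->
  tsum (fun x => m x * f i x) @[i --> F] --> tsum (fun x => m x * g x).
Proof.
move=> m0 sm fK gK fg.
have h0 : tsum (fun x => m x * `|f i x - g x|) @[i --> F] --> (0 : R).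
  apply: (@cvg_tsum _ _ _ m (K + K)) => //.
    by apply: nearW => i x; rewrite (le_trans (ler_normB _ _))// lerD.
  by move=> x; rewrite -(subrr (g x)); apply: cvgB => //; exact: cvg_cst.
apply/cvgrPdist_le => e e0; have /cvgrPdist_le/(_ e e0) := h0.
apply: filterS => i; rewrite sub0r normrN ger0_norm; last first.
  by apply: tsum_ge0 => x; rewrite mulr_ge0.
move=> h; apply: le_trans h.
rewrite distrC -tsumB; [|exact: (abs_summableM sm (fK i))|exact: (abs_summableM sm gK)].
have sfg : abs_summable (fun x => m x * f i x - m x * g x).
  by apply: abs_summableB; [exact: (abs_summableM sm (fK i))|exact: (abs_summableM sm gK)].
apply: le_trans (ler_norm_tsum sfg) _.
rewrite le_eqVlt; apply/orP; left; apply/eqP; apply: eq_tsum => x.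
by rewrite -mulrBr normrM (ger0_norm (m0 x)).
Qed.

End Sums.

(** * Fubini and Tonelli for sums over pairs *)

Section DoubleSums.
Variables (R : realType) (S T : choiceType).
Implicit Types f : S * T -> R.

Let tsum_pair_ge0 f : (forall p, 0 <= f p) -> abs_summable f ->
  [/\ forall x, abs_summable (fun y => f (x, y)),
      abs_summable (fun x => tsum (fun y => f (x, y)))
    & tsum f = tsum (fun x => tsum (fun y => f (x, y)))].
Proof.
move=> f0 sf; have := sf; rewrite abs_summable_ge0// => sf'.
have E : (\esum_(x in [set: S]) \esum_(y in [set: T]) (f (x, y))%:E =
          \esum_(p in [set: S * T]) (f p)%:E)%E.
  rewrite (@esum_esum _ _ _ [set: S] (fun=> [set: T]) (fun x y => (f (x, y))%:E)); last first.
    by move=> x y _ _; rewrite lee_fin.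
  rewrite (_ : [set: S] `*`` _ = [set: S * T]); last by apply/seteqP; split.
  by apply: eq_esum => -[].
have sx x : abs_summable (fun y => f (x, y)).
  apply/abs_summable_ge0 => //.
  apply: le_lt_trans sf'; rewrite -E.
  apply: (@le_trans _ _ (\esum_(x in [set x]) \esum_(y in [set: T]) (f (x, y))%:E)%E).
    by rewrite esum_set1// esum_ge0// => y _; rewrite lee_fin.
  rewrite esum_mkcond; apply: le_esum => z _; case: ifP => // _.
  by apply: esum_ge0 => y _; rewrite lee_fin.
have E' : (\esum_(x in [set: S]) (tsum (fun y => f (x, y)))%:E =
          \esum_(p in [set: S * T]) (f p)%:E)%E.
  by rewrite -E; apply: eq_esum => x _; rewrite tsum_ge0_EFin.
split=> //; first by apply/abs_summable_ge0 => [x|]; [exact: tsum_ge0|rewrite E'].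
have h0 x : 0 <= tsum (fun y => f (x, y)) by exact: tsum_ge0.
apply: EFin_inj; rewrite -tsum_ge0_EFin// -E' tsum_ge0_EFin//.
by apply/abs_summable_ge0 => //; rewrite E'.
Qed.

Lemma tsum_pair f : abs_summable f ->
  [/\ forall x, abs_summable (fun y => f (x, y)),
      abs_summable (fun x => tsum (fun y => f (x, y)))
    & tsum f = tsum (fun x => tsum (fun y => f (x, y)))].
Proof.
move=> sf.
set p := fun z => Num.max (f z) 0; set n := fun z => Num.max (- f z) 0.
have fE z : f z = p z - n z.
  rewrite /p /n; case: (leP (f z) 0); case: (leP (- f z) 0); lra.
have p0 z : 0 <= p z by rewrite le_max lexx orbT.
have n0 z : 0 <= n z by rewrite le_max lexx orbT.
have sp : abs_summable p.
  apply: abs_summable_le sf => z; rewrite /p.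
  by case: (leP (f z) 0); rewrite ?normr0.
have sn : abs_summable n.
  apply: abs_summable_le sf => z; rewrite /n.
  by case: (leP (- f z) 0); rewrite ?normr0// normrN.
have [p1 p2 p3] := tsum_pair_ge0 p0 sp.
have [n1 n2 n3] := tsum_pair_ge0 n0 sn.
have fx x : (fun y => f (x, y)) = (fun y => p (x, y) - n (x, y)).
  by apply/funext => y.
have E x : tsum (fun y => f (x, y)) = tsum (fun y => p (x, y)) - tsum (fun y => n (x, y)).
  by rewrite fx tsumB.
split.
- by move=> x; rewrite fx; exact: abs_summableB.
- rewrite (_ : (fun x => _) = (fun x => tsum (fun y => p (x, y)) - tsum (fun y => n (x, y)))).
    exact: abs_summableB.
  exact/funext.
- have -> : tsum f = tsum p - tsum n by rewrite (eq_tsum fE) tsumB.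
  by rewrite p3 n3 -tsumB//; apply: eq_tsum => x; rewrite E.
Qed.

Lemma abs_summable_pair f : (forall p, 0 <= f p) ->
  (forall x, abs_summable (fun y => f (x, y))) ->
  abs_summable (fun x => tsum (fun y => f (x, y))) -> abs_summable f.
Proof.
move=> f0 fx; rewrite !abs_summable_ge0//; last by move=> x; exact: tsum_ge0.
rewrite (_ : (\esum_(x in [set: S]) _)%E =
   (\esum_(x in [set: S]) \esum_(y in [set: T]) (f (x, y))%:E)%E); last first.
  by apply: eq_esum => x _; rewrite tsum_ge0_EFin.
rewrite (@esum_esum _ _ _ [set: S] (fun=> [set: T]) (fun x y => (f (x, y))%:E)); last first.
  by move=> x y _ _; rewrite lee_fin.
rewrite (_ : [set: S] `*`` _ = [set: S * T]); last by apply/seteqP; split.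
by under eq_esum do rewrite -surjective_pairing.
Qed.

Let swap_esum (h : S * T -> R) :
  (\esum_(p in [set: S * T]) (h p)%:E = \esum_(p in [set: T * S]) (h (p.2, p.1))%:E)%E.
Proof.
rewrite (@reindex_esum _ _ _ [set: T * S] [set: S * T] (fun p => (p.2, p.1)))//.
split=> //=; first by move=> [a b] [c d] _ _ [-> ->].
by move=> [a b] _; exists (b, a).
Qed.

Lemma tsum_swap f : tsum f = tsum (fun p : T * S => f (p.2, p.1)).
Proof.
rewrite /tsum; congr (fine _ - fine _).
  exact: (swap_esum (fun p => Num.max (f p) 0)).
exact: (swap_esum (fun p => Num.max (- f p) 0)).
Qed.

Lemma abs_summable_swap f : abs_summable f ->
  abs_summable (fun p : T * S => f (p.2, p.1)).
Proof. by rewrite /abs_summable (swap_esum (fun p => `|f p|)). Qed.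

End DoubleSums.

(** * Exponential formula for semigroups *)

(** Telescoping: [U] transports earlier errors without amplifying them, so [m] steps cost at most
    [m * e]. The set [E], invariant under [V], restricts the one-step estimate to the points where
    it is available. *)
Lemma iter_near (R : realFieldType) (H : normedModType R) (U V : H -> H)
    (E : set H) (e : R) :
  (forall x y, `|U x - U y| <= `|x - y|) -> (forall x, E x -> E (V x)) ->
  (forall x, E x -> `|U x - V x| <= e) ->
  forall m f, E f -> `|iter m U f - iter m V f| <= m%:R * e.
Proof.
move=> U1 VE UV m f Ef.
have VmE k : E (iter k V f) by elim: k => //= k; exact: VE.
elim: m => [|m IH]; first by rewrite subrr normr0 mul0r.
rewrite !iterS -(subrKA (U (iter m V f))) (le_trans (ler_normD _ _))//.
by rewrite -natr1 mulrDl mul1r lerD// ?(le_trans (U1 _ _))// UV.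
Qed.

Lemma iter_comm (T : Type) (U V : T -> T) : (forall x, U (V x) = V (U x)) ->
  forall m x, iter m U (iter m V x) = iter m (fun x => U (V x)) x.
Proof.
move=> UV; have UVm k x : U (iter k V x) = iter k V (U x).
  by elim: k x => //= k IH x; rewrite UV IH.
elim=> // m IH x; rewrite [RHS]iterSr -IH -[in RHS]UVm iterS [iter m.+1 V x]iterSr.
by rewrite -iterS iterSr.
Qed.

(* The exponential formula for the contraction semigroup generated by [-A],
   where the (possibly multivalued) operator [A] is given by its graph. *)
Section HilleYosida.
Variables (R : realType) (H : completeNormedModType R) (A : H -> H -> Prop).
Hypothesis A_lin : forall a x y x' y', A x y -> A x' y' ->
  A (a *: x + x') (a *: y + y').
Hypothesis A_acc : forall (a : R) x y, 0 <= a -> A x y -> `|x| <= `|x + a *: y|.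
Hypothesis A_range : forall (a : R) f, 0 < a -> exists x y, A x y /\ x + a *: y = f.
Hypothesis A_dense : forall f (e : R), 0 < e -> exists x y, A x y /\ `|f - x| <= e.

(** The branch [a <= 0] makes [G 0] the identity, so that the resolvent estimates, and with them the
    exponential formula, cover the time [0]. *)
Let resolvent_ex (a : R) f : exists x : H, if 0 < a then exists y, A x y /\ x + a *: y = f
  else x = f.
Proof. by have [a0|a0] := ltP 0 a; [exact: A_range|exists f]. Qed.

Definition resolvent a f := sval (cid (resolvent_ex a f)).

Local Notation G := resolvent.

Lemma resolventP (a : R) f : 0 < a -> exists y, A (G a f) y /\ G a f + a *: y = f.
Proof. by move=> a0; rewrite /G; case: cid => /= x; rewrite a0. Qed.

Let AD x y x' y' : A x y -> A x' y' -> A (x + x') (y + y').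
Proof. by move=> h h'; have := A_lin 1 h h'; rewrite !scale1r. Qed.

Let AB x y x' y' : A x y -> A x' y' -> A (x - x') (y - y').
Proof.
by move=> h h'; have := A_lin (-1) h' h; rewrite !scaleN1r addrC [- _ + _]addrC.
Qed.

Let A0 : A 0 0.
Proof.
have [x [y [h _]]] := @A_range 1 0 ltr01.
by have := AB h h; rewrite !subrr.
Qed.

Let AZ a x y : A x y -> A (a *: x) (a *: y).
Proof. by move=> h; have := A_lin a h A0; rewrite !addr0. Qed.

Lemma resolvent_unique a x y : 0 <= a -> A x y -> G a (x + a *: y) = x.
Proof.
move=> a0 xy; have [a_gt0|] := ltP 0 a; last first.
  move=> a0'; have -> : a = 0 by apply/eqP; rewrite eq_le a0 a0'.
  by rewrite scale0r addr0 /G; case: cid => z /=; rewrite ltxx.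
have [y' [h e]] := resolventP (x + a *: y) a_gt0.
apply/eqP; rewrite -subr_eq0 -normr_eq0 eq_le normr_ge0 andbT.
rewrite (le_trans (A_acc a0 (AB h xy)))//.
by rewrite scalerBr addrACA -opprD e subrr normr0.
Qed.

Let resolvent0 f : G 0 f = f.
Proof. by rewrite /G; case: cid => z /=; rewrite ltxx. Qed.

Lemma resolvent_contr a f : 0 <= a -> `|G a f| <= `|f|.
Proof.
rewrite le_eqVlt => /orP[/eqP <-|a0]; first by rewrite resolvent0.
by have [y [h {2}<-]] := resolventP f a0; exact: A_acc (ltW a0) h.
Qed.

Lemma resolvent_linear a (b : R) f g : 0 <= a ->
  G a (b *: f + g) = b *: G a f + G a g.
Proof.
rewrite le_eqVlt => /orP[/eqP <-|a0]; first by rewrite !resolvent0.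
have [y [h e]] := resolventP f a0; have [y' [h' e']] := resolventP g a0.
rewrite -(resolvent_unique (ltW a0) (A_lin b h h')); congr (G a _).
rewrite -{1}e -{1}e' !scalerDr [a *: (b *: y)]scalerA [a * b]mulrC -scalerA.
by rewrite addrACA.
Qed.

Lemma resolventB a f g : 0 <= a -> G a (f - g) = G a f - G a g.
Proof.
by move=> a0; have := resolvent_linear (-1) g f a0; rewrite !scaleN1r addrC => ->; rewrite addrC.
Qed.

Lemma resolvent_lip a f g : 0 <= a -> `|G a f - G a g| <= `|f - g|.
Proof. by move=> a0; rewrite -resolventB// resolvent_contr. Qed.

(** With [r := G a y], linearity puts [(x - a r, r)] in the graph of [A], whence [G a x = x - a r].
    This is the commutation of the resolvent with [A], and it gives [|x - G a x| <= a |y|]. *)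
Lemma resolvent_graph a x y : 0 <= a -> A x y ->
  A (G a x) (G a y) /\ G a x + a *: G a y = x.
Proof.
rewrite le_eqVlt => /orP[/eqP <-|a0] xy.
  by rewrite !resolvent0 scale0r addr0.
have [s [hs es]] := resolventP y a0; set r := G a y in hs es *.
have h : A (x - a *: r) r.
  by have := AB xy (AZ a hs); rewrite -{1}es addrK.
have -> : G a x = x - a *: r.
  by rewrite -(resolvent_unique (ltW a0) h) subrK.
by rewrite subrK.
Qed.

Lemma resolvent_comm a b f : 0 <= a -> 0 <= b -> G a (G b f) = G b (G a f).
Proof.
move=> a0; rewrite le_eqVlt => /orP[/eqP <-|b0]; first by rewrite !resolvent0.
have [y [h e]] := resolventP f b0; have [h' e'] := resolvent_graph a0 h.
rewrite -{2}e -[in RHS]/(G b _).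
have -> : G a (G b f + b *: y) = G a (G b f) + b *: G a y.
  by rewrite [_ + _ in LHS]addrC resolvent_linear// addrC.
by rewrite resolvent_unique// ltW.
Qed.

(** Since [(1 + aA)(1 + bA) = 1 + (a + b)A + ab A^2], merging two short steps into a long one costs
    only [ab |A^2 f|] on the domain of [A^2]. *)
Lemma resolvent_mul_near a b f g h : 0 <= a -> 0 <= b -> A f g -> A g h ->
  `|G a (G b f) - G (a + b) f| <= a * b * `|h|.
Proof.
move=> a0 b0 fg gh; have ab0 : 0 <= a + b by rewrite addr_ge0.
have [pq pE] := resolvent_graph ab0 fg; have [qr qE] := resolvent_graph ab0 gh.
set p := G _ f in pq pE *; set q := G _ g in pq pE qr qE; set r := G _ h in qr qE.
have h1 : A (p + a *: q) (q + a *: r) by apply: AD => //; exact: AZ.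
have E : p + a *: q + b *: (q + a *: r) = f + (a * b) *: r.
  by rewrite -pE scalerDl scalerDr scalerA [b * a]mulrC !addrA.
have pE' : G a (G b (f + (a * b) *: r)) = p.
  by rewrite -E (resolvent_unique b0 h1) (resolvent_unique a0 pq).
have -> : G a (G b f) - p = - ((a * b) *: G a (G b r)).
  by rewrite -pE' [f + _]addrC !resolvent_linear// [_ + G a (G b f)]addrC opprD addrA subrr sub0r.
rewrite normrN normrZ ger0_norm ?mulr_ge0// ler_wpM2l ?mulr_ge0//.
rewrite (le_trans (resolvent_contr _ a0))// (le_trans (resolvent_contr _ b0))//.
exact: resolvent_contr.
Qed.

(** Pieces of the domain of [A^2] on which [A^2] is bounded by [C]. They are invariant under
    resolvents, as [iter_near] demands, and their union is dense. *)
Let E2 (C : R) : set H := [set f | exists g h, [/\ A f g, A g h & `|h| <= C]].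

Let E2_resolvent a C f : 0 <= a -> E2 C f -> E2 C (G a f).
Proof.
move=> a0 [g [h [fg gh hC]]]; exists (G a g), (G a h); split.
- exact: (resolvent_graph a0 fg).1.
- exact: (resolvent_graph a0 gh).1.
- exact: le_trans (resolvent_contr _ a0) hC.
Qed.

(** For [x] in the domain of [A], the point [G a x] lies in the domain of [A^2], at distance at most
    [a |y|] from [x]. *)
Let E2_dense f e : 0 < e -> exists C f', E2 C f' /\ `|f - f'| <= e.
Proof.
move=> e0; have e20 : 0 < e / 2 by rewrite divr_gt0.
have [x [y [xy fx]]] := A_dense f e20.
set a := e / 2 / (`|y| + 1).
have a0 : 0 < a by rewrite divr_gt0// ltr_wpDl.
have [h hE] := resolvent_graph (ltW a0) xy.
have [z [hz _]] := resolventP y a0.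
exists `|z|, (G a x); split; first by exists (G a y), z.
have ay : `|x - G a x| <= e / 2.
  rewrite -{1}hE [_ + a *: _]addrC addrK normrZ gtr0_norm//.
  rewrite (le_trans (ler_wpM2l (ltW a0) (resolvent_contr _ (ltW a0))))//.
  by rewrite /a mulrAC ler_pdivrMr ?ltr_wpDl// ler_wpM2l ?ltW// ltrDl.
by rewrite (splitr e) -(subrKA x) (le_trans (ler_normD _ _))// lerD.
Qed.

(** With powers of two each subdivision refines the previous one: two steps of length [a] are
    compared with one of length [a + a], and the errors form a geometric series. *)
Definition exp_formula n t f := iter (2 ^ n) (G (t / (2 ^ n)%:R)) f.
Local Notation F := exp_formula.

Let pow2_gt0 n : 0 < (2 ^ n)%:R :> R. Proof. by rewrite ltr0n expn_gt0. Qed.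

Let step_ge0 n (t : R) : 0 <= t -> 0 <= t / (2 ^ n)%:R.
Proof. by move=> t0; rewrite divr_ge0. Qed.

Let iter_lip a m f g : 0 <= a -> `|iter m (G a) f - iter m (G a) g| <= `|f - g|.
Proof.
move=> a0; elim: m => //= m; apply: le_trans; exact: resolvent_lip.
Qed.

Let F_lip n t f g : 0 <= t -> `|F n t f - F n t g| <= `|f - g|.
Proof. by move=> t0; apply: iter_lip; exact: step_ge0. Qed.

Let F_contr n t f : 0 <= t -> `|F n t f| <= `|f|.
Proof.
move=> t0; rewrite /F; have := step_ge0 n t0; move: (t / _) => a a0.
elim: (2 ^ n)%N => //= m; apply: le_trans; exact: resolvent_contr.
Qed.

Let F_linear n t (b : R) f g : 0 <= t -> F n t (b *: f + g) = b *: F n t f + F n t g.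
Proof.
move=> t0; rewrite /F; have := step_ge0 n t0; move: (t / _) => a a0.
by elim: (2 ^ n)%N => //= m ->; rewrite resolvent_linear.
Qed.

Let F_step n t C f : 0 <= t -> E2 C f ->
  `|F n.+1 t f - F n t f| <= (t ^+ 2 * C / 2) * ((2 ^ n)%:R^-1 - (2 ^ n.+1)%:R^-1).
Proof.
move=> t0 fE; have C0 : 0 <= C by case: fE => g [h [_ _]]; exact: le_trans.
set a := t / (2 ^ n.+1)%:R; have a0 : 0 <= a by exact: step_ge0.
have aE : t / (2 ^ n)%:R = a + a.
  by rewrite /a expnS natrM; field; rewrite gt_eqF.
have -> : F n.+1 t f = iter (2 ^ n) (fun x => G a (G a x)) f.
  rewrite /F -/a expnS mul2n -addnn iterD iter_comm//.
rewrite {1}/F aE.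
have := @iter_near _ _ (fun x => G a (G a x)) (G (a + a)) (E2 C) (a * a * C).
move=> /(_ _ _ _ (2 ^ n)%N f fE) h; apply: le_trans (h _ _ _) _.
- move=> x y; rewrite (le_trans (resolvent_lip _ _ a0))//.
  exact: resolvent_lip.
- by move=> x; apply: E2_resolvent; rewrite addr_ge0.
- move=> x [g [k [xg gk kC]]].
  by rewrite (le_trans (resolvent_mul_near a0 a0 xg gk))// ler_wpM2l// mulr_ge0.
rewrite le_eqVlt; apply/orP; left; apply/eqP.
by rewrite /a expnS natrM; field; rewrite gt_eqF.
Qed.

Let F_dist n k t C f : 0 <= t -> E2 C f ->
  `|F (n + k) t f - F n t f| <= (t ^+ 2 * C / 2) * (2 ^ n)%:R^-1.
Proof.
move=> t0 fE; have C0 : 0 <= C by case: fE => g [h [_ _]]; exact: le_trans.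
have c0 : 0 <= t ^+ 2 * C / 2 by rewrite divr_ge0// mulr_ge0// exprn_ge0.
suff : `|F (n + k) t f - F n t f| <=
    (t ^+ 2 * C / 2) * ((2 ^ n)%:R^-1 - (2 ^ (n + k))%:R^-1).
  move=> /le_trans; apply; rewrite ler_wpM2l// gerBl invr_ge0.
  by rewrite ler0n.
elim: k => [|k IH]; first by rewrite addn0 !subrr normr0 mulr0.
rewrite addnS -(subrKA (F (n + k) t f)) (le_trans (ler_normD _ _))//.
apply: le_trans (lerD (F_step _ t0 fE) IH) _; rewrite -mulrDr.
by rewrite addrC subrKA.
Qed.

Let half_small (c e : R) : 0 < e -> exists n, c * (2 ^ n)%:R^-1 <= e.
Proof.
move=> e0; exists (Num.truncn (c / e)).+1.
have := truncnS_gt (c / e); rewrite ltr_pdivrMr// => /ltW hn.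
rewrite ler_pdivrMr// (le_trans hn)// mulrC ler_wpM2l ?ltW//.
by rewrite ltr_nat ltn_expl.
Qed.

Let F_cvg t f : 0 <= t -> cvg (F n t f @[n --> \oo]).
Proof.
move=> t0; apply: cauchy_cvg; apply: cauchy_exP => e e0.
have e30 : 0 < e / 4 by rewrite divr_gt0.
have [C [f' [f'E ff']]] := E2_dense f e30.
have [N hN] := half_small (t ^+ 2 * C / 2) e30.
exists (F N t f); exists N => // n /= Nn.
rewrite -ball_normE /ball_ /= -(subnKC Nn) distrC.
rewrite -(subrKA (F (N + (n - N)) t f')) (le_lt_trans (ler_normD _ _))//.
rewrite -(subrKA (F N t f') (F (N + (n - N)) t f')).
have h1 := F_lip (N + (n - N)) f f' t0.
have h2 := F_lip N f' f t0.
have h3 := le_trans (F_dist N (n - N) t0 f'E) hN.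
have h4 := ler_normD (F (N + (n - N)) t f' - F N t f') (F N t f' - F N t f).
move: h2; rewrite [ `|f' - f| ]distrC => h2.
lra.
Qed.

Definition semigroup t f : H := lim (F n t f @[n --> \oo]).
Local Notation S := semigroup.

Let S_cvg t f : 0 <= t -> F n t f @[n --> \oo] --> S t f.
Proof. by move=> t0; exact: F_cvg. Qed.

Let cvg_norm_le (u : nat -> H) l (c : R) : u n @[n --> \oo] --> l ->
  (forall n, `|u n| <= c) -> `|l| <= c.
Proof.
move=> ul uc; have h : `|u n| @[n --> \oo] --> `|l| by exact: cvg_norm.
rewrite -(cvg_lim _ h)//.
by apply: limr_le; [apply/cvg_ex; eexists; exact: h|exact: nearW].
Qed.

Lemma semigroup_contr t f : 0 <= t -> `|S t f| <= `|f|.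
Proof. move=> t0; apply: (@cvg_norm_le (fun n => F n t f)) => [|n]; [exact: S_cvg|exact: F_contr]. Qed.

Lemma semigroup_linear t (b : R) f g : 0 <= t -> S t (b *: f + g) = b *: S t f + S t g.
Proof.
move=> t0; apply: cvg_lim => //.
under eq_fun do rewrite F_linear//.
by apply: cvgD; [apply: cvgZl_tmp|]; exact: S_cvg.
Qed.

Lemma semigroupB t f g : 0 <= t -> S t (f - g) = S t f - S t g.
Proof.
move=> t0; have := semigroup_linear (-1) g f t0.
by rewrite !scaleN1r addrC => ->; rewrite addrC.
Qed.

Lemma semigroup_id f : S 0 f = f.
Proof.
apply: cvg_lim => //; rewrite (_ : (fun n => _) = (fun=> f)); first exact: cvg_cst.
apply/funext => n; rewrite /F mul0r; elim: (2 ^ n)%N => //= m ->.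
exact: resolvent0.
Qed.

Let small_norm (x : H) : (forall e, 0 < e -> `|x| <= e) -> x = 0.
Proof.
move=> h; apply/eqP; rewrite -normr_eq0 eq_le normr_ge0 andbT.
by apply/ler_addgt0Pr => e e0; rewrite add0r h.
Qed.

(** Resolvents commute, so [F n s (F n t f)] iterates [G a (G b _)]. On the domain of [A^2] it
    differs from [F n (s + t) f] by at most [2^n * a * b * C = s t C / 2^n]; density does the
    rest. *)
Lemma semigroupD s t f : 0 <= s -> 0 <= t -> S (s + t) f = S s (S t f).
Proof.
move=> s0 t0; have st0 : 0 <= s + t by rewrite addr_ge0.
have H2 C f' : E2 C f' -> S (s + t) f' = S s (S t f').
  move=> f'E; have C0 : 0 <= C by case: f'E => g [h [_ _]]; exact: le_trans.
  apply/esym/eqP; rewrite -subr_eq0; apply/eqP; apply: small_norm => e e0.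
  have e30 : 0 < e / 4 by rewrite divr_gt0.
  have [N1 _ h1] := (cvgrPdist_le _ _).1 (@S_cvg _ f' st0) _ e30.
  have [N2 _ h2] := (cvgrPdist_le _ _).1 (@S_cvg _ (S t f') s0) _ e30.
  have [N3 _ h3] := (cvgrPdist_le _ _).1 (@S_cvg _ f' t0) _ e30.
  have [N4 h4] := half_small (s * t * C) e30.
  set n := maxn (maxn N1 N2) (maxn N3 N4).
  have k1 : `|S (s + t) f' - F n (s + t) f'| <= e / 4.
    by apply: h1; rewrite /= /n !leq_max leqnn.
  have k2 : `|S s (S t f') - F n s (S t f')| <= e / 4.
    by apply: h2; rewrite /= /n !leq_max leqnn !orbT.
  have k3 : `|F n s (S t f') - F n s (F n t f')| <= e / 4.
    apply: le_trans (F_lip _ _ _ s0) _.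
    by apply: h3; rewrite /= /n !leq_max leqnn !orbT.
  have k4 : `|F n s (F n t f') - F n (s + t) f'| <= e / 4.
    have N4n : (N4 <= n)%N by rewrite /n !leq_max leqnn !orbT.
    set a := s / (2 ^ n)%:R; set b := t / (2 ^ n)%:R.
    have a0 : 0 <= a by exact: step_ge0.
    have b0 : 0 <= b by exact: step_ge0.
    rewrite /F -/a -/b mulrDl -/a -/b iter_comm; last first.
      by move=> x; rewrite resolvent_comm.
    have := @iter_near _ _ (fun x => G a (G b x)) (G (a + b)) (E2 C) (a * b * C).
    move=> /(_ _ _ _ (2 ^ n)%N f' f'E) h; apply: le_trans (h _ _ _) _.
    - move=> x y; rewrite (le_trans (resolvent_lip _ _ a0))//.
      exact: resolvent_lip.
    - by move=> x; apply: E2_resolvent; rewrite addr_ge0.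
    - move=> x [g [k [xg gk kC]]].
      by rewrite (le_trans (resolvent_mul_near a0 b0 xg gk))// ler_wpM2l// mulr_ge0.
    apply: le_trans h4.
    rewrite [leLHS](_ : _ = s * t * C * (2 ^ n)%:R^-1); last first.
      by rewrite /a /b; field; rewrite gt_eqF.
    by rewrite ler_wpM2l ?mulr_ge0// lef_pV2 ?posrE// ler_nat leq_exp2l.
  rewrite -(subrKA (F n s (S t f'))) (le_trans (ler_normD _ _))//.
  rewrite -(subrKA (F n s (F n t f')) (F n s _)).
  rewrite -(subrKA (F n (s + t) f') (F n s (F n t f'))).
  set x2 := _ - _ in k2 *; set x3 := _ - _ in k3 *; set x4 := _ - _ in k4 *.
  move: k1; rewrite distrC => k1.
  have := ler_normD x3 (x4 + (F n (s + t) f' - S (s + t) f')).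
  have := ler_normD x4 (F n (s + t) f' - S (s + t) f').
  lra.
apply/eqP; rewrite -subr_eq0; apply/eqP; apply: small_norm => e e0.
have e20 : 0 < e / 2 by rewrite divr_gt0.
have [C [f' [f'E ff']]] := E2_dense f e20.
rewrite -(subrKA (S (s + t) f')) (le_trans (ler_normD _ _))//.
rewrite {2}(H2 _ _ f'E) -!semigroupB// (splitr e) lerD//.
  exact: le_trans (semigroup_contr _ st0) ff'.
rewrite (le_trans (semigroup_contr _ s0))// (le_trans (semigroup_contr _ t0))//.
by rewrite distrC.
Qed.

Lemma semigroup_graph_le t x y : 0 <= t -> A x y -> `|S t x - x| <= t * `|y|.
Proof.
move=> t0 xy; apply: (@cvg_norm_le (fun n => F n t x - x)).
  by apply: cvgB; [exact: S_cvg|exact: cvg_cst].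
move=> n; have -> : t * `|y| = (2 ^ n)%:R * (t / (2 ^ n)%:R * `|y|).
  by field; rewrite gt_eqF.
rewrite /F; set a := t / _; have a0 : 0 <= a by exact: step_ge0.
have := @iter_near _ _ (G a) id [set x] (a * `|y|).
move=> /(_ _ _ _ (2 ^ n)%N x) h.
rewrite -[X in _ - X](_ : iter (2 ^ n) id x = x); last by elim: (2 ^ n)%N => //= m ->.
apply: h => //; first by move=> ? ?; exact: resolvent_lip.
move=> _ ->; have [h hE] := resolvent_graph a0 xy.
rewrite -{2}hE opprD addrA subrr sub0r normrN normrZ ger0_norm//.
by rewrite ler_wpM2l// resolvent_contr.
Qed.

Lemma semigroup_continuous f : `|S t f - f| @[t --> 0^'+] --> (0 : R).
Proof.
apply/cvgrPdist_le => e e0; have e30 : 0 < e / 3 by rewrite divr_gt0.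
have [x [y [xy fx]]] := A_dense f e30.
have d0 : 0 < e / 3 / (`|y| + 1) by rewrite divr_gt0// ltr_wpDl.
near=> t; rewrite sub0r normrN normr_id.
have t0 : 0 <= t by rewrite ltW//; near: t; exact: nbhs_right_gt.
have td : t <= e / 3 / (`|y| + 1) by near: t; exact: nbhs_right_le.
rewrite -(subrKA (S t x)) (le_trans (ler_normD _ _))//.
rewrite -(subrKA x (S t x)) -semigroupB//.
have := ler_normD (S t x - x) (x - f).
have := le_trans (semigroup_contr (f - x) t0) fx.
have := semigroup_graph_le t0 xy.
have : t * `|y| <= e / 3.
  apply: le_trans (_ : t * (`|y| + 1) <= _); first by rewrite ler_wpM2l// lerDl.
  by rewrite -ler_pdivlMr// ltr_wpDl.
rewrite [ `|x - f| ]distrC; lra.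
Unshelve. all: by end_near. Qed.

(** The iterates satisfy [G^k f - f = - a (G g + ... + G^k g)], a Riemann sum for the integrated
    equation. Each [G^j g] is close to [g] because [g'], which approximates [g], lies in the domain
    of [A]. After division by [t] only [2 |g - g'|] remains as [t] tends to zero. *)
Let semigroup_generator_bound t f g g' h : 0 <= t -> A f g -> A g' h ->
  `|S t f - f + t *: g| <= t * (2 * `|g - g'| + t * `|h|).
Proof.
move=> t0 fg g'h; apply: (@cvg_norm_le (fun n => F n t f - f + t *: g)).
  by apply: cvgD; [apply: cvgB; [exact: S_cvg|exact: cvg_cst]|exact: cvg_cst].
move=> n; set N := (2 ^ n)%N; rewrite /F -/N.
set a := t / N%:R; have a0 : 0 <= a by exact: step_ge0.
have tE : t = N%:R * a by rewrite /a; field; rewrite gt_eqF// pow2_gt0.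
have gk k : (k <= N)%N -> `|g - iter k (G a) g| <= 2 * `|g - g'| + t * `|h|.
  move=> kN.
  have h1 : `|g' - iter k (G a) g'| <= t * `|h|.
    have := @iter_near _ _ (G a) id [set g'] (a * `|h|).
    move=> /(_ _ _ _ k g') hk.
    rewrite distrC -[X in _ - X](_ : iter k id g' = g'); last by elim: k {kN hk} => //= m ->.
    apply: le_trans (hk _ _ _ _) _ => //.
    - by move=> ? ?; exact: resolvent_lip.
    - move=> _ ->; have [hh hE] := resolvent_graph a0 g'h.
      rewrite -{2}hE opprD addrA subrr sub0r normrN normrZ ger0_norm//.
      by rewrite ler_wpM2l// resolvent_contr.
    - by rewrite mulrA tE ler_wpM2r// ler_wpM2r// ler_nat.
  rewrite -(subrKA g') (le_trans (ler_normD _ _))//.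
  rewrite -(subrKA (iter k (G a) g') g').
  have := ler_normD (g' - iter k (G a) g') (iter k (G a) g' - iter k (G a) g).
  have := iter_lip k g' g a0; rewrite [ `|g' - g| ]distrC; lra.
set B := 2 * _ + _ in gk *.
have key k : (k <= N)%N -> A (iter k (G a) f) (iter k (G a) g) /\
    `|iter k (G a) f - f + (k%:R * a) *: g| <= k%:R * a * B.
  elim: k => [|k IH] kN; first by rewrite subrr !mul0r scale0r addr0 normr0.
  have [h1 h2] := IH (ltnW kN); rewrite !iterS.
  have [h3 h4] := resolvent_graph a0 h1; split => //.
  set x := iter k _ f in h1 h2 h3 h4 *; set y := iter k _ g in h1 h3 h4 *.
  have -> : G a x - f + (k.+1%:R * a) *: g =
      (x - f + (k%:R * a) *: g) + a *: (g - G a y).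
    rewrite -{2}h4 -natr1 mulrDl mul1r scalerDl scalerBr.
    rewrite [G a x + _]addrC -![in RHS]addrA [RHS]addrC -!addrA.
    rewrite [RHS]addrCA; congr (_ + _).
    by rewrite [RHS]addrCA [a *: G a y + _]addrCA addNKr addrC -addrA.
  rewrite (le_trans (ler_normD _ _))// -natr1 mulrDl mul1r mulrDl lerD//.
  by rewrite normrZ ger0_norm// ler_wpM2l// /y -iterS gk.
by have [_] := key N (leqnn N); rewrite -tE.
Qed.

Lemma semigroup_generator f g :
  `|t^-1 *: (S t f - f) + g| @[t --> 0^'+] --> (0 : R) <-> A f g.
Proof.
have AS f' g' : A f' g' -> `|t^-1 *: (S t f' - f') + g'| @[t --> 0^'+] --> (0 : R).
  move=> fg; apply/cvgrPdist_le => e e0; have e30 : 0 < e / 4 by rewrite divr_gt0.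
  have [x [y [xy fx]]] := A_dense g' e30.
  have d0 : 0 < e / 4 / (`|y| + 1) by rewrite divr_gt0// ltr_wpDl.
  near=> t; rewrite sub0r normrN normr_id.
  have t0 : 0 < t by near: t; exact: nbhs_right_gt.
  have td : t <= e / 4 / (`|y| + 1) by near: t; exact: nbhs_right_le.
  have -> : t^-1 *: (S t f' - f') + g' = t^-1 *: (S t f' - f' + t *: g').
    by rewrite [RHS]scalerDr scalerA mulVf ?gt_eqF// scale1r.
  rewrite normrZ gtr0_norm ?invr_gt0// ler_pdivrMl//.
  apply: le_trans (semigroup_generator_bound (ltW t0) fg xy) _.
  rewrite ler_wpM2l ?ltW//.
  have : t * `|y| <= e / 4.
    apply: le_trans (_ : t * (`|y| + 1) <= _); first by rewrite ler_wpM2l ?ltW// ltrDl.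
    by rewrite -ler_pdivlMr// ltr_wpDl.
  lra.
split; last exact: AS.
(* Let [f'] in the domain of [A] solve [f' + A f' = f + g]. The difference [v] of [f] and [f']
   satisfies [S t v - v = t v + o(t)], growth at rate [1], which a contraction allows only for
   [v = 0]. *)
move=> fg; have [f' [g' [fg' e]]] := A_range (f + g) ltr01.
rewrite scale1r in e.
have vE : - (g - g') = f - f'.
  by apply/eqP; rewrite -subr_eq0 opprB addrC opprB addrACA -opprD -e subrr.
suff v0 : f - f' = 0.
  move/eqP: (v0); rewrite subr_eq0 => /eqP ->.
  by move/eqP: vE; rewrite v0 oppr_eq0 subr_eq0 => /eqP ->.
set v := f - f' in vE *.
have hv : `|t^-1 *: (S t v - v) - v| @[t --> 0^'+] --> (0 : R).
  have h : `|t^-1 *: (S t f - f) + g| + `|t^-1 *: (S t f' - f') + g'| @[t --> 0^'+]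
      --> (0 + 0 : R) by apply: cvgD => //; exact: AS.
  apply/cvgrPdist_le => d d0; move/cvgrPdist_le: h => /(_ d d0) h.
  near=> t; have t0 : 0 < t by near: t; exact: nbhs_right_gt.
  have : `|0 + 0 - (`|t^-1 *: (S t f - f) + g| + `|t^-1 *: (S t f' - f') + g'|)| <= d.
    by near: t.
  rewrite addr0 !sub0r !normrN normr_id ger0_norm ?addr_ge0// => /(le_trans _); apply.
  have -> : t^-1 *: (S t v - v) - v =
     (t^-1 *: (S t f - f) + g) - (t^-1 *: (S t f' - f') + g').
    rewrite [in RHS]opprD [RHS]addrACA -scalerBr.
    rewrite (_ : g - g' = - v); last by rewrite -vE opprK.
    congr (_ *: _ + _).
    by rewrite /v semigroupB ?ltW// !opprD !opprK addrACA.
  exact: ler_normB.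
apply: small_norm => d d0; move/cvgrPdist_le: hv => /(_ d d0) hv.
have [t [t0 ht]] : exists t : R, 0 < t /\ `|t^-1 *: (S t v - v) - v| <= d.
  apply: (@filter_ex _ (0 : R)^'+).
  near=> t; split; first by near: t; exact: nbhs_right_gt.
  have : `|0 - `|t^-1 *: (S t v - v) - v| | <= d by near: t.
  by rewrite sub0r normrN normr_id.
have h1 : `|(1 + t) *: v| <= `|S t v| + t * d.
  have -> : (1 + t) *: v = S t v - t *: (t^-1 *: (S t v - v) - v).
    rewrite [t *: (_ - v)]scalerBr scalerA divff ?gt_eqF// !scale1r scalerDl scale1r.
    by rewrite !opprB [RHS]addrC addrA subrK addrC.
  rewrite (le_trans (ler_normB _ _))// lerD2l normrZ gtr0_norm//.
  by rewrite ler_wpM2l// ltW.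
have h2 := semigroup_contr v (ltW t0).
move: h1; rewrite normrZ gtr0_norm ?addr_gt0// => h1.
rewrite -(ler_pM2l t0); lra.
Unshelve. all: by end_near. Qed.

Lemma semigroup_fixed t f : 0 <= t -> A f 0 -> S t f = f.
Proof.
move=> t0 f0; have := semigroup_graph_le t0 f0.
rewrite normr0 mulr0 => h; apply/eqP; rewrite -subr_eq0 -normr_eq0.
by rewrite eq_le h normr_ge0.
Qed.

End HilleYosida.

(** * The closed form and its operator *)

Section WeightedL2.
Variables (R : realType) (T : choiceType) (m : T -> R).
Hypothesis m_ge0 : forall x, 0 <= m x.
Implicit Types f g h : T -> R.

(** The weight is generic because the theory serves twice: for functions on vertices, weighted by
    [vertex_weight], and for gradients on pairs of vertices, weighted by [half_weight]. *)
Definition wl2 f : Prop := abs_summable (fun x => f x ^+ 2 * m x).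
Definition wdot f g : R := tsum (fun x => f x * g x * m x).

Lemma wl2_dot f g : wl2 f -> wl2 g -> abs_summable (fun x => f x * g x * m x).
Proof.
move=> sf sg; apply: abs_summable_le (abs_summableD sf sg) => x.
rewrite normrM (ger0_norm (m_ge0 x)) -mulrDl [X in _ <= X]ger0_norm; last first.
  by rewrite mulr_ge0// addr_ge0// sqr_ge0.
rewrite ler_wpM2r// ler_norml; apply/andP; split; nra.
Qed.

Lemma wl2D f g : wl2 f -> wl2 g -> wl2 (fun x => f x + g x).
Proof.
move=> sf sg; apply: abs_summable_le
  (abs_summableD (abs_summableZ 2 sf) (abs_summableZ 2 sg)) => x.
have m0 := m_ge0 x; have h1 := sqr_ge0 (f x); have h2 := sqr_ge0 (g x).
rewrite !ger0_norm; [|by nra|by rewrite mulr_ge0// sqr_ge0].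
rewrite !mulrA -mulrDl ler_wpM2r//; have := sqr_ge0 (f x - g x); lra.
Qed.

Lemma wl2Z a f : wl2 f -> wl2 (fun x => a * f x).
Proof.
move=> /(abs_summableZ (a ^+ 2)); apply: abs_summable_le => x.
by rewrite exprMn mulrA.
Qed.

Lemma wl2N f : wl2 f -> wl2 (fun x => - f x).
Proof. by move=> sf; apply: abs_summable_le sf => x; rewrite sqrrN. Qed.

Lemma wl2B f g : wl2 f -> wl2 g -> wl2 (fun x => f x - g x).
Proof. by move=> sf /wl2N; exact: wl2D. Qed.

Lemma wdotC f g : wdot f g = wdot g f.
Proof. by apply: eq_tsum => x; rewrite [f x * _]mulrC. Qed.

Lemma wdotDl f g h : wl2 f -> wl2 g -> wl2 h ->
  wdot (fun x => f x + g x) h = wdot f h + wdot g h.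
Proof.
move=> sf sg sh; rewrite -tsumD; [|exact: wl2_dot..].
by apply: eq_tsum => x; rewrite !mulrDl.
Qed.

Lemma wdotZl a f h : wl2 f -> wl2 h -> wdot (fun x => a * f x) h = a * wdot f h.
Proof.
move=> sf sh; rewrite -tsumZ; last exact: wl2_dot.
by apply: eq_tsum => x; rewrite !mulrA.
Qed.

Lemma wdotBl f g h : wl2 f -> wl2 g -> wl2 h ->
  wdot (fun x => f x - g x) h = wdot f h - wdot g h.
Proof.
move=> sf sg sh; rewrite -tsumB; [|exact: wl2_dot..].
by apply: eq_tsum => x; rewrite !mulrBl.
Qed.

Lemma wdotDr f g h : wl2 f -> wl2 g -> wl2 h ->
  wdot h (fun x => f x + g x) = wdot h f + wdot h g.
Proof. by move=> *; rewrite wdotC wdotDl// [wdot h f]wdotC [wdot h g]wdotC. Qed.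

Lemma wdotBr f g h : wl2 f -> wl2 g -> wl2 h ->
  wdot h (fun x => f x - g x) = wdot h f - wdot h g.
Proof. by move=> *; rewrite wdotC wdotBl// [wdot h f]wdotC [wdot h g]wdotC. Qed.

Lemma wdotZr a f h : wl2 f -> wl2 h -> wdot h (fun x => a * f x) = a * wdot h f.
Proof. by move=> *; rewrite wdotC wdotZl// [wdot h f]wdotC. Qed.

Lemma wdot_ge0 f : 0 <= wdot f f.
Proof. by apply: tsum_ge0 => x; rewrite mulr_ge0// -expr2 sqr_ge0. Qed.

Lemma wdot_CS f g : wl2 f -> wl2 g -> wdot f g ^+ 2 <= wdot f f * wdot g g.
Proof.
move=> sf sg.
have H t : 0 <= wdot f f + 2 * t * wdot f g + t ^+ 2 * wdot g g.
  have := wdot_ge0 (fun x => f x + t * g x).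
  have stg := wl2Z t sg; have sft := wl2D sf stg.
  rewrite wdotDl// !wdotDr// !wdotZr// !wdotZl// [wdot g f]wdotC; lra.
have c0 := wdot_ge0 g; set a := wdot f f in H *; set b := wdot f g in H *.
set c := wdot g g in H c0 *.
have [cp|] := ltP 0 c.
  have := H (- b / c) => h.
  have : 0 <= (a + 2 * (- b / c) * b + (- b / c) ^+ 2 * c) * c by rewrite mulr_ge0// ltW.
  have -> : (a + 2 * (- b / c) * b + (- b / c) ^+ 2 * c) * c = a * c - b ^+ 2.
    by field; rewrite gt_eqF.
  lra.
move=> c0'; have cE : c = 0 by apply/eqP; rewrite eq_le c0' c0.
have [->|bn0] := eqVneq b 0; first by rewrite cE mulr0 expr0n.
(* For [c = 0] the polynomial is affine in [t], and at this [t] it equals [-1]. *)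
have := H (- (a + 1) / (2 * b)); rewrite cE mulr0 addr0.
have -> : a + 2 * (- (a + 1) / (2 * b)) * b = -1 by field.
lra.
Qed.

Lemma le_sqr_wdot f x : wl2 f -> f x ^+ 2 * m x <= wdot f f.
Proof.
move=> sf; have := @le_term_tsum _ _ (fun x => f x * f x * m x) x.
rewrite expr2; apply => [y|]; first by rewrite mulr_ge0// -expr2 sqr_ge0.
exact: wl2_dot.
Qed.

Lemma wl2_fatou {I : Type} (F : set_system I) {FF : ProperFilter F}
    (fn : I -> T -> R) f (C : R) :
  (forall x, fn n x @[n --> F] --> f x) ->
  (\forall n \near F, wl2 (fn n) /\ wdot (fn n) (fn n) <= C) ->
  wl2 f /\ wdot f f <= C.
Proof.
move=> fnf hC.
have f0 x : 0 <= f x * f x * m x by rewrite mulr_ge0// -expr2 sqr_ge0.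
have [|sf fC] := @abs_summable_bound _ _ C (fun x => f x * f x * m x) f0.
  move=> s us.
  have h : \sum_(x <- s) fn n x * fn n x * m x @[n --> F] -->
      \sum_(x <- s) f x * f x * m x.
    by apply: cvg_big => [|x _]; [exact: add_continuous|apply: cvgMr_tmp; exact: cvgM].
  rewrite -(cvg_lim _ h)//; apply: limr_le; first by apply/cvg_ex; eexists; exact: h.
  move: hC; apply: filterS => n [sn nC]; apply: le_trans nC.
  apply: sum_le_tsum us; first by move=> x; rewrite mulr_ge0// -expr2 sqr_ge0.
  exact: wl2_dot.
split=> //; apply: abs_summable_le sf => x; by rewrite expr2.
Qed.

Definition wnorm f : R := Num.sqrt (wdot f f).

Lemma wnorm_sqr f : wnorm f ^+ 2 = wdot f f.
Proof. by rewrite sqr_sqrtr// wdot_ge0. Qed.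

Lemma wnorm_ge0 f : 0 <= wnorm f.
Proof. exact: sqrtr_ge0. Qed.

Lemma wdot_le_norm f g : wl2 f -> wl2 g -> `|wdot f g| <= wnorm f * wnorm g.
Proof.
move=> sf sg; rewrite -(@ler_pXn2r _ 2)// ?nnegrE ?mulr_ge0 ?wnorm_ge0//.
by rewrite exprMn !wnorm_sqr real_normK ?num_real// wdot_CS.
Qed.

Lemma wnormD f g : wl2 f -> wl2 g -> wnorm (fun x => f x + g x) <= wnorm f + wnorm g.
Proof.
move=> sf sg; have sfg := wl2D sf sg.
rewrite -(@ler_pXn2r _ 2)// ?nnegrE ?addr_ge0 ?wnorm_ge0//.
rewrite wnorm_sqr wdotDl// !wdotDr// [wdot g f]wdotC sqrrD !wnorm_sqr.
have := le_trans (ler_norm _) (wdot_le_norm sf sg); lra.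
Qed.

Lemma wnormZ a f : wl2 f -> wnorm (fun x => a * f x) = `|a| * wnorm f.
Proof.
move=> sf; have saf := wl2Z a sf.
by rewrite /wnorm wdotZl// wdotZr// mulrA -expr2 sqrtrM ?sqr_ge0// sqrtr_sqr.
Qed.

Lemma wnorm_eq0 f : (forall x, 0 < m x) -> wl2 f -> wnorm f = 0 -> forall x, f x = 0.
Proof.
move=> m0 sf f0 x; have := le_sqr_wdot x sf.
rewrite -wnorm_sqr f0 expr0n/= pmulr_lle0// => h.
by apply/eqP; rewrite -sqrf_eq0 eq_le h sqr_ge0.
Qed.

End WeightedL2.

(** * The Hilbert space as a complete normed module *)

Section L2.
Variables (R : realType) (X : countType) (G : graph R X).
Local Notation mu := (vertex_weight G).

Lemma mu_ge0 x : 0 <= mu x. Proof. exact/ltW/vertex_weight_gt0. Qed.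
#[local] Hint Resolve mu_ge0 : core.

Lemma in_l2E f : in_l2 G f <-> wl2 mu f.
Proof.
by rewrite /wl2 abs_summable_ge0// => x; rewrite mulr_ge0// sqr_ge0.
Qed.

Definition l2_pred : {pred X -> R} := [pred f | `[< in_l2 G f >]].

Lemma l2_predP f : wl2 mu f -> f \in l2_pred.
Proof. by move=> /in_l2E/asboolT h; exact: h. Qed.

Lemma l2_submod_closed : submod_closed l2_pred.
Proof.
split; first by apply/asboolP/in_l2E; rewrite /wl2 (_ : (fun x => _) = fun=> 0);
  [exact: abs_summable_cst0|apply/funext => x; rewrite expr0n mul0r].
move=> a f g /asboolP/in_l2E sf /asboolP/in_l2E sg; apply/asboolP/in_l2E.
exact: (wl2D mu_ge0 (wl2Z a sf) sg).
Qed.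

HB.instance Definition _ := GRing.isSubmodClosed.Build R (X -> R) l2_pred l2_submod_closed.

(** The elements are functions, not classes: every vertex has positive measure, so the norm
    separates functions and controls each value. *)
Record l2 := L2 { l2_val :> X -> R; l2_valP : l2_val \in l2_pred }.

HB.instance Definition _ := [isSub for l2_val].
HB.instance Definition _ := [Choice of l2 by <:].
HB.instance Definition _ := [SubChoice_isSubLmodule of l2 by <:].

Lemma l2_in (f : l2) : wl2 mu f.
Proof. by have /asboolW/in_l2E : `[< in_l2 G f >] := l2_valP f. Qed.
#[local] Hint Resolve l2_in : core.

Let l2_ler_normD (f g : l2) : l2norm G (f + g : l2) <= l2norm G f + l2norm G g.
Proof. exact: (wnormD mu_ge0 (l2_in f) (l2_in g)). Qed.

Let l2_normrZ (a : R) (f : l2) : l2norm G (a *: f : l2) = `|a| * l2norm G f.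
Proof. exact: (wnormZ mu_ge0 a (l2_in f)). Qed.

Let l2_normr0_eq0 (f : l2) : l2norm G f = 0 -> f = 0.
Proof.
move=> f0; apply: val_inj; apply/funext => x.
by apply: (wnorm_eq0 mu_ge0 _ (l2_in f)) => // y; exact: vertex_weight_gt0.
Qed.

HB.instance Definition _ := Lmodule_isNormed.Build R l2
  l2_ler_normD l2_normrZ l2_normr0_eq0.

Lemma l2_normE (f : l2) : `|f| = wnorm mu f. Proof. by []. Qed.

Lemma l2_ptwise_le (f : l2) x : `|l2_val f x| <= `|f| / Num.sqrt (mu x).
Proof.
have s0 : 0 < Num.sqrt (mu x) by rewrite sqrtr_gt0 vertex_weight_gt0.
rewrite ler_pdivlMr// -(@ler_pXn2r _ 2)// ?nnegrE ?mulr_ge0//.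
rewrite exprMn real_normK ?num_real// sqr_sqrtr// l2_normE wnorm_sqr//.
exact: le_sqr_wdot.
Qed.

Lemma l2_cvg_ptwise {I : Type} (F : set_system I) {FF : Filter F}
    (fn : I -> l2) (f : l2) : fn i @[i --> F] --> f ->
  forall x, l2_val (fn i) x @[i --> F] --> l2_val f x.
Proof.
move=> fnf x; have s0 : 0 < Num.sqrt (mu x) by rewrite sqrtr_gt0 vertex_weight_gt0.
apply/cvgrPdist_le => e e0.
move/cvgrPdist_le: fnf => /(_ (e * Num.sqrt (mu x)))/(_ (mulr_gt0 e0 s0)).
apply: filterS => i; rewrite -ler_pdivrMr//; apply: le_trans.
exact: (l2_ptwise_le (f - fn i)).
Qed.

(** Evaluation at [x] is bounded by the norm over [sqrt (mu x)], so a Cauchy filter has a pointwise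
    limit. Fatou along the filter gives both its membership in the space and the convergence in
    norm. *)
Let l2_complete (F : set_system l2) : ProperFilter F -> cauchy F -> cvg F.
Proof.
move=> FF /cauchy_ballP Fc.
have Fx x : cvg (l2_val f x @[f --> F]).
  apply: cauchy_cvg; apply: cauchy_exP => e e0.
  have s0 : 0 < Num.sqrt (mu x) by rewrite sqrtr_gt0 vertex_weight_gt0.
  have [g hg] := filter_ex (nearP_dep (Fc _ (mulr_gt0 e0 s0))).
  exists (l2_val g x); move: hg; apply: filterS => h; rewrite -!ball_normE /=.
  rewrite -ltr_pdivrMr//; apply: le_lt_trans; exact: (l2_ptwise_le (g - h)).
pose f x := lim (l2_val g x @[g --> F]).
have ff x : l2_val g x @[g --> F] --> f x by exact: Fx.
have key e : 0 < e -> \forall g \near F, wl2 mu (fun x => f x - l2_val g x) /\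
    wnorm mu (fun x => f x - l2_val g x) <= e.
  move=> e0; have := Fc _ e0; move=> /nearP_dep.
  apply: filterS => g hg.
  have [||s1 s2] := @wl2_fatou _ _ mu mu_ge0 _ F _ (fun h x => l2_val h x - l2_val g x)
    (fun x => f x - l2_val g x) (e ^+ 2).
  - by move=> x; apply: cvgB => //; exact: cvg_cst.
  - move: hg; apply: filterS => h gh; split; first exact: (l2_in (h - g)).
    rewrite -(wnorm_sqr mu_ge0) -[X in X ^+ 2 <= _]/(`|h - g|) ler_pXn2r// ?nnegrE// ?ltW//.
    by move: gh; rewrite -ball_normE /= distrC.
  - split=> //; rewrite -(@ler_pXn2r _ 2)// ?nnegrE ?wnorm_ge0// ?(ltW e0)//.
    by rewrite wnorm_sqr.
have [g [sg _]] : exists g, wl2 mu (fun x => f x - l2_val g x) /\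
    wnorm mu (fun x => f x - l2_val g x) <= 1 by exact: filter_ex (key _ ltr01).
have sf : wl2 mu f.
  have := wl2D mu_ge0 sg (l2_in g).
  by rewrite (_ : (fun x => _) = f)//; apply/funext => x; rewrite subrK.
have fP : f \in l2_pred by exact: l2_predP.
apply/cvg_ex; exists (L2 fP); apply/cvgrPdist_le => e e0.
by move: (key _ e0); apply: filterS => h [].
Qed.

HB.instance Definition _ := Uniform_isComplete.Build l2 l2_complete.

End L2.

(** * The energy, closability of the form, and its operator *)

Section Forms.
Variables (R : realType) (X : countType) (G : graph R X).
Local Notation mu := (vertex_weight G).
Local Notation w := (edge_weight G).
Local Notation mu0 := (@mu_ge0 R X G).
Implicit Types (f g h v : X -> R).

Lemma edge_summable x : abs_summable (w x).
Proof.
by apply/abs_summable_ge0; [exact: edge_weight_ge0|exact: edge_weight_summable].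
Qed.

(** Putting the factor [1 / 2] of the form into the weight makes the energy an inner product of
    gradients, which inherits Cauchy-Schwarz, Fatou and the triangle inequality. *)
Definition half_weight (p : X * X) : R := w p.1 p.2 / 2.
Local Notation we := half_weight.

Lemma half_weight_ge0 p : 0 <= we p.
Proof. by rewrite divr_ge0// edge_weight_ge0. Qed.
Local Notation we0 := half_weight_ge0.

Definition grad f (p : X * X) : R := f p.1 - f p.2.

Definition fin_energy f : Prop := wl2 we (grad f).
Definition energy f g : R := wdot we (grad f) (grad g).

Lemma gradD f g : grad (fun x => f x + g x) = fun p => grad f p + grad g p.
Proof. by apply/funext => p; rewrite /grad; ring. Qed.
Lemma gradB f g : grad (fun x => f x - g x) = fun p => grad f p - grad g p.
Proof. by apply/funext => p; rewrite /grad; ring. Qed.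
Lemma gradZ a f : grad (fun x => a * f x) = fun p => a * grad f p.
Proof. by apply/funext => p; rewrite /grad; ring. Qed.

Lemma formE f g : fin_energy f -> fin_energy g -> Defs.form G f g = energy f g.
Proof.
move=> sf sg; rewrite /Defs.form /energy /wdot -tsumZ.
  by apply: eq_tsum => p; rewrite /we /grad; field.
apply: abs_summable_le (abs_summableZ 2 (wl2_dot we0 sf sg)) => p.
rewrite le_eqVlt; apply/orP; left; apply/eqP; congr (`|_|).
by rewrite /we /grad; field.
Qed.

Lemma fs_seq f : finitely_supported f ->
  exists2 s : seq X, uniq s & forall x, x \notin s -> f x = 0.
Proof.
rewrite /finitely_supported => fs; exists (finmap.enum_fset (fset_set [set x | f x != 0])).
  exact: finmap.fset_uniq.
move=> x; rewrite [_ \in _](in_fset_set fs).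
by apply: contraNeq => h; rewrite inE.
Qed.

Lemma seq_fs f (s : seq X) : (forall x, x \notin s -> f x = 0) -> finitely_supported f.
Proof.
move=> fs; apply: (@sub_finite_set _ _ [set` s]); last exact: finite_seq.
by move=> x /= fx; apply: contraNT fx => /fs ->.
Qed.

Lemma fsD f g : finitely_supported f -> finitely_supported g ->
  finitely_supported (fun x => f x + g x).
Proof.
move=> ff fg; apply: (@sub_finite_set _ _ ([set x | f x != 0] `|` [set x | g x != 0])).
  move=> x /= h; have [f0|f0] := eqVneq (f x) 0; last by left.
  by right; rewrite f0 add0r in h.
by rewrite finite_setU.
Qed.

Lemma fsM (a : X -> R) f : finitely_supported f -> finitely_supported (fun x => a x * f x).
Proof.
move=> ff; apply: (@sub_finite_set _ _ [set x | f x != 0]) => // x /=.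
by apply: contraNN => /eqP ->; rewrite mulr0.
Qed.

Lemma fsZ (a : R) f : finitely_supported f -> finitely_supported (fun x => a * f x).
Proof. exact: (fsM (fun=> a)). Qed.

Lemma fsB f g : finitely_supported f -> finitely_supported g ->
  finitely_supported (fun x => f x - g x).
Proof.
move=> ff /(fsZ (-1)) fg; have := fsD ff fg.
by rewrite (_ : (fun x => _) = (fun x => f x - g x))//; apply/funext => x; rewrite mulN1r.
Qed.

Lemma fs_wl2 f : finitely_supported f -> wl2 mu f.
Proof.
move=> /fs_seq[s us fs]; apply: (tsum_finite us _).1 => x /fs ->.
by rewrite expr0n mul0r.
Qed.

(** Without local finiteness a finite support may meet infinitely many edges; summability over pairs
    comes from the finite degree of each vertex of the support. *)
Lemma fs_edge_summable f (b : X * X -> R) (K : R) : finitely_supported f ->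
  (forall p, `|b p| <= K) -> abs_summable (fun p => w p.1 p.2 * f p.1 * b p).
Proof.
move=> /fs_seq[s us fs] bK.
apply: (@abs_summable_le _ _ _ (fun p => w p.1 p.2 * `|f p.1| * K)).
  move=> p; rewrite !normrM normr_id ler_wpM2l ?mulr_ge0//.
  exact: le_trans (bK p) (ler_norm _).
have fy x : abs_summable (fun y => w x y * (`|f x| * `|K|)).
  by under eq_fun do rewrite mulrC; apply: abs_summableZ; exact: edge_summable.
suff : abs_summable (fun p : X * X => w p.1 p.2 * (`|f p.1| * `|K|)).
  by apply: abs_summable_le => p; rewrite -mulrA !normrM !normr_id.
apply: abs_summable_pair => [p|x|] //=.
  by rewrite mulr_ge0 ?edge_weight_ge0// mulr_ge0.
apply: (tsum_finite us _).1 => x /fs ->.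
by apply: tsum0 => y; rewrite normr0 mul0r mulr0.
Qed.

Lemma fs_fin_energy f : finitely_supported f -> fin_energy f.
Proof.
move=> ff; have f2 : finitely_supported (fun x => f x * f x) by exact: fsM.
have s1 := @fs_edge_summable _ (fun=> 1) 1 f2 (fun=> ltac:(by rewrite normr1)).
have s2 := abs_summable_swap s1.
apply: abs_summable_le (abs_summableD s1 s2) => -[x y] /=.
rewrite !mulr1 [w y x]edge_weight_sym -mulrDr.
have w0 := edge_weight_ge0 G x y.
have f20 : 0 <= f x * f x + f y * f y by rewrite addr_ge0// -expr2 sqr_ge0.
rewrite [leRHS]ger0_norm; last by rewrite mulr_ge0.
rewrite ger0_norm; last by rewrite mulr_ge0 ?we0// sqr_ge0.
rewrite /we /grad /= mulrC -mulrA ler_wpM2l//.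
by rewrite ler_pdivrMl//; have := sqr_ge0 (f x + f y); lra.
Qed.

Lemma energyDl f g h : fin_energy f -> fin_energy g -> fin_energy h ->
  energy (fun x => f x + g x) h = energy f h + energy g h.
Proof. by rewrite /energy gradD; exact: wdotDl we0 _ _ _. Qed.

Lemma energyBl f g h : fin_energy f -> fin_energy g -> fin_energy h ->
  energy (fun x => f x - g x) h = energy f h - energy g h.
Proof. by rewrite /energy gradB; exact: wdotBl we0 _ _ _. Qed.

Lemma energyZl a f h : fin_energy f -> fin_energy h ->
  energy (fun x => a * f x) h = a * energy f h.
Proof. by rewrite /energy gradZ; exact: wdotZl we0 _ _ _. Qed.

Lemma energyC f g : energy f g = energy g f.
Proof. exact: wdotC. Qed.

Lemma energyDr f g h : fin_energy f -> fin_energy g -> fin_energy h ->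
  energy h (fun x => f x + g x) = energy h f + energy h g.
Proof. by rewrite /energy gradD; exact: wdotDr we0 _ _ _. Qed.

Lemma energyBr f g h : fin_energy f -> fin_energy g -> fin_energy h ->
  energy h (fun x => f x - g x) = energy h f - energy h g.
Proof. by rewrite /energy gradB; exact: wdotBr we0 _ _ _. Qed.

Lemma energyZr a f h : fin_energy f -> fin_energy h ->
  energy h (fun x => a * f x) = a * energy h f.
Proof. by rewrite /energy gradZ; exact: wdotZr we0 _ _ _. Qed.

Lemma energy_ge0 f : 0 <= energy f f.
Proof. exact: wdot_ge0 we0 _. Qed.

Lemma fin_energyD f g : fin_energy f -> fin_energy g -> fin_energy (fun x => f x + g x).
Proof. by rewrite /fin_energy gradD; exact: wl2D we0 _ _. Qed.

Lemma fin_energyB f g : fin_energy f -> fin_energy g -> fin_energy (fun x => f x - g x).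
Proof. by rewrite /fin_energy gradB; exact: wl2B we0 _ _. Qed.

Lemma fin_energyZ a f : fin_energy f -> fin_energy (fun x => a * f x).
Proof. by rewrite /fin_energy gradZ; exact: wl2Z. Qed.

Lemma wnorm_cvg_ptwise (fn : nat -> X -> R) f : (forall n, wl2 mu (fn n)) -> wl2 mu f ->
  wnorm mu (fun x => fn n x - f x) @[n --> \oo] --> (0 : R) ->
  forall x, fn n x @[n --> \oo] --> f x.
Proof.
move=> sfn sf h; pose u n : l2 G := L2 (l2_predP (sfn n)).
pose v : l2 G := L2 (l2_predP sf).
have : u n @[n --> \oo] --> v.
  apply/cvgrPdist_le => e e0; move/cvgrPdist_le: h => /(_ e e0).
  apply: filterS => n; rewrite sub0r normrN ger0_norm; last exact: wnorm_ge0.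
  by rewrite distrC.
exact: l2_cvg_ptwise.
Qed.

(** This is closability: by Fatou, a bound on the energies of [fn n - fn m] for large [m] passes to
    [fn n - f]. The closed form is therefore given by the same formula as the form on finite
    supports. *)
Lemma form_approx_energy (fn : nat -> X -> R) f : wl2 mu f -> form_approx G fn f ->
  [/\ fin_energy f,
      wnorm mu (fun x => fn n x - f x) @[n --> \oo] --> (0 : R)
    & wnorm we (grad (fun x => fn n x - f x)) @[n --> \oo] --> (0 : R)].
Proof.
move=> sf [ffs fl2 fC].
have fx := wnorm_cvg_ptwise (fun n => fs_wl2 (ffs n)) sf fl2.
have key e : 0 < e -> exists N, forall n, (N <= n)%N ->
    fin_energy (fun x => fn n x - f x) /\
    energy (fun x => fn n x - f x) (fun x => fn n x - f x) <= e.
  move=> e0; have [N hN] := fC _ e0; exists N => n Nn.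
  apply: (@wl2_fatou _ _ we we0 _ (\oo : set_system nat) _
    (fun m => grad (fun x => fn n x - fn m x))).
    by move=> p; rewrite /grad; apply: cvgB; apply: cvgB => //; exact: cvg_cst.
  exists N => // m /= Nm.
  have h : fin_energy (fun x => fn n x - fn m x) by apply: fs_fin_energy; exact: fsB.
  by split=> //; rewrite -/(energy _ _) -formE// ltW// hN.
have fE : fin_energy f.
  have [N /(_ N (leqnn N))[h _]] := key 1 ltr01.
  have := fin_energyB (fs_fin_energy (ffs N)) h.
  by rewrite (_ : (fun x => _) = f)//; apply/funext => x; rewrite subKr.
split=> //; apply/cvgrPdist_le => e e0.
have [N hN] := key (e ^+ 2) (exprn_gt0 _ e0).
exists N => // n /= Nn; have [h1 h2] := hN n Nn.
rewrite sub0r normrN ger0_norm ?wnorm_ge0//.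
by rewrite -(@ler_pXn2r _ 2)// ?nnegrE ?wnorm_ge0// ?(ltW e0)// (wnorm_sqr we0).
Qed.

(** Membership in the form domain becomes density in the form norm, with one approximant for each
    precision in place of a Cauchy sequence. *)
Lemma closure_domP f : closure_dom G f <-> [/\ wl2 mu f, fin_energy f &
  forall e, 0 < e -> exists g, [/\ finitely_supported g,
    wnorm mu (fun x => g x - f x) <= e & wnorm we (grad (fun x => g x - f x)) <= e]].
Proof.
split=> [[/in_l2E sf [fn fnf]]|[sf fE H]].
  have [ffs _ _] := fnf; have [fE h1 h2] := form_approx_energy sf fnf.
  split=> // e e0; move/cvgrPdist_le: h1 => /(_ e e0) h1.
  move/cvgrPdist_le: h2 => /(_ e e0) h2.
  have [n [hn1 hn2]] : exists n, wnorm mu (fun x => fn n x - f x) <= e /\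
      wnorm we (grad (fun x => fn n x - f x)) <= e.
    apply: (@filter_ex _ (\oo : set_system nat)); near=> n; split.
      have : `|0 - wnorm mu (fun x => fn n x - f x)| <= e by near: n.
      by rewrite sub0r normrN ger0_norm ?wnorm_ge0.
    have : `|0 - wnorm we (grad (fun x => fn n x - f x))| <= e by near: n.
    by rewrite sub0r normrN ger0_norm ?wnorm_ge0.
  by exists (fn n).
split; first exact/in_l2E.
have H' (n : nat) : exists g, [/\ finitely_supported g,
    wnorm mu (fun x => g x - f x) <= n.+1%:R^-1
  & wnorm we (grad (fun x => g x - f x)) <= n.+1%:R^-1] by apply: H; rewrite invr_gt0.
have [fn hfn] := choice H'; exists fn; split.
- by move=> n; have [] := hfn n.
- apply/cvgrPdist_le => e e0; near=> n.
  rewrite sub0r normrN ger0_norm ?sqrtr_ge0//.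
  have [_ h _] := hfn n; apply: le_trans h _; apply: ltW.
  by near: n; exact: near_infty_natSinv_lt (PosNum e0).
(* Two approximants are less than [2 d] apart in the energy seminorm, and [2 d < 3 d = sqrt e]. *)
- move=> e e0; pose d : R := Num.sqrt e / 3.
  have d0 : 0 < d by rewrite divr_gt0// sqrtr_gt0.
  have [N _ hN] := near_infty_natSinv_lt (PosNum d0).
  exists N => n m Nn Nm.
  have hE k : fin_energy (fun x => fn k x - f x).
    by apply: fin_energyB => //; apply: fs_fin_energy; have [] := hfn k.
  have hE' : fin_energy (fn n \- fn m).
    by apply: fs_fin_energy; apply: fsB; [have [] := hfn n|have [] := hfn m].
  rewrite formE// /energy -(wnorm_sqr we0).
  have -> : grad (fn n \- fn m) = fun p =>
      grad (fun x => fn n x - f x) p + (-1) * grad (fun x => fn m x - f x) p.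
    by apply/funext => p; rewrite /grad /=; ring.
  have h := wnormD we0 (hE n) (wl2Z (-1) (hE m)).
  rewrite (wnormZ we0 _ (hE m)) normrN1 mul1r in h.
  have [_ _ h1] := hfn n; have [_ _ h2] := hfn m.
  have h3 := hN n Nn; have h4 := hN m Nm; rewrite /= in h3 h4.
  have sE : e = (3 * d) ^+ 2 by rewrite /d mulrC divfK// sqr_sqrtr// ltW.
  rewrite [X in _ < X]sE ltr_pXn2r// ?nnegrE ?wnorm_ge0//; last by rewrite mulr_ge0// ltW.
  apply: le_lt_trans h (lt_trans (ltrD (le_lt_trans h1 h3) (le_lt_trans h2 h4)) _).
  by rewrite -subr_gt0 (_ : 3 * d - (d + d) = d)//; ring.
Unshelve. all: by end_near. Qed.

Lemma closure_dom_wl2 f : closure_dom G f -> wl2 mu f.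
Proof. by move=> /closure_domP[]. Qed.

Lemma closure_dom_energy f : closure_dom G f -> fin_energy f.
Proof. by move=> /closure_domP[]. Qed.

Lemma fs_closure_dom f : finitely_supported f -> closure_dom G f.
Proof.
move=> ff; apply/closure_domP; split; [exact: fs_wl2|exact: fs_fin_energy|].
move=> e e0; exists f; split => //.
  rewrite /wnorm /wdot tsum0 ?sqrtr0 ?ltW// => x.
  by rewrite subrr !mul0r.
rewrite /wnorm /wdot tsum0 ?sqrtr0 ?ltW// => x.
by rewrite /grad !subrr !mul0r.
Qed.

Lemma closure_dom_lin a f g : closure_dom G f -> closure_dom G g ->
  closure_dom G (fun x => a * f x + g x).
Proof.
move=> /closure_domP[sf fE fH] /closure_domP[sg gE gH]; apply/closure_domP; split.
- exact: (wl2D mu0 (wl2Z a sf) sg).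
- exact: (fin_energyD (fin_energyZ a fE) gE).
move=> e e0; set d := e / (`|a| + 1).
have a0 : 0 < `|a| + 1 by rewrite ltr_wpDl.
have d0 : 0 < d by rewrite divr_gt0.
have dE : `|a| * d + d = e.
  by rewrite -[X in _ + X]mul1r -mulrDl /d mulrC divfK// gt_eqF.
have [f' [ff f1 f2]] := fH _ d0; have [g' [fg g1 g2]] := gH _ d0.
exists (fun x => a * f' x + g' x); split.
- by apply: fsD => //; exact: fsZ.
- have -> : (fun x => a * f' x + g' x - (a * f x + g x)) =
      (fun x => a * (f' x - f x) + (g' x - g x)) by apply/funext => x; ring.
  have h1 := wl2B mu0 (fs_wl2 ff) sf; have h2 := wl2B mu0 (fs_wl2 fg) sg.
  apply: le_trans (wnormD mu0 (wl2Z a h1) h2) _.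
  by rewrite (wnormZ mu0 _ h1) -dE lerD// ler_wpM2l.
- have -> : grad (fun x => a * f' x + g' x - (a * f x + g x)) =
      (fun p => a * grad (fun x => f' x - f x) p + grad (fun x => g' x - g x) p).
    by apply/funext => x; rewrite /grad; ring.
  have h1 := fin_energyB (fs_fin_energy ff) fE.
  have h2 := fin_energyB (fs_fin_energy fg) gE.
  apply: le_trans (wnormD we0 (wl2Z a h1) h2) _.
  by rewrite (wnormZ we0 _ h1) -dE lerD// ler_wpM2l.
Qed.

Lemma cvg_wdot (T : choiceType) (m : T -> R) (fn gn : nat -> T -> R) (f g : T -> R) :
  (forall x, 0 <= m x) ->
  (forall n, wl2 m (fn n)) -> (forall n, wl2 m (gn n)) -> wl2 m f -> wl2 m g ->
  wnorm m (fun x => fn n x - f x) @[n --> \oo] --> (0 : R) ->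
  wnorm m (fun x => gn n x - g x) @[n --> \oo] --> (0 : R) ->
  wdot m (fn n) (gn n) @[n --> \oo] --> wdot m f g.
Proof.
move=> m0 sfn sgn sf sg hf hg.
pose a n := wnorm m (fun x => fn n x - f x); pose b n := wnorm m (fun x => gn n x - g x).
have hab : a n * wnorm m g + a n * b n + wnorm m f * b n @[n --> \oo] --> (0 : R).
  rewrite -[X in _ --> X](_ : 0 * wnorm m g + 0 * 0 + wnorm m f * 0 = 0); last by ring.
  apply: cvgD; first apply: cvgD.
  - by apply: cvgM => //; exact: cvg_cst.
  - exact: cvgM.
  - by apply: cvgM => //; exact: cvg_cst.
apply/cvgrPdist_le => e e0; move/cvgrPdist_le: hab => /(_ e e0).
apply: filterS => n; rewrite sub0r normrN.
have df := wl2B m0 (sfn n) sf; have dg := wl2B m0 (sgn n) sg.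
have -> : wdot m f g - wdot m (fn n) (gn n) =
   - (wdot m (fun x => fn n x - f x) g +
      wdot m (fun x => fn n x - f x) (fun x => gn n x - g x) +
      wdot m f (fun x => gn n x - g x)).
  rewrite (wdotBl m0 (sfn n) sf sg) (wdotBl m0 (sfn n) sf dg).
  rewrite !(wdotBr m0 (sgn n) sg)//; ring.
rewrite normrN => h; apply: le_trans (le_trans (ler_norm _) h).
rewrite (le_trans (ler_normD _ _))// lerD// ?wdot_le_norm//.
by rewrite (le_trans (ler_normD _ _))// lerD// wdot_le_norm.
Qed.

(** Along any two approximating sequences the gradients converge, so the forms tend to [energy f h]:
    the relation [closure_form] is single-valued on the domain. *)
Lemma closure_formP f h q : closure_dom G f -> closure_dom G h ->
  closure_form G f h q <-> q = energy f h.
Proof.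
move=> df dh; have sf := closure_dom_wl2 df; have sh := closure_dom_wl2 dh.
have H fn gn : form_approx G fn f -> form_approx G gn h ->
    Defs.form G (fn n) (gn n) @[n --> \oo] --> energy f h.
  move=> af ah; have [fE _ f2] := form_approx_energy sf af.
  have [hE _ h2] := form_approx_energy sh ah.
  have [ff _ _] := af; have [fh _ _] := ah.
  have -> : (fun n => Defs.form G (fn n) (gn n)) = (fun n => energy (fn n) (gn n)).
    by apply/funext => n; rewrite formE//; exact: fs_fin_energy.
  apply: (cvg_wdot we0) => //; try by move=> n; exact: fs_fin_energy.
  - by under eq_fun do rewrite -gradB.
  - by under eq_fun do rewrite -gradB.
split=> [[fn [gn [af ah hq]]]|->].
  by rewrite -(cvg_lim _ hq)// (cvg_lim _ (H _ _ af ah)).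
have [_ [fn af]] := df; have [_ [gn ah]] := dh.
by exists fn, gn; split => //; exact: H.
Qed.

Lemma operator_LP f g : operator_L G f g <-> [/\ closure_dom G f, wl2 mu g &
  forall h, closure_dom G h -> energy f h = wdot mu g h].
Proof.
split=> [[df /in_l2E sg H]|[df sg H]].
  by split=> // h dh; apply/esym/closure_formP => //; exact: H.
split=> //; first exact/in_l2E.
by move=> h dh; apply/closure_formP => //; rewrite H.
Qed.

End Forms.

(** * Resolvents of the operator by minimisation, and density of its domain *)

Section Resolvent.
Variables (R : realType) (X : countType) (G : graph R X).
Local Notation mu := (vertex_weight G).
Local Notation mu0 := (@mu_ge0 R X G).
Local Notation we := (half_weight G).
Local Notation we0 := (@half_weight_ge0 R X G).
Local Notation Q := (energy G).
Implicit Types (f g h : X -> R).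

Section Minimisation.
Variables (a : R) (f : X -> R).
Hypotheses (a_gt0 : 0 < a) (sf : wl2 mu f).

Let B g h := wdot mu g h + a * Q g h.
(** Dirichlet principle: a minimiser solves [g + a L g = f] weakly. The competitors have finite
    support, so that a minimising sequence is itself an approximating sequence for the closed
    form. *)
Let J g := B g g / 2 - wdot mu f g.

Let BZ t g h : finitely_supported g -> finitely_supported h ->
  B (fun x => g x + t * h x) (fun x => g x + t * h x) =
  B g g + 2 * t * B g h + t ^+ 2 * B h h.
Proof.
move=> fg fh; have sg := fs_wl2 G fg; have sh := fs_wl2 G fh.
have eg := fs_fin_energy G fg; have eh := fs_fin_energy G fh.
have sth := wl2Z t sh; have eth := fin_energyZ t eh.
have s1 := wl2D mu0 sg sth; have e1 := fin_energyD eg eth.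
rewrite /B (wdotDl mu0)// !(wdotDr mu0)// !(wdotZl mu0)// !(wdotZr mu0)//.
rewrite energyDl// !energyDr// !energyZl// !energyZr// [wdot mu h g]wdotC [Q h g]energyC.
ring.
Qed.

Let fD t g h : finitely_supported g -> finitely_supported h ->
  wdot mu f (fun x => g x + t * h x) = wdot mu f g + t * wdot mu f h.
Proof.
move=> fg fh; have sg := fs_wl2 G fg; have sh := fs_wl2 G fh.
by rewrite (wdotDr mu0)//; [rewrite (wdotZr mu0)|exact: wl2Z].
Qed.

Let B_ge g : wdot mu g g <= B g g.
Proof. by rewrite lerDl mulr_ge0 ?energy_ge0// ltW. Qed.

Let J_bound g : finitely_supported g -> - wdot mu f f / 2 <= J g.
Proof.
move=> fg; have sg := fs_wl2 G fg; have := B_ge g.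
have sfg := wl2B mu0 sg sf.
have := wdot_ge0 mu0 (fun x => g x - f x).
rewrite (wdotBl mu0)// !(wdotBr mu0)// [wdot mu g f]wdotC /J; lra.
Qed.

Let Jset : set R := [set J g | g in [set g | finitely_supported g]].

Let Jinf : has_inf Jset.
Proof.
split; first by exists (J (fun=> 0)), (fun=> 0) => //=; exact: (@seq_fs _ _ _ [::]).
by exists (- wdot mu f f / 2) => _ [g fg <-]; exact: J_bound.
Qed.

Let J_ge g : finitely_supported g -> inf Jset <= J g.
Proof. by move=> fg; apply: (ge_inf Jinf.2); exists g. Qed.

Let minimiser n : exists g, finitely_supported g /\ J g < inf Jset + n.+1%:R^-1.
Proof.
have n0 : 0 < n.+1%:R^-1 :> R by rewrite invr_gt0.
by have [_ [g fg <-] h] := inf_adherent n0 Jinf; exists g.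
Qed.

(** The midpoint of [g] and [h] is a competitor, and [J] there is the mean of [J g] and [J h] minus
    one eighth of [B] at [g - h]. *)
Let parallelogram g h e d : finitely_supported g -> finitely_supported h ->
  J g < inf Jset + e -> J h < inf Jset + d ->
  B (fun x => g x - h x) (fun x => g x - h x) <= 4 * (e + d).
Proof.
move=> fg fh ge hd.
have fdiff : finitely_supported (fun x => h x - g x) by exact: fsB.
have := J_ge (fsD fg (fsZ (1 / 2) fdiff)).
have := BZ (1 / 2) fg fdiff; have := fD (1 / 2) fg fdiff; rewrite /J => -> ->.
have E1 : h = fun x => g x + 1 * (h x - g x) by apply/funext => x; ring.
have := BZ 1 fg fdiff; rewrite -E1; have := fD 1 fg fdiff; rewrite -E1.
have -> : B (fun x => g x - h x) (fun x => g x - h x) =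
    B (fun x => h x - g x) (fun x => h x - g x).
  rewrite /B; congr (_ + _ * _); apply: eq_tsum => x; rewrite /grad; ring.
move: ge hd; rewrite /J; set D := B (fun x => h x - g x) _.
move: (B g _) (B g g) (B h h) (wdot mu f g) (wdot mu f h) (wdot mu f _).
move=> *; lra.
Qed.

(** An approximate Euler-Lagrange equation: near-minimality of [g] makes the quadratic polynomial
    [e + t b + t^2 / 2 * B h h] nonnegative in [t], and the bound is on its discriminant. *)
Let euler g h e : finitely_supported g -> finitely_supported h -> 0 < e ->
  J g < inf Jset + e -> (B g h - wdot mu f h) ^+ 2 <= 2 * e * B h h.
Proof.
move=> fg fh e0 ge; set b := B g h - wdot mu f h.
have H t : 0 <= e + t * b + t ^+ 2 / 2 * B h h.
  have := J_ge (fsD fg (fsZ t fh)); rewrite /J BZ// fD//; move: ge; rewrite /J /b; lra.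
have Bh0 : 0 <= B h h by apply: le_trans (B_ge h); exact: (wdot_ge0 mu0 h).
set c := B h h in H Bh0 *; have [cp|] := ltP 0 c.
  have := H (- b / c) => h1.
  have : 0 <= (e + (- b / c) * b + (- b / c) ^+ 2 / 2 * c) * (2 * c).
    by rewrite mulr_ge0// mulr_ge0// ltW.
  have -> : (e + (- b / c) * b + (- b / c) ^+ 2 / 2 * c) * (2 * c) = 2 * e * c - b ^+ 2.
    by field; rewrite gt_eqF.
  lra.
move=> c0'; have cE : c = 0 by apply/eqP; rewrite eq_le c0' Bh0.
have [->|bn0] := eqVneq b 0; first by rewrite cE mulr0 expr0n.
have := H (- (e + 1) / b); rewrite cE mulr0 addr0.
have -> : e + - (e + 1) / b * b = -1 by field.
lra.
Qed.

Lemma resolvent_form_ex : exists2 g, closure_dom G g &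
  forall h, closure_dom G h -> wdot mu g h + a * Q g h = wdot mu f h.
Proof.
have [gn hgn] := choice minimiser.
have gfs n : finitely_supported (gn n) by have [] := hgn n.
have Bnm n m : B (fun x => gn n x - gn m x) (fun x => gn n x - gn m x) <=
    4 * (n.+1%:R^-1 + m.+1%:R^-1).
  by apply: parallelogram; have [] := hgn n; have [] := hgn m.
pose u n : l2 G := L2 (l2_predP (fs_wl2 G (gfs n))).
have small (e : R) : 0 < e -> exists N, forall n m, (N <= n)%N -> (N <= m)%N ->
    4 * (n.+1%:R^-1 + m.+1%:R^-1) < e.
  move=> e0; have e80 : 0 < e / 8 by rewrite divr_gt0.
  have [N _ hN] := near_infty_natSinv_lt (PosNum e80).
  exists N => n m /hN /= h1 /hN /= h2.
  rewrite (_ : e = 4 * (e / 8 + e / 8)); last by field.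
  by rewrite ltr_pM2l// ltrD.
have : cvg (u n @[n --> \oo]).
  apply: cauchy_cvg; apply: cauchy_exP => e e0.
  have [N hN] := small _ (exprn_gt0 2 e0).
  exists (u N); exists N => // n /= Nn; rewrite -ball_normE /=.
  rewrite -(@ltr_pXn2r _ 2)// ?nnegrE// ?(ltW e0)// l2_normE (wnorm_sqr mu0).
  apply: le_lt_trans (hN N n (leqnn N) Nn); apply: le_trans (Bnm N n); exact: B_ge.
move=> /cvg_ex[v uv].
have gv : form_approx G gn (l2_val v).
  split=> //.
    apply/cvgrPdist_le => e e0; move/cvgrPdist_le: uv => /(_ e e0).
    apply: filterS => n; rewrite sub0r normrN ger0_norm ?sqrtr_ge0//.
    by rewrite distrC.
  move=> e e0; have [N hN] := small _ (mulr_gt0 a_gt0 e0); exists N => n m Nn Nm.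
  rewrite formE; [|exact: fs_fin_energy (fsB (gfs n) (gfs m))..].
  rewrite -(ltr_pM2l a_gt0); apply: le_lt_trans (hN n m Nn Nm).
  by apply: le_trans (Bnm n m); rewrite lerDr (wdot_ge0 mu0).
have sv := l2_in v.
have dv : closure_dom G v by split; [exact/in_l2E|exists gn].
exists v => //.
have [vE h1 h2] := form_approx_energy sv gv.
(* For [h] of finite support the equation is the limit of [euler] along the minimising sequence;
   approximation of [h] then gives it on the whole form domain. *)
have key h : finitely_supported h -> wdot mu v h + a * Q v h = wdot mu f h.
  move=> fh; have sh := fs_wl2 G fh; have eh := fs_fin_energy G fh.
  have c0 (T : choiceType) (m : T -> R) (k : T -> R) :
      wnorm m (fun x => k x - k x) @[n --> \oo] --> (0 : R).
    rewrite (_ : wnorm _ _ = 0); first exact: cvg_cst.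
    by rewrite /wnorm /wdot tsum0 ?sqrtr0// => x; rewrite subrr !mul0r.
  have B_cvg : B (gn n) h - wdot mu f h @[n --> \oo] --> B v h - wdot mu f h.
    apply: cvgB; last exact: cvg_cst.
    apply: cvgD.
      apply: (cvg_wdot mu0 (fun n => fs_wl2 G (gfs n)) (fun=> sh) sv sh h1).
      exact: c0.
    apply: cvgM; first exact: cvg_cst.
    apply: (cvg_wdot we0 (fun n => fs_fin_energy G (gfs n)) (fun=> eh) vE eh).
      by under eq_fun do rewrite -gradB.
    exact: c0.
  apply/eqP; rewrite -subr_eq0 -sqrf_eq0 eq_le sqr_ge0 andbT.
  have B2 : (B (gn n) h - wdot mu f h) ^+ 2 @[n --> \oo] --> (B v h - wdot mu f h) ^+ 2.
    by under eq_fun do rewrite expr2; rewrite expr2; exact: cvgM.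
  apply/ler_addgt0Pr => e e0; rewrite add0r.
  rewrite -[leLHS](cvg_lim _ B2)//; apply: limr_le; first by apply/cvg_ex; eexists; exact: B2.
  have Bh0 : 0 <= B h h by apply: le_trans (B_ge h); exact: (wdot_ge0 mu0 h).
  have e0' : 0 < e / (2 * (B h h + 1)) by rewrite divr_gt0// mulr_gt0// ltr_wpDl.
  near=> n; have [_ hn] := hgn n.
  have n0 : 0 < n.+1%:R^-1 :> R by rewrite invr_gt0.
  apply: le_trans (euler (gfs n) fh n0 hn) _.
  have : n.+1%:R^-1 <= e / (2 * (B h h + 1)).
    by apply: ltW; near: n; exact: near_infty_natSinv_lt (PosNum e0').
  rewrite ler_pdivlMr ?mulr_gt0 ?ltr_wpDl//.
  have : n.+1%:R^-1 * B h h <= n.+1%:R^-1 * (B h h + 1).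
    by rewrite ler_wpM2l ?(ltW n0)// lerDl.
  by move: (n.+1%:R^-1) (B h h) => r b; lra.
move=> h dh; have [_ [hn hhn]] := dh; have sh := closure_dom_wl2 dh.
have [hE k1 k2] := form_approx_energy sh hhn; have [hfs _ _] := hhn.
have c0 (T : choiceType) (m : T -> R) (k : T -> R) :
    wnorm m (fun x => k x - k x) @[n --> \oo] --> (0 : R).
  rewrite (_ : wnorm _ _ = 0); first exact: cvg_cst.
  by rewrite /wnorm /wdot tsum0 ?sqrtr0// => x; rewrite subrr !mul0r.
have L1 : wdot mu v (hn n) + a * Q v (hn n) @[n --> \oo] --> wdot mu v h + a * Q v h.
  apply: cvgD.
    apply: (cvg_wdot mu0 (fun=> sv) (fun n => fs_wl2 G (hfs n)) sv sh _ k1).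
    exact: c0.
  apply: cvgM; first exact: cvg_cst.
  apply: (cvg_wdot we0 (fun=> vE) (fun n => fs_fin_energy G (hfs n)) vE hE).
    exact: c0.
  by under eq_fun do rewrite -gradB.
have L2 : wdot mu f (hn n) @[n --> \oo] --> wdot mu f h.
  apply: (cvg_wdot mu0 (fun=> sf) (fun n => fs_wl2 G (hfs n)) sf sh _ k1).
  exact: c0.
have E : (fun n => wdot mu v (hn n) + a * Q v (hn n)) = (fun n => wdot mu f (hn n)).
  by apply/funext => n; exact: key.
by rewrite E in L1; rewrite -(cvg_lim _ L1)// -(cvg_lim _ L2).
Unshelve. all: by end_near. Qed.

End Minimisation.

Definition l2_operator (f g : l2 G) : Prop := operator_L G f g.

Lemma l2_operatorP (f g : l2 G) : l2_operator f g <-> closure_dom G f /\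
  forall h, closure_dom G h -> Q f h = wdot mu g h.
Proof.
split=> [/operator_LP[]//|[? ?]]; apply/operator_LP; split=> //; exact: l2_in.
Qed.

Lemma l2_operator_lin (a : R) (x y x' y' : l2 G) :
  l2_operator x y -> l2_operator x' y' -> l2_operator (a *: x + x') (a *: y + y').
Proof.
move=> /l2_operatorP[dx H] /l2_operatorP[dx' H']; apply/l2_operatorP.
split; first exact: (closure_dom_lin a dx dx').
move=> h dh; have hE := closure_dom_energy dh; have sh := closure_dom_wl2 dh.
have xE := closure_dom_energy dx; have xE' := closure_dom_energy dx'.
transitivity (a * Q x h + Q x' h).
  rewrite -energyZl// -energyDl//; exact: fin_energyZ.
rewrite H// H'//.
rewrite -(wdotZl mu0 a (l2_in y) sh) -(wdotDl mu0 (wl2Z a (l2_in y)) (l2_in y') sh).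
by [].
Qed.

Lemma l2_operator_ge0 (x y : l2 G) : l2_operator x y -> wdot mu y x = Q x x.
Proof. by move=> /l2_operatorP[dx <-]. Qed.

Lemma l2_norm_sqr (x : l2 G) : `|x| ^+ 2 = wdot mu x x.
Proof. by rewrite l2_normE (wnorm_sqr mu0). Qed.

Lemma l2_operator_acc (a : R) (x y : l2 G) : 0 <= a -> l2_operator x y ->
  `|x| <= `|x + a *: y|.
Proof.
move=> a0 xy; rewrite -(@ler_pXn2r _ 2)// ?nnegrE// !l2_norm_sqr.
have sx := l2_in x; have sy := l2_in y; have say := wl2Z a sy.
have E : wdot mu (x + a *: y) (x + a *: y) =
    wdot mu x x + 2 * a * wdot mu y x + a ^+ 2 * wdot mu y y.
  transitivity (wdot mu (fun z => x z + a * y z) (fun z => x z + a * y z)); first by [].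
  have s1 := wl2D mu0 sx say.
  rewrite (wdotDl mu0)// !(wdotDr mu0)// !(wdotZl mu0)// !(wdotZr mu0)//.
  rewrite [wdot mu x y]wdotC; ring.
rewrite E (l2_operator_ge0 xy) -addrA lerDl addr_ge0// mulr_ge0//.
- by rewrite mulr_ge0.
- exact: energy_ge0.
- exact: sqr_ge0.
- exact: (wdot_ge0 mu0 y).
Qed.

Lemma l2_operator_range (a : R) (f : l2 G) : 0 < a ->
  exists x y, l2_operator x y /\ x + a *: y = f.
Proof.
move=> a0; have [g dg H] := resolvent_form_ex a0 (l2_in f).
have sg := closure_dom_wl2 dg; have sf := l2_in f.
pose x : l2 G := L2 (l2_predP sg).
exists x, (a^-1 *: (f - x)); split; last first.
  by rewrite scalerA divff ?gt_eqF// scale1r addrC subrK.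
apply/l2_operatorP; split => // h dh; have sh := closure_dom_wl2 dh.
transitivity (a^-1 * (wdot mu f h - wdot mu g h)).
  by rewrite -H// addrC addrA addNr add0r mulKf ?gt_eqF.
rewrite -(wdotBl mu0 sf sg sh) -(wdotZl mu0 _ (wl2B mu0 sf sg) sh).
by [].
Qed.

Lemma fs_dense (f : l2 G) (e : R) : 0 < e ->
  exists g : l2 G, finitely_supported g /\ `|f - g| <= e.
Proof.
move=> e0; have [s us hs] := @tsum_tail _ _ (fun x => f x ^+ 2 * mu x) (e ^+ 2)
  (fun x => mulr_ge0 (sqr_ge0 _) (mu0 x)) (l2_in f) (exprn_gt0 2 e0).
have gfs : finitely_supported (fun x => if x \in s then f x else 0).
  by apply: (@seq_fs _ _ _ s) => x /negbTE ->.
exists (L2 (l2_predP (fs_wl2 G gfs))); split=> //.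
rewrite -(@ler_pXn2r _ 2)// ?nnegrE// ?(ltW e0)// l2_norm_sqr.
apply: le_trans hs; rewrite le_eqVlt; apply/orP; left; apply/eqP.
apply: eq_tsum => x.
transitivity ((f x - (if x \in s then f x else 0)) ^+ 2 * mu x); first by rewrite expr2.
by case: ifP => _; rewrite ?subrr ?subr0// expr0n mul0r.
Qed.

(** For [g] of finite support and [x = (1 + aL)^-1 g], one has
    [|g - x|^2 = a (Q x g - Q x x) <= a Q g g], which is small with [a]. *)
Lemma l2_operator_dense (f : l2 G) (e : R) : 0 < e ->
  exists x y, l2_operator x y /\ `|f - x| <= e.
Proof.
move=> e0; have e20 : 0 < e / 2 by rewrite divr_gt0.
have [g [gfs fg]] := fs_dense f e20.
have gE := fs_fin_energy G gfs; have sg := l2_in g.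
set a := (e / 2) ^+ 2 / (Q g g + 1).
have Q0 : 0 < Q g g + 1 by rewrite ltr_wpDl// energy_ge0.
have a0 : 0 < a by rewrite divr_gt0// exprn_gt0.
have [x [y [xy xyE]]] := l2_operator_range g a0.
exists x, y; split=> //.
rewrite (splitr e) -(subrKA g) (le_trans (ler_normD _ _))// lerD//.
have /l2_operatorP[dx H] := xy; have xE := closure_dom_energy dx.
have gx : g - x = a *: y by rewrite -xyE addrC addKr.
rewrite -(@ler_pXn2r _ 2)// ?nnegrE// ?(ltW e20)// l2_norm_sqr.
have dgx : closure_dom G (g - x).
  have := closure_dom_lin (-1) dx (fs_closure_dom G gfs).
  by rewrite (_ : (fun x => _) = (g - x))//; apply/funext => z; rewrite mulN1r addrC.
have -> : wdot mu (g - x) (g - x) = a * (Q x g - Q x x).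
  transitivity (a * wdot mu y (g - x)).
    rewrite -(wdotZl mu0 a (l2_in y) (l2_in (g - x))).
    by have -> : (fun z => a * y z) = (g - x) by rewrite gx.
  rewrite -H//; congr (_ * _); rewrite -energyBr//.
have : 0 <= Q (fun z => x z - g z) (fun z => x z - g z) by exact: energy_ge0.
have s1 := fin_energyB xE gE.
rewrite energyBl// !energyBr// [Q g x]energyC => h1.
have h2 : Q x g - Q x x <= Q g g by have := energy_ge0 G x; have := energy_ge0 G g; lra.
apply: le_trans (_ : a * (Q g g + 1) <= _); last by rewrite /a divfK// gt_eqF.
rewrite ler_wpM2l ?(ltW a0)//; lra.
Qed.

End Resolvent.

(** * Recurrence and stochastic completeness *)

(* By Baire, a function that is everywhere continuous from the right has a
   point of continuity in every interval. *)
Lemma right_continuous_pt (R : realType) (V : normedModType R) (U : R -> V) (a b : R) :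
  (forall s e, 0 < e -> exists2 d, 0 < d & forall r, 0 <= r < d -> `|U (s + r) - U s| <= e) ->
  a < b -> exists2 s, a < s < b &
    forall e, 0 < e -> exists2 d, 0 < d & forall u, `|u - s| < d -> `|U u - U s| <= e.
Proof.
move=> Uc ab.
(* The points near which [U] oscillates by at most [1 / (n + 1)]. Density comes from right
   continuity: on a short interval to the right of any [x], all values are close to [U x]. *)
pose F (n : nat) : set R := [set s | exists2 d, 0 < d & forall u v,
  `|u - s| < d -> `|v - s| < d -> `|U u - U v| <= n.+1%:R^-1].
have Fo n : open (F n) /\ dense (F n).
  split.
    rewrite openE => s [d d0 hd]; apply/nbhs_ballP; exists (d / 2); first by rewrite /= divr_gt0.
    move=> s'; rewrite -ball_normE /= => ss'; exists (d / 2); first by rewrite divr_gt0.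
    have T u : `|u - s'| < d / 2 -> `|u - s| < d.
      move=> us'; rewrite -(subrKA s') (splitr d) (le_lt_trans (ler_normD _ _))//.
      by rewrite ltrD// distrC.
    by move=> u v us' vs'; apply: hd; exact: T.
  move=> O [x Ox] Oo; have := Oo; rewrite openE => /(_ x Ox) /nbhs_ballP[d /= d0 hO].
  have n0 : 0 < n.+1%:R^-1 / 2 :> R by rewrite divr_gt0// invr_gt0.
  have [d' d'0 hU] := Uc x _ n0.
  set m := Num.min d d'; have m0 : 0 < m by rewrite lt_min d0 d'0.
  exists (x + m / 2); split.
    apply: hO; rewrite -ball_normE /= opprD addrA subrr sub0r normrN gtr0_norm ?divr_gt0//.
    apply: (@lt_le_trans _ _ m); last by rewrite /m ge_min lexx.
    by rewrite ltr_pdivrMr// ltr_pMr// ltr1n.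
  exists (m / 2); first by rewrite divr_gt0.
  have T u : `|u - (x + m / 2)| < m / 2 -> `|U u - U x| <= n.+1%:R^-1 / 2.
    rewrite ltr_norml => /andP[u1 u2].
    have md : m <= d' by rewrite /m ge_min lexx orbT.
    have := hU (u - x); rewrite [x + _]addrC subrK; apply.
    by apply/andP; split; lra.
  move=> u v /T hu /T hv; rewrite -(subrKA (U x)) (splitr n.+1%:R^-1).
  by rewrite (le_trans (ler_normD _ _))// lerD// distrC.
have [s [sab hs]] : `]a, b[%classic `&` \bigcap_i F i !=set0.
  apply: (Baire Fo); last exact: interval_open.
  by exists ((a + b) / 2); rewrite /= in_itv /=; apply/andP; split; lra.
exists s; first by move: sab; rewrite /= in_itv.
move=> e e0; have [N _ hN] := near_infty_natSinv_lt (PosNum e0).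
have [d d0 hd] := hs N I; exists d => // u us.
rewrite (le_trans (hd u s us _))// ?subrr ?normr0//.
exact: ltW (hN N (leqnn N)).
Qed.

(** A nonpositive upper right derivative does not by itself exclude an upward jump at a point
    approached from the left; the last condition does. Consider the times up to which
    [N u <= N a + e * (u - a)]: the last condition shows that their supremum is attained, the first
    that it can be exceeded as long as it is less than [b]. *)
Lemma right_dini_le (R : realType) (N : R -> R) (a b : R) : a <= b ->
  (forall s e, a <= s < b -> 0 < e ->
     exists2 d, 0 < d & forall r, 0 < r < d -> N (s + r) <= N s + e * r) ->
  (forall s e, a < s <= b -> 0 < e ->
     exists2 d, 0 < d & forall r, 0 < r < d -> N s <= N (s - r) + e) ->
  N b <= N a.
Proof.
move=> ab Nr Nl.
suff H e : 0 < e -> N b <= N a + e * (b - a).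
  apply/ler_addgt0Pr => e e0.
  have ba0 : 0 < b - a + 1 by rewrite ltr_wpDl// subr_ge0.
  have := H (e / (b - a + 1)) (divr_gt0 e0 ba0); move=> /le_trans; apply.
  rewrite lerD2l mulrAC ler_pdivrMr// ler_wpM2l// ?ltW//; lra.
move=> e0.
pose E := [set s | a <= s <= b /\ forall u, a <= u <= s -> N u <= N a + e * (u - a)].
have Ea : E a.
  split; first by rewrite lexx ab.
  by move=> u ua; have -> : u = a by [apply/eqP; rewrite eq_le andbC]; rewrite subrr mulr0 addr0.
have Esup : has_sup E by split; [exists a|exists b => s [/andP[]]].
set m := sup E.
have am : a <= m by apply: ub_le_sup Ea; exact: Esup.2.
have mb : m <= b by apply: ge_sup; [exists a|move=> s [/andP[]]].
have below u : a <= u < m -> N u <= N a + e * (u - a).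
  move=> /andP[au um]; have [s Es us] := sup_adherent (ltac:(by rewrite subr_gt0) : 0 < m - u) Esup.
  by case: Es => _; apply; rewrite au /=; move: us; rewrite -/m; lra.
have Em : N m <= N a + e * (m - a).
  move: am; rewrite le_eqVlt => /orP[/eqP <-|am]; first by rewrite subrr mulr0 addr0.
  apply/ler_addgt0Pr => e' e'0.
  have [|d d0 hd] := Nl m e' _ e'0; first by rewrite am mb.
  pose r := Num.min (d / 2) ((m - a) / 2).
  have ma0 : 0 < (m - a) / 2 by rewrite divr_gt0// subr_gt0.
  have d20 : 0 < d / 2 by rewrite divr_gt0.
  have r0 : 0 < r by rewrite lt_min d20 ma0.
  have rd : r <= d / 2 by rewrite /r ge_min lexx.
  have rm : r <= (m - a) / 2 by rewrite /r ge_min lexx orbT.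
  have h1 : N m <= N (m - r) + e' by apply: hd; rewrite r0 /=; lra.
  have h2 : N (m - r) <= N a + e * (m - r - a) by apply: below; apply/andP; split; lra.
  have : e * (m - r - a) <= e * (m - a) by rewrite ler_wpM2l ?(ltW e0)//; lra.
  lra.
have : m = b.
  apply/eqP; rewrite eq_le mb /= leNgt; apply/negP => mb'.
  have [|d d0 hd] := Nr m e _ e0; first by rewrite am mb'.
  pose r := Num.min (d / 2) (b - m).
  have d20 : 0 < d / 2 by rewrite divr_gt0.
  have r0 : 0 < r by rewrite lt_min d20 subr_gt0.
  have rd : r <= d / 2 by rewrite /r ge_min lexx.
  have rm : r <= b - m by rewrite /r ge_min lexx orbT.
  have : E (m + r).
    split; first by apply/andP; split; lra.
    move=> u /andP[au umr]; have [um|mu] := ltP u m; first by apply: below; rewrite au.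
    move: mu; rewrite le_eqVlt => /orP[/eqP <- //|mu].
    have := hd (u - m); rewrite [m + _]addrC subrK => h.
    have : N u <= N m + e * (u - m) by apply: h; apply/andP; split; lra.
    lra.
  move=> /(ub_le_sup Esup.2); rewrite -/m; lra.
by move=> <-.
Qed.

Lemma cvg_right0 (R : realType) (f : R -> R) : f t @[t --> 0^'+] --> (0 : R) <->
  forall e, 0 < e -> exists2 d, 0 < d & forall t, 0 < t < d -> `|f t| <= e.
Proof.
split=> [/cvgrPdist_le H e e0|H].
  have /nbhs_ballP[d /= d0 hd] := H e e0; exists d => // t /andP[t0 td].
  have := hd t; rewrite -ball_normE /= sub0r normrN gtr0_norm// => /(_ td t0).
  by rewrite sub0r normrN.
apply/cvgrPdist_le => e e0; have [d d0 hd] := H e e0.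
near=> t; rewrite sub0r normrN; apply: hd; apply/andP; split.
  by near: t; exact: nbhs_right_gt.
by near: t; exact: nbhs_right_lt.
Unshelve. all: by end_near. Qed.

(** * Periodic orbits of a semigroup whose generator is the opposite of a nonnegative operator *)

Section Periodic.
Variables (R : realType) (H : normedModType R) (ip : H -> H -> R).
Variables (A : H -> H -> Prop) (S : R -> H -> H).
Hypothesis ip_sqr : forall x, ip x x = `|x| ^+ 2.
Hypothesis ipC : forall x y, ip x y = ip y x.
Hypothesis ip_CS : forall x y, `|ip x y| <= `|x| * `|y|.
Hypothesis ip_lin : forall a x y z, ip (a *: x + y) z = a * ip x z + ip y z.
Hypothesis A_lin : forall a x y x' y', A x y -> A x' y' ->
  A (a *: x + x') (a *: y + y').
Hypothesis A_ge0 : forall x y, A x y -> 0 <= ip y x.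
Hypothesis A_range : forall f, exists x y, A x y /\ x + y = f.
Hypothesis S_lin : forall t a x y, 0 <= t -> S t (a *: x + y) = a *: S t x + S t y.
Hypothesis S_bound : forall t, 0 <= t -> exists C, forall x, `|S t x| <= C * `|x|.
Hypothesis S_0 : forall x, S 0 x = x.
Hypothesis S_D : forall s t x, 0 <= s -> 0 <= t -> S (s + t) x = S s (S t x).
Hypothesis S_cont : forall x, `|S t x - x| @[t --> 0^'+] --> (0 : R).
Hypothesis S_gen : forall f g,
  `|t^-1 *: (S t f - f) + g| @[t --> 0^'+] --> (0 : R) <-> A f g.

Let SB t x y : 0 <= t -> S t (x - y) = S t x - S t y.
Proof.
by move=> t0; have := S_lin (-1) y x t0; rewrite !scaleN1r addrC => ->; rewrite addrC.
Qed.

Let S_bound' t : 0 <= t -> exists2 C : R, 0 < C & forall x, `|S t x| <= C * `|x|.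
Proof.
move=> /S_bound[C hC]; exists (`|C| + 1); first by rewrite ltr_wpDl.
move=> x; apply: le_trans (hC x) _; rewrite ler_wpM2r//.
by rewrite (le_trans (ler_norm _))// lerDl.
Qed.

Let A_S s x y : 0 <= s -> A x y -> A (S s x) (S s y).
Proof.
move=> s0 /S_gen xy; apply/S_gen; have [C C0 hC] := S_bound' s0.
apply/cvgrPdist_le => e e0; move/cvgrPdist_le: xy => /(_ (e / C) (divr_gt0 e0 C0)) h.
near=> t; rewrite sub0r normrN normr_id.
have t0 : 0 <= t by rewrite ltW//; near: t; exact: nbhs_right_gt.
have -> : t^-1 *: (S t (S s x) - S s x) + S s y = S s (t^-1 *: (S t x - x) + y).
  by rewrite S_lin// SB// -!S_D// [s + t]addrC.
apply: le_trans (hC _) _; rewrite mulrC -ler_pdivlMr//.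
have : `|0 - `|t^-1 *: (S t x - x) + y| | <= e / C by near: t.
by rewrite sub0r normrN normr_id.
Unshelve. all: by end_near. Qed.

Let ipDr x y z : ip z (x + y) = ip z x + ip z y.
Proof. by have := ip_lin 1 x y z; rewrite scale1r mul1r !(ipC z). Qed.

Let ipDl x y z : ip (x + y) z = ip x z + ip y z.
Proof. by have := ip_lin 1 x y z; rewrite scale1r mul1r. Qed.

Let ipZl a x z : ip (a *: x) z = a * ip x z.
Proof.
have := ip_lin a x 0 z; rewrite addr0 => ->.
by have := ip_lin 1 0 0 z; rewrite scale1r addr0 mul1r; lra.
Qed.

Let ipZr a x z : ip z (a *: x) = a * ip z x.
Proof. by rewrite ipC ipZl ipC. Qed.

Let normD_sqr x y : `|x + y| ^+ 2 = `|x| ^+ 2 + 2 * ip x y + `|y| ^+ 2.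
Proof. by rewrite -!ip_sqr ipDl !ipDr [ip y x]ipC; ring. Qed.

(** If [z] is the error of the difference quotient, then [|S r x|^2 = |x|^2 - 2 r <y, x> + 2 r <x,
    z> + r^2 |z - y|^2]. For [|z|] and [r] below [k], the last two terms are at most [k * M * r]. *)
Let norm_deriv x y e : A x y -> 0 < e -> exists2 d, 0 < d & forall r, 0 < r < d ->
  `|S r x| ^+ 2 <= `|x| ^+ 2 - 2 * r * ip y x + e * r.
Proof.
move=> xy e0; have xy' := (S_gen x y).2 xy.
pose M := 2 * `|x| + (1 + `|y|) ^+ 2.
pose k := Num.min 1 (e / M).
have y0 := normr_ge0 y; have x0 := normr_ge0 x.
have M0 : 0 < M by rewrite ltr_wpDl ?mulr_ge0// exprn_gt0// ltr_wpDr.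
have k0 : 0 < k by rewrite lt_min ltr01 divr_gt0.
have k1 : k <= 1 by rewrite /k ge_min lexx.
have kM : k * M <= e by rewrite -ler_pdivlMr// /k ge_min lexx orbT.
have [d d0 hd] := (cvg_right0 _).1 xy' k k0.
exists (Num.min d k); first by rewrite lt_min d0 k0.
move=> r /andP[r0]; rewrite lt_min => /andP[rd rk].
pose z := r^-1 *: (S r x - x) + y.
have zk : `|z| <= k by have := hd r; rewrite normr_id r0 rd; exact.
have SE : S r x = x + r *: (z - y).
  by rewrite /z addrK scalerA divff ?gt_eqF// scale1r addrC subrK.
have zy : `|z - y| <= 1 + `|y|.
  by rewrite (le_trans (ler_normB _ _))// lerD2r (le_trans zk).
have -> : `|S r x| ^+ 2 = `|x| ^+ 2 - 2 * r * ip y x + (2 * r * ip x z + r ^+ 2 * `|z - y| ^+ 2).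
  rewrite SE normD_sqr normrZ ipZr exprMn real_normK ?num_real//.
  by rewrite -scaleN1r ipDr ipZr [ip y x]ipC; ring.
rewrite lerD2l.
have h1 : ip x z <= `|x| * k.
  by rewrite (le_trans (ler_norm _))// (le_trans (ip_CS _ _))// ler_wpM2l.
have h2 : `|z - y| ^+ 2 <= (1 + `|y|) ^+ 2 by rewrite ler_pXn2r// ?nnegrE// addr_ge0.
apply: le_trans (_ : k * M * r <= _); last by rewrite ler_wpM2r// ltW.
rewrite [k * M * r]mulrC [k * M]mulrC mulrA /M mulrDr mulrDl; apply: lerD.
  by rewrite [2 * r]mulrC -!mulrA ler_pM2l// ler_pM2l.
rewrite expr2 -mulrA [X in _ <= X]mulrAC -mulrA ler_pM2l// mulrC.
by rewrite [leRHS]mulrC; exact: (ler_pM (sqr_ge0 _) (ltW r0) h2 (ltW rk)).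
Qed.

Let orbit_right s x e : 0 <= s -> 0 < e ->
  exists2 d, 0 < d & forall r, 0 <= r < d -> `|S (s + r) x - S s x| <= e.
Proof.
move=> s0 e0; have [C C0 hC] := S_bound' s0.
have [d d0 hd] := (cvg_right0 _).1 (S_cont x) (e / C) (divr_gt0 e0 C0).
exists d => // r /andP[]; rewrite le_eqVlt => /orP[/eqP <-|r0] rd.
  by rewrite addr0 subrr normr0 ltW.
rewrite S_D ?(ltW r0)// -SB//; apply: le_trans (hC _) _.
rewrite mulrC -ler_pdivlMr//; have := hd r; rewrite normr_id r0 rd; exact.
Qed.

Lemma periodic_orbit T f : 0 < T -> S T f = f ->
  exists g h, [/\ A g h, g + h = f & ip h g = 0].
Proof.
move=> T0 STf; have [g [h [gh ghf]]] := A_range f.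
(* Both [g] and [S T g] solve [x + A x = f], because [f] is fixed. Their difference [u] is sent by
   [A] to [- u], and nonnegativity of [A] forces [u = 0]. *)
have ST : S T g = g.
  have gh' := A_S (ltW T0) gh.
  have : A (S T g - g) (S T h - h).
    by have := A_lin (-1) gh gh'; rewrite !scaleN1r addrC [- _ + _]addrC.
  move=> /A_ge0; set u := S T g - g.
  have -> : S T h - h = - u.
    have e : S T g + S T h = g + h.
      by rewrite ghf -[RHS]STf -ghf; have := S_lin 1 g h (ltW T0); rewrite !scale1r.
    apply/eqP; rewrite -subr_eq0 opprK /u addrACA -opprD [S T h + _]addrC e.
    by rewrite [h + g]addrC subrr.
  rewrite -scaleN1r ipZl mulN1r oppr_ge0 ip_sqr => h0.
  apply/eqP; rewrite -subr_eq0 -normr_eq0 -sqrf_eq0 eq_le h0 sqr_ge0//.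
have Sper k s : 0 <= s -> S (s + k%:R * T) g = S s g.
  move=> s0; elim: k => [|k IH]; first by rewrite mul0r addr0.
  have sk0 : 0 <= s + k%:R * T by rewrite addr_ge0// mulr_ge0// ltW.
  by rewrite -natr1 mulrDl mul1r addrA (S_D _ sk0 (ltW T0)) ST IH.
(* Continuity at one point [s1], given by Baire, propagates: [s - r] is,
   modulo the period, [s1 - r] moved forward in time. *)
have left_cont s e : 0 < s -> 0 < e ->
    exists2 d, 0 < d & forall r, 0 < r < d -> `|S (s - r) g - S s g| <= e.
  move=> s0 e0.
  (* Extension by zero to negative times keeps the orbit right continuous on the whole line, as the
     Baire argument requires. *)
  pose U s := if 0 <= s then S s g else 0.
  have [|s1 /andP[s10 s11] hs1] := @right_continuous_pt _ _ U 0 1 _ ltr01.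
    move=> u e' e'0; rewrite /U; have [u0|u0] := leP 0 u.
      have [d d0 hd] := orbit_right g u0 e'0; exists d => // r /andP[r0 rd].
      by rewrite addr_ge0// hd// r0.
    exists (- u); first by rewrite oppr_gt0.
    move=> r /andP[r0 ru]; have /lt_geF -> : u + r < 0 by lra.
    by rewrite subrr normr0 ltW.
  have [k kT] : exists k : nat, s1 <= s + k%:R * T.
    exists (Num.truncn (s1 / T)).+1; have := truncnS_gt (s1 / T).
    by rewrite ltr_pdivrMr//; lra.
  have q0 : 0 <= s + k%:R * T - s1 by rewrite subr_ge0.
  have [C C0 hC] := S_bound' q0.
  have [d d0 hd] := hs1 (e / C) (divr_gt0 e0 C0).
  pose d' := Num.min d (Num.min s1 s).
  exists d'; first by rewrite !lt_min d0 s10 s0.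
  move=> r /andP[r0]; rewrite !lt_min => /andP[rd /andP[rs1 rs]].
  have sr0 : 0 <= s - r by rewrite subr_ge0 ltW.
  have s1r0 : 0 <= s1 - r by rewrite subr_ge0 ltW.
  rewrite -(Sper k (s - r) sr0) -(Sper k s (ltW s0)).
  rewrite (_ : s - r + k%:R * T = (s + k%:R * T - s1) + (s1 - r)); last by ring.
  rewrite (_ : s + k%:R * T = (s + k%:R * T - s1) + s1) in hC q0 *; last by ring.
  rewrite addrK in hC q0 *.
  rewrite (S_D g q0 s1r0) (S_D g q0 (ltW s10)) -(SB _ _ q0); apply: le_trans (hC _) _.
  rewrite mulrC -ler_pdivlMr//.
  have := hd (s1 - r); rewrite /U s1r0 (ltW s10); apply.
  by rewrite addrC addKr normrN gtr0_norm.
have c0 := A_ge0 gh.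
(* If [ip h g] were positive, [|S s g|^2] would drop strictly just after time [0]; being
   nonincreasing it could not regain its value at time [T]. *)
exists g, h; split => //; apply/eqP; rewrite eq_le c0 andbT leNgt; apply/negP => cp.
pose N s := `|S s g| ^+ 2.
have Nr s e : 0 <= s -> 0 < e -> exists2 d, 0 < d &
    forall r, 0 < r < d -> N (s + r) <= N s - 2 * r * ip (S s h) (S s g) + e * r.
  move=> s0 e0; have [d d0 hd] := norm_deriv (A_S s0 gh) e0.
  by exists d => // r rd; rewrite /N addrC S_D//; [exact: hd|case/andP: rd => /ltW].
have [d d0 hd] := Nr 0 (ip h g) (lexx 0) cp.
pose r := Num.min (d / 2) (T / 2).
have d20 : 0 < d / 2 by rewrite divr_gt0.
have T20 : 0 < T / 2 by rewrite divr_gt0.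
have r0 : 0 < r by rewrite lt_min d20 T20.
have rd : r <= d / 2 by rewrite /r ge_min lexx.
have rT : r <= T / 2 by rewrite /r ge_min lexx orbT.
have : N r < N 0.
  have := hd r; rewrite add0r !S_0 r0 /= => h1.
  have : N r <= N 0 - 2 * r * ip h g + ip h g * r by apply: h1; lra.
  have : 0 < r * ip h g by rewrite mulr_gt0.
  by lra.
have N0 : N 0 = N T by rewrite /N S_0 ST.
rewrite N0 ltNge => /negP; apply.
apply: right_dini_le; first by lra.
- move=> s e /andP[rs sT] e0; have s0 : 0 <= s by apply: le_trans rs; exact: ltW.
  have [d' d'0 hd'] := Nr s e s0 e0; exists d' => // r' rd'.
  apply: le_trans (hd' r' rd') _; rewrite lerD2r gerDl oppr_le0.
  by rewrite !mulr_ge0// ?(A_ge0 (A_S s0 gh))//; case/andP: rd' => /ltW.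
- move=> s e /andP[rs sT] e0; have s0 : 0 < s by apply: lt_trans rs.
  pose M := 2 * `|S s g| + 1; have M0 : 0 < M by rewrite ltr_wpDl// mulr_ge0.
  pose k := Num.min 1 (e / M).
  have k0 : 0 < k by rewrite lt_min ltr01 divr_gt0.
  have k1 : k <= 1 by rewrite /k ge_min lexx.
  have kM : k * M <= e by rewrite -ler_pdivlMr// /k ge_min lexx orbT.
  have [d' d'0 hd'] := left_cont s k s0 k0; exists d' => // r' rd'.
  have h1 := hd' r' rd'.
  have h2 : `|S s g| <= `|S (s - r') g| + k.
    by rewrite -lerBlDl (le_trans _ h1)// distrC lerB_dist.
  rewrite /N; have := normr_ge0 (S s g); have := normr_ge0 (S (s - r') g).
  move: h2 kM k0 k1; rewrite /M.
  move: `|S s g| `|S (s - r') g| => p q h2 kM k0' k1 q0 p0.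
  have [pk|pk] := leP p k; first by have := sqr_ge0 q; nra.
  have : (p - k) ^+ 2 <= q ^+ 2 by rewrite ler_pXn2r// ?nnegrE; lra.
  rewrite sqrrB; nra.
Qed.

End Periodic.

(** * Recurrence and stochastic completeness of graphs of finite measure *)

Section Recurrence.
Variables (R : realType) (X : countType) (G : graph R X).
Local Notation mu := (vertex_weight G).
Local Notation w := (edge_weight G).
Local Notation mu0 := (@mu_ge0 R X G).
Local Notation we := (half_weight G).
Local Notation we0 := (@half_weight_ge0 R X G).
Local Notation Q := (energy G).
Implicit Types (f g h : X -> R).

(** Every vertex has capacity zero. In this homogeneous form the negation is directly a bound
    [cap * f o ^+ 2 <= Q f f] at some vertex, and the strict inequality forces [g o != 0]. *)
Definition recurrent : Prop := forall o e, 0 < e -> exists g,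
  finitely_supported g /\ Q g g < e * g o ^+ 2.

Hypothesis mu_finite : (total_measure G < +oo)%E.

Lemma mu_summable : abs_summable mu.
Proof. exact/(abs_summable_ge0 mu0). Qed.

Lemma bounded_wl2 f (K : R) : (forall x, `|f x| <= K) -> wl2 mu f.
Proof.
move=> fK; apply: abs_summable_le (abs_summableM (K := K ^+ 2)
  (f := fun x => f x ^+ 2) mu_summable _) => x.
  by rewrite mulrC.
by rewrite normrX lerXn2r// ?nnegrE// (le_trans _ (fK x)).
Qed.

Lemma edge_le_energy f x y : fin_energy G f -> w x y * (f x - f y) ^+ 2 <= 2 * Q f f.
Proof.
move=> fE; have := le_sqr_wdot we0 (x, y) fE.
by rewrite /half_weight /grad /= -/(Q f f); lra.
Qed.

Lemma edge_connected (P : X -> Prop) (o : X) :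
  (forall x y, 0 < w x y -> P x -> P y) -> P o -> forall x, P x.
Proof.
move=> H Po x; have [s [sp <-]] := graph_connected G o x.
elim: s o Po sp => //= y s IH o Po /andP[oy sp].
exact: IH (H _ _ oy Po) sp.
Qed.

Lemma energy0_const f : fin_energy G f -> Q f f = 0 -> forall x y, f x = f y.
Proof.
move=> fE f0 x; apply: (edge_connected (P := fun y => f x = f y) (o := x)) => // y z yz ->.
have := edge_le_energy y z fE; rewrite f0 mulr0 pmulr_rle0// => h.
by apply/eqP; rewrite -subr_eq0 -sqrf_eq0 eq_le h sqr_ge0.
Qed.

Lemma cvg_le0 (I : Type) (F : set_system I) (FF : Filter F) (a b : I -> R) (c : R) :
  (forall i, `|a i - c| <= b i) -> b i @[i --> F] --> (0 : R) -> a i @[i --> F] --> c.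
Proof.
move=> ab b0; apply/cvgrPdist_le => e e0; move/cvgrPdist_le: b0 => /(_ e e0).
apply: filterS => i; rewrite sub0r normrN distrC => h.
exact: le_trans (ab i) (le_trans (ler_norm _) h).
Qed.

Lemma cvg_sqr0 (a : nat -> R) : a n ^+ 2 @[n --> \oo] --> (0 : R) ->
  a n @[n --> \oo] --> (0 : R).
Proof.
move=> a0; apply/cvgrPdist_le => e e0; move/cvgrPdist_le: a0 => /(_ (e ^+ 2) (exprn_gt0 _ e0)).
apply: filterS => n; rewrite !sub0r !normrN normrX.
by rewrite ler_pXn2r// nnegrE// ltW.
Qed.

(** Small energy means a small difference across each edge, and connectedness carries the value [1]
    from [o] to every vertex. *)
Lemma energy_cvg_ptwise (fn : nat -> X -> R) (o : X) :
  (forall n, fin_energy G (fn n)) -> (forall n, fn n o = 1) ->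
  Q (fn n) (fn n) @[n --> \oo] --> (0 : R) -> forall x, fn n x @[n --> \oo] --> (1 : R).
Proof.
move=> fE fo Q0; apply: (edge_connected (o := o)) => [x y xy fx|]; last first.
  by rewrite (_ : (fun n => _) = (fun=> 1)); [exact: cvg_cst|exact/funext].
have h : fn n x - fn n y @[n --> \oo] --> (0 : R).
  apply: cvg_sqr0.
  have k : 2 / w x y * Q (fn n) (fn n) @[n --> \oo] --> (0 : R).
    by rewrite -[X in _ --> X](mulr0 (2 / w x y)); apply: cvgM => //; exact: cvg_cst.
  apply: cvg_le0 k => n; rewrite subr0 ger0_norm ?sqr_ge0//.
  rewrite mulrAC ler_pdivlMr// mulrC; exact: edge_le_energy.
rewrite (_ : (fun n => fn n y) = (fun n => fn n x - (fn n x - fn n y))).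
  by rewrite -[X in _ --> X](subr0 1); exact: cvgB.
by apply/funext => n; rewrite subKr.
Qed.

Lemma energy_contraction f g : fin_energy G f ->
  (forall x y, `|g x - g y| <= `|f x - f y|) -> fin_energy G g /\ Q g g <= Q f f.
Proof.
move=> fE gf.
have H p : grad g p ^+ 2 * we p <= grad f p ^+ 2 * we p.
  by rewrite ler_wpM2r ?we0// -ler_sqrt ?sqr_ge0// !sqrtr_sqr; exact: gf.
have gE : fin_energy G g.
  apply: abs_summable_le fE => p.
  by rewrite !ger0_norm// mulr_ge0 ?sqr_ge0// we0.
split=> //; apply: le_tsum => [||p]; [exact: (wl2_dot we0)..|].
by rewrite -!expr2.
Qed.

(** Division by [g o] normalises the value at [o], and truncation to [[0, 1]] is a contraction of
    the values, which does not increase the energy. *)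
Lemma recurrent_cutoff (o : X) : recurrent -> exists gn : nat -> X -> R,
  [/\ forall n, finitely_supported (gn n), forall n x, 0 <= gn n x <= 1,
      forall n, gn n o = 1 & forall n, Q (gn n) (gn n) <= n.+1%:R^-1].
Proof.
move=> rec.
have H (n : nat) : exists g : X -> R, [/\ finitely_supported g,
    forall x, 0 <= g x <= 1, g o = 1 & Q g g <= n.+1%:R^-1].
  have n0 : 0 < n.+1%:R^-1 :> R by rewrite invr_gt0.
  have [g [gfs gQ]] := rec o _ n0.
  have go : g o != 0.
    apply: contraTneq gQ => ->; rewrite expr0n mulr0 -leNgt; exact: energy_ge0.
  pose k x := (g o)^-1 * g x.
  have kfs : finitely_supported k by exact: fsZ.
  have gE := fs_fin_energy G gfs.
  have kQ : Q k k <= n.+1%:R^-1.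
    rewrite (energyZl _ gE (fin_energyZ _ gE)) (energyZr _ gE gE) mulrA -expr2.
    rewrite exprVn mulrC ler_pdivrMr ?ltW//.
    by rewrite exprn_even_gt0.
  pose c x := Num.min (Num.max (k x) 0) 1.
  have cE x : [\/ k x < 0 /\ c x = 0, 0 <= k x <= 1 /\ c x = k x | 1 < k x /\ c x = 1].
    rewrite /c; have [k0|k0] := ltP (k x) 0.
      by constructor 1; split => //; rewrite min_l.
    have [k1|k1] := leP (k x) 1; first by constructor 2.
    by constructor 3.
  exists c; split.
  - apply: (@sub_finite_set _ _ [set x | k x != 0]) => // x /=; apply: contraNN => /eqP kx.
    by rewrite /c kx maxxx min_l.
  - by move=> x; case: (cE x) => -[h ->]//; rewrite ?lexx ?ler01.
  - by rewrite /c /k mulVf// max_l// min_l.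
  - apply: le_trans kQ; apply: (energy_contraction (fs_fin_energy G kfs) _).2 => x y.
    have := ler_norm (k x - k y); have := ler_norm (k y - k x); rewrite [ `|k y - _| ]distrC.
    rewrite ler_norml => *.
    by case: (cE x) => -[hx ->]; case: (cE y) => -[hy ->]; apply/andP; split; lra.
have [gn hgn] := choice H; exists gn.
by split=> n; have [] := hgn n.
Qed.

Lemma invS_cvg0 : n.+1%:R^-1 @[n --> \oo] --> (0 : R).
Proof.
apply/cvgrPdist_le => e e0; near=> n; rewrite sub0r normrN gtr0_norm ?invr_gt0//.
by apply: ltW; near: n; exact: near_infty_natSinv_lt (PosNum e0).
Unshelve. all: by end_near. Qed.

Lemma wl2_const (c : R) : wl2 mu (fun=> c).
Proof. by apply: (bounded_wl2 (K := `|c|)). Qed.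

Lemma wdot_small (gn : nat -> X -> R) (K : R) :
  (forall n x, `|gn n x| <= K) -> (forall x, gn n x @[n --> \oo] --> (0 : R)) ->
  wnorm mu (gn n) @[n --> \oo] --> (0 : R).
Proof.
move=> gK g0; apply: cvg_sqr0.
have h : tsum (fun x => mu x * `|gn n x ^+ 2|) @[n --> \oo] --> (0 : R).
  apply: (@cvg_tsum _ _ _ _ _ mu (K ^+ 2)); [exact: mu0|exact: mu_summable| |].
    apply: nearW => n x; rewrite normrX lerXn2r// ?nnegrE//.
    exact: le_trans (gK n x).
  move=> x; rewrite -[X in _ --> X](mulr0 0); under eq_fun do rewrite expr2.
  exact: cvgM.
rewrite [X in X @ _](_ : _ = fun n => tsum (fun x => mu x * `|gn n x ^+ 2|))//.
apply/funext => n; rewrite (wnorm_sqr mu0).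
by apply: eq_tsum => x; rewrite ger0_norm ?sqr_ge0// expr2 mulrC.
Qed.

(** Because the measure is finite, dominated convergence turns the pointwise convergence of the
    cutoffs to [1] into convergence in [l^2]. Their energies tend to zero, so [1] lies in the form
    domain, where its gradient vanishes. *)
Lemma recurrent_one : recurrent -> operator_L G (fun=> 1) (fun=> 0).
Proof.
move=> rec; have [x0 _] := graph_nonempty G.
have [gn [gfs g01 go gQ]] := recurrent_cutoff x0 rec.
have g0 : grad (fun _ : X => 1 : R) = (fun _ : X * X => 0 : R).
  by apply/funext => p; rewrite /grad subrr.
have E1 : fin_energy G (fun=> 1).
  by rewrite /fin_energy g0 /wl2; under eq_fun do rewrite expr0n mul0r; exact: abs_summable_cst0.
have Qc : Q (gn n) (gn n) @[n --> \oo] --> (0 : R).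
  apply: cvg_le0 invS_cvg0 => n; rewrite subr0 ger0_norm//; exact: energy_ge0.
have gx := energy_cvg_ptwise (fun n => fs_fin_energy G (gfs n)) go Qc.
have nc : wnorm mu (fun x => gn n x - 1) @[n --> \oo] --> (0 : R).
  apply: (@wdot_small _ 1) => [n x|x].
    by have /andP[h1 h2] := g01 n x; rewrite ler_norml; apply/andP; split; lra.
  by rewrite -[X in _ --> X](subrr 1); apply: cvgB => //; exact: cvg_cst.
have Ec : wnorm we (grad (gn n)) @[n --> \oo] --> (0 : R).
  apply: cvg_sqr0; rewrite [X in X @ _ --> _](_ : _ = fun n => Q (gn n) (gn n))//.
  by apply/funext => n; rewrite (wnorm_sqr we0).
apply/operator_LP; split.
- apply/closure_domP; split=> //; first exact: wl2_const.
  move=> e e0; move/cvgrPdist_le: nc => /(_ e e0) h1; move/cvgrPdist_le: Ec => /(_ e e0) h2.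
  have [n [k1 k2]] := filter_ex (filterI h1 h2).
  exists (gn n); split=> //.
    by move: k1; rewrite sub0r normrN ger0_norm// wnorm_ge0.
  rewrite gradB g0; move: k2; rewrite sub0r normrN ger0_norm ?wnorm_ge0//.
  by under [X in _ -> wnorm _ X <= _]eq_fun do rewrite subr0.
- exact: wl2_const.
- move=> h dh; rewrite /energy g0 /wdot !tsum0// => x; by rewrite !mul0r.
Qed.

(** [is_heat_semigroup] speaks of operations on all functions; the value [0] off [l^2] is an
    arbitrary default. *)
Definition l2_semigroup t (f : X -> R) : X -> R :=
  match pselect (wl2 mu f) with
  | left sf => semigroup (@l2_operator_range R X G) t (L2 (l2_predP sf))
  | right _ => fun=> 0
  end.

Local Notation rng := (@l2_operator_range R X G).
Local Notation S := (semigroup rng).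

Lemma l2_semigroupE t (f : l2 G) : l2_semigroup t f = S t f :> (X -> R).
Proof.
rewrite /l2_semigroup; case: pselect => [sf|]; last by have := l2_in f.
by congr (l2_val (S t _)); apply: val_inj.
Qed.

Lemma l2_semigroup_heat : is_heat_semigroup G l2_semigroup.
Proof.
have lin := @l2_operator_lin R X G; have acc := @l2_operator_acc R X G.
have den := @l2_operator_dense R X G.
have lift f : in_l2 G f -> exists F : l2 G, f = l2_val F.
  by move=> /in_l2E sf; exists (L2 (l2_predP sf)).
split.
- by move=> t f t0 /lift[F ->]; rewrite l2_semigroupE; apply/in_l2E; exact: l2_in.
- move=> t a f g t0 /lift[F ->] /lift[K ->].
  by rewrite !l2_semigroupE -[LHS]/(l2_semigroup t (a *: F + K)) l2_semigroupE (semigroup_linear lin acc rng den).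
- move=> t t0; exists 1 => f /lift[F ->]; rewrite l2_semigroupE mul1r.
  exact: (semigroup_contr lin acc rng den F t0).
- by move=> f /lift[F ->]; rewrite l2_semigroupE semigroup_id.
- move=> s t f s0 t0 /lift[F ->].
  by rewrite l2_semigroupE (semigroupD lin acc rng den)// !l2_semigroupE.
- move=> f /lift[F ->]; under eq_fun do rewrite l2_semigroupE.
  exact: (semigroup_continuous lin acc rng den F).
- move=> f g /lift[F ->] /lift[K ->]; under eq_fun do rewrite l2_semigroupE.
  exact: (semigroup_generator lin acc rng den F K).
Qed.

(** The function [1] is annihilated by [L], hence fixed by the semigroup. Any exhaustion of it
    converges to it in [l^2], again by dominated convergence, and contractivity transfers this to
    the images. *)
Lemma recurrent_complete : recurrent -> stochastically_complete G.
Proof.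
move=> rec; exists l2_semigroup; split; first exact: l2_semigroup_heat.
exists 1; split=> //.
have lin := @l2_operator_lin R X G; have acc := @l2_operator_acc R X G.
have den := @l2_operator_dense R X G.
pose one : l2 G := L2 (l2_predP (wl2_const 1)).
have S1 : S 1 one = one.
  by apply: (semigroup_fixed lin acc rng den ler01); exact: recurrent_one.
move=> fn fs f0 fS f1 x.
have fle n y : fn n y <= 1.
  rewrite -(cvg_lim _ (f1 y))//; apply: limr_ge; first by apply/cvg_ex; exists 1; exact: f1.
  exists n => // m /= nm; elim: m nm => [|m IH]; first by rewrite leqn0 => /eqP ->.
  by rewrite leq_eqVlt => /orP[/eqP <- //|/IH h]; exact: le_trans h (fS _ _).
pose F n : l2 G := L2 (l2_predP (fs_wl2 G (fs n))).
have Fc : `|F n - one| @[n --> \oo] --> (0 : R).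
  have := @wdot_small (fun n x => fn n x - 1) 1; apply => [n y|y].
    have := f0 n y; have := fle n y; rewrite ler_norml => *; apply/andP; split; lra.
  by rewrite -[X in _ --> X](subrr 1); apply: cvgB => //; exact: cvg_cst.
apply: cvg_EFin; first by apply: nearW.
rewrite (_ : (fine \o _) = (fun n => l2_val (S 1 (F n)) x)); last first.
  by apply/funext => n; rewrite /= -l2_semigroupE.
rewrite [X in _ --> X](_ : 1 = l2_val one x)//; apply: l2_cvg_ptwise.
apply/cvgrPdist_le => e e0; move/cvgrPdist_le: Fc => /(_ e e0).
apply: filterS => n; rewrite sub0r normrN normr_id; apply: le_trans.
rewrite -{1}S1 -(semigroupB lin acc rng den _ _ ler01).
by apply: le_trans (semigroup_contr lin acc rng den _ ler01) _; rewrite distrC.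
Qed.

(** [pickle] numbers the countable set of vertices; the vertices of index [< n] serve from here on
    as the exhaustion by finite sets. *)
Lemma exhaustion_fs (n : nat) (f : X -> R) :
  finitely_supported (fun x => if (pickle x < n)%N then f x else 0).
Proof.
apply: (@seq_fs _ _ _ (pmap (@pickle_inv X) (iota 0 n))) => x.
case: ifP => // xn; rewrite mem_pmap => /negP[]; apply/mapP.
by exists (pickle x); [rewrite mem_iota|rewrite pickleK_inv].
Qed.

Lemma exhaustion_cvg (f : X -> R) x :
  (if (pickle x < n)%N then f x else 0) @[n --> \oo] --> f x.
Proof.
apply: cvg_near_cst; exists (pickle x).+1 => // n /= xn.
by rewrite xn.
Qed.

(** [heat_extension] knows only limits along exhaustions. As [1] is in [l^2], boundedness of [P t]
    identifies the limit with [P t] applied to [1]. *)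
Lemma complete_fixed (P : R -> (X -> R) -> X -> R) t : is_heat_semigroup G P -> 0 <= t ->
  heat_extension P t (fun=> 1) (fun=> 1%:E) -> P t (fun=> 1) = fun=> 1.
Proof.
move=> heat t0 ext; apply/funext => x.
pose fn n (x : X) : R := if (pickle x < n)%N then 1 else 0.
have ffs n : finitely_supported (fn n) := exhaustion_fs n (fun=> 1).
have f1 x : fn n x @[n --> \oo] --> (1 : R) := @exhaustion_cvg (fun=> 1) x.
have sfn n := (in_l2E G (fn n)).2 (fs_wl2 G (ffs n)).
have s1 := (in_l2E G (fun=> 1)).2 (wl2_const 1).
have h1 : (P t (fn n) x)%:E @[n --> \oo] --> 1%:E.
  apply: ext => //.
  - by move=> n y; rewrite /fn; case: ifP.
  - move=> n y; rewrite /fn; case: (ltnP (pickle y) n) => [yn|_]; last by case: ifP.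
    by rewrite (ltn_trans yn).
have h2 : P t (fn n) x @[n --> \oo] --> (1 : R) by exact: (fine_cvg h1).
have [C hC] := heat_bounded heat t0.
have h3 : P t (fn n) x @[n --> \oo] --> P t (fun=> 1) x.
  have sP n := (in_l2E G _).1 (heat_l2 heat t0 (sfn n)).
  have sP1 := (in_l2E G _).1 (heat_l2 heat t0 s1).
  apply: (wnorm_cvg_ptwise sP sP1).
  have nc : wnorm mu (fun y => fn n y - 1) @[n --> \oo] --> (0 : R).
    apply: (@wdot_small _ 1) => [n y|y].
      by rewrite /fn; case: ifP => _; rewrite ?subrr ?sub0r ?normrN ?normr0 ?normr1.
    by rewrite -[X in _ --> X](subrr 1); apply: cvgB => //; exact: cvg_cst.
  have k : C * wnorm mu (fun y => fn n y - 1) @[n --> \oo] --> (0 : R).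
    by rewrite -[X in _ --> X](mulr0 C); apply: cvgM => //; exact: cvg_cst.
  apply: cvg_le0 k => n; rewrite subr0 ger0_norm ?wnorm_ge0//.
  have sd : in_l2 G (fun y => fn n y - 1).
    by apply/in_l2E; apply: (wl2B mu0); [exact: fs_wl2|exact: wl2_const].
  have := hC _ sd; congr (_ <= _); congr (wnorm mu _).
  have E : (fun y => fn n y - 1) = (fun y => -1 * (fun=> 1) y + fn n y).
    by apply/funext => y; ring.
  by rewrite E (heat_linear heat)//; apply/funext => y; ring.
by rewrite -(cvg_lim _ h3)// -[RHS](cvg_lim _ h2).
Qed.

(** The family [P] is arbitrary here. The abstract result yields [g + L g = 1] with [g] of zero
    energy, hence constant; once this constant is known to be [1], the approximants of [g] in the
    form norm are the functions sought. *)
Lemma complete_recurrent : stochastically_complete G -> recurrent.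
Proof.
move=> [P [heat [T [T0 ext]]]].
have PT1 := complete_fixed heat (ltW T0) ext.
pose one : l2 G := L2 (l2_predP (wl2_const 1)).
have in_l2' (f : l2 G) : in_l2 G f by apply/in_l2E; exact: l2_in.
have sP t (f : l2 G) : 0 <= t -> wl2 mu (P t f).
  by move=> t0; exact: ((in_l2E G _).1 (heat_l2 heat t0 (in_l2' f))).
(* [P] as an operation on [l2]; the default [0] can occur only at negative times. *)
pose U t (f : l2 G) : l2 G := match pselect (wl2 mu (P t f)) with
  | left h => L2 (l2_predP h) | right _ => 0 end.
have UE t (f : l2 G) : 0 <= t -> l2_val (U t f) = P t f.
  by move=> t0; rewrite /U; case: pselect => // h; have := h (sP t f t0).
have EU (f g : l2 G) : l2_val f = l2_val g -> f = g by exact: val_inj.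
have [|||||||||||||g [k [gk gk1 kg]]] := @periodic_orbit R (l2 G)
    (fun x y => wdot mu x y) (@l2_operator R X G) U _ _ _ _ (@l2_operator_lin R X G)
    _ _ _ _ _ _ _ _ T one T0.
- by move=> x; rewrite l2_norm_sqr.
- by move=> x y; exact: wdotC.
- by move=> x y; exact: (wdot_le_norm mu0 (l2_in x) (l2_in y)).
- move=> a x y z; rewrite -(wdotZl mu0 a (l2_in x) (l2_in z)).
  by rewrite -(wdotDl mu0 (wl2Z a (l2_in x)) (l2_in y) (l2_in z)).
- by move=> x y /l2_operator_ge0 ->; exact: energy_ge0.
- by move=> f; have [x [y [h e]]] := l2_operator_range f ltr01; exists x, y; rewrite scale1r in e.
- move=> t a x y t0; apply: EU; rewrite UE//.
  have := heat_linear heat a t0 (in_l2' x) (in_l2' y).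
  by rewrite -(UE t x t0) -(UE t y t0).
- move=> t t0; have [C hC] := heat_bounded heat t0; exists C => x.
  by have := hC x (in_l2' x); rewrite -UE.
- by move=> x; apply: EU; rewrite UE// (heat_0 heat).
- by move=> s t x s0 t0; apply: EU; rewrite !UE ?addr_ge0// (heat_D heat).
- move=> x; have := heat_continuous heat (in_l2' x).
  move=> /cvg_right0 h; apply/cvg_right0 => e e0; have [d d0 hd] := h e e0.
  exists d => // t td; have := hd t td; rewrite -UE//.
  by case/andP: td => /ltW.
- move=> f g; have := heat_generator heat (in_l2' f) (in_l2' g).
  move=> [h1 h2]; split=> [/cvg_right0 h|h].
    apply: h1; apply/cvg_right0 => e e0; have [d d0 hd] := h e e0.
    exists d => // t td; have := hd t td; rewrite -UE//.
    by case/andP: td => /ltW.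
  move: (h2 h) => /cvg_right0 {}h; apply/cvg_right0 => e e0; have [d d0 hd] := h e e0.
  exists d => // t td; have := hd t td; rewrite -UE//.
  by case/andP: td => /ltW.
- by apply: EU; rewrite UE ?ltW//.
have [dg gh] := (l2_operatorP _ _).1 gk.
have gE := closure_dom_energy dg.
have Qg : Q g g = 0 by rewrite -(l2_operator_ge0 gk).
have gc := energy0_const gE Qg.
move=> o e e0; set c := g o in gc.
have gx x : g x = c by exact: gc.
have kx x : k x = 1 - c.
  have : l2_val (g + k) x = 1 by rewrite gk1.
  by rewrite -[l2_val (g + k) x]/(g x + k x) gx; lra.
have mu_pos : 0 < tsum mu.
  exact: lt_le_trans (vertex_weight_gt0 G o) (@le_term_tsum _ _ mu o mu0 mu_summable).
have c01 : c * (1 - c) = 0.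
  have : wdot mu k g = (c * (1 - c)) * tsum mu.
    rewrite -tsumZ; last exact: mu_summable.
    by apply: eq_tsum => x; rewrite kx gx; ring.
  by rewrite kg => /esym/eqP; rewrite mulf_eq0 (gt_eqF mu_pos) orbF => /eqP.
(* For [c = 0] one would have [L g = 1] with [g] constant; testing with the indicator of [o] gives
   [mu o = 0]. *)
have c1 : c = 1.
  move/eqP: c01; rewrite mulf_eq0 => /orP[/eqP c0|]; last by rewrite subr_eq0 => /eqP.
  pose dl x : R := if x == o then 1 else 0.
  have dfs : finitely_supported dl.
    apply: (@seq_fs _ _ _ [:: o]) => x; rewrite inE /dl.
    by case: eqP.
  have := gh dl (fs_closure_dom G dfs).
  rewrite /wdot; have [_ ->] := @tsum_finite _ _ (fun x => k x * dl x * mu x) [:: o] isT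
    ltac:(by move=> x; rewrite inE /dl => /negbTE ->; rewrite mulr0 mul0r).
  rewrite big_seq1 kx c0 /dl eqxx subr0 !mul1r.
  have -> : Q g dl = 0.
    apply: tsum0 => p; rewrite /grad !gx subrr !mul0r //.
  by move=> h; have := vertex_weight_gt0 G o; rewrite -h ltxx.
have /closure_domP[_ _ appr] := dg.
pose s := Num.sqrt (mu o).
have s0 : 0 < s by rewrite sqrtr_gt0 vertex_weight_gt0.
(* The bound [d <= s / 2] puts [f o] within [1 / 2] of [1], and [d ^+ 2 <= e / 8] makes the energy
   less than [e / 4 <= e * f o ^+ 2]. *)
pose d := Num.min (s / 2) (Num.sqrt (e / 8)).
have d0 : 0 < d by rewrite lt_min divr_gt0// sqrtr_gt0 divr_gt0.
have ds : d <= s / 2 by rewrite /d ge_min lexx.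
have de : d ^+ 2 <= e / 8.
  have : d <= Num.sqrt (e / 8) by rewrite /d ge_min lexx orbT.
  have e80 : 0 <= e / 8 by rewrite divr_ge0// (ltW e0).
  move=> h; rewrite -[leRHS]sqr_sqrtr//.
  by rewrite ler_pXn2r ?nnegrE ?sqrtr_ge0// (ltW d0).
have [f [ffs f1 f2]] := appr d d0; exists f; split=> //.
have fE := fs_fin_energy G ffs.
have Qf : Q f f <= e / 8.
  apply: le_trans de; have -> : Q f f = wnorm we (grad (fun x => f x - g x)) ^+ 2.
    rewrite (wnorm_sqr we0) gradB; apply: eq_tsum => p.
    by rewrite /grad !gx subrr subr0.
  by rewrite ler_pXn2r// ?nnegrE ?wnorm_ge0// ltW.
have fo : 1 / 2 <= f o.
  have sfg := wl2B mu0 (fs_wl2 G ffs) (l2_in g).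
  have := le_sqr_wdot mu0 o sfg; rewrite -(wnorm_sqr mu0) => h.
  have : (f o - g o) ^+ 2 * mu o <= (s / 2) ^+ 2.
    apply: le_trans h _; rewrite ler_pXn2r// ?nnegrE ?wnorm_ge0//.
      exact: le_trans f1 ds.
    by rewrite divr_ge0// (ltW s0).
  rewrite exprMn /s sqr_sqrtr ?mu0// [mu o * _]mulrC ler_pM2r ?vertex_weight_gt0// gx c1.
  rewrite -ler_sqrt ?sqr_ge0// !sqrtr_sqr ler_norml => /andP[h1 _].
  move: h1; rewrite ger0_norm ?invr_ge0//; lra.
apply: le_lt_trans Qf _; have : 1 / 4 <= f o ^+ 2 by nra.
nra.
Qed.

End Recurrence.

(** * Conservation of mass *)

Lemma nonlinearity_le (R : realType) (phi : R -> R) : nonlinearity phi ->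
  forall s t, s <= t -> phi s <= phi t.
Proof.
by move=> [_ h _ _] s t; rewrite le_eqVlt => /orP[/eqP -> //|]; exact: h.
Qed.

Lemma is_derive_bigsum (R : realType) (I : Type) (s : seq I) (f : I -> R -> R)
    (df : I -> R) (r : R) : (forall i, is_derive r 1 (f i) (df i)) ->
  is_derive r 1 (fun t => \sum_(i <- s) f i t) (\sum_(i <- s) df i).
Proof.
move=> h; elim: s => [|i s IH].
  rewrite big_nil; under eq_fun do rewrite big_nil; exact: is_derive_cst.
rewrite big_cons; under eq_fun do rewrite big_cons.
exact: (is_deriveD (f := f i) (g := fun t => \sum_(i <- s) f i t)).
Qed.

(** * Green's formulas and equilibrium potentials *)

Section Laplacian.
Variables (R : realType) (X : countType) (G : graph R X).
Local Notation mu := (vertex_weight G).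
Local Notation w := (edge_weight G).
Local Notation mu0 := (@mu_ge0 R X G).
Local Notation Q := (energy G).
Local Notation Lap := (laplacian G).
Implicit Types (f g h : X -> R).

Definition deg x : R := tsum (w x).

Lemma deg_ge0 x : 0 <= deg x.
Proof. by apply: tsum_ge0 => y; exact: edge_weight_ge0. Qed.

Lemma edge_summableM x f (K : R) : (forall y, `|f y| <= K) ->
  abs_summable (fun y => w x y * f y).
Proof. by move=> fK; exact: (abs_summableM (edge_summable G x) fK). Qed.

Lemma laplacianE f (K : R) x : (forall y, `|f y| <= K) ->
  Lap f x = (mu x)^-1 * (deg x * f x - tsum (fun y => w x y * f y)).
Proof.
move=> fK; rewrite /laplacian; congr (_ * _).
rewrite (@eq_tsum _ _ _ (fun y => f x * w x y - w x y * f y)); last by move=> y; ring.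
rewrite tsumB ?tsumZ//; first by rewrite mulrC.
- exact: edge_summable.
- by apply: abs_summableZ; exact: edge_summable.
- exact: edge_summableM fK.
Qed.

Lemma mu_neq0 x : mu x != 0.
Proof. by rewrite gt_eqF// vertex_weight_gt0. Qed.

Lemma mu_laplacian f x : Lap f x * mu x = tsum (fun y => w x y * (f x - f y)).
Proof. by rewrite /laplacian mulrC mulrA divff ?mul1r// mu_neq0. Qed.

Lemma laplacian_le f (K : R) x : (forall y, 0 <= f y <= K) -> `|Lap f x| <= deg x / mu x * K.
Proof.
move=> fK; have fK' y : `|f y| <= K by have /andP[h1 h2] := fK y; rewrite ger0_norm.
have K0 : 0 <= K by have /andP[h1 h2] := fK x; exact: le_trans h2.
rewrite (laplacianE x fK') normrM gtr0_norm ?invr_gt0 ?vertex_weight_gt0//.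
rewrite [deg x / _]mulrC -mulrA ler_wpM2l ?invr_ge0 ?mu0//.
have h0 : 0 <= tsum (fun y => w x y * f y).
  by apply: tsum_ge0 => y; rewrite mulr_ge0 ?edge_weight_ge0//; case/andP: (fK y).
have h1 : tsum (fun y => w x y * f y) <= deg x * K.
  rewrite /deg mulrC -tsumZ; last exact: edge_summable.
  apply: le_tsum; first exact: edge_summableM fK'.
    by apply: abs_summableZ; exact: edge_summable.
  by move=> y; rewrite mulrC ler_wpM2r ?edge_weight_ge0//; case/andP: (fK y).
have /andP[f0 f1] := fK x.
have h2 : deg x * f x <= deg x * K by rewrite ler_wpM2l ?deg_ge0.
have h3 : 0 <= deg x * f x by rewrite mulr_ge0 ?deg_ge0.
by rewrite ler_norml; apply/andP; split; lra.
Qed.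

Lemma fs_bounded f : finitely_supported f -> exists K, forall x, `|f x| <= K.
Proof.
move=> /fs_seq[s us fs]; exists (\sum_(x <- s) `|f x|) => x.
have [xs|xs] := boolP (x \in s); last by rewrite fs// normr0 sumr_ge0.
by rewrite (big_rem x)//= lerDl sumr_ge0.
Qed.

(** [Q g f] is the mean of the sums of [A] and of its transpose, which agree. The finite support of
    [g] and the bound on [f] make [A] summable over pairs. *)
Lemma greenl f (K : R) g : finitely_supported g -> (forall x, `|f x| <= K) ->
  Q g f = tsum (fun x => g x * Lap f x * mu x).
Proof.
move=> gfs fK.
pose A (p : X * X) := w p.1 p.2 * g p.1 * (f p.1 - f p.2).
have sA : abs_summable A.
  apply: (@fs_edge_summable R X G g (fun p => f p.1 - f p.2) (K + K) gfs) => p.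
  by rewrite (le_trans (ler_normB _ _))// lerD.
have sA' := abs_summable_swap sA.
have -> : Q g f = 1 / 2 * (tsum A + tsum (fun p : X * X => A (p.2, p.1))).
  rewrite -tsumD// -tsumZ; last exact: abs_summableD.
  apply: eq_tsum => -[x y]; rewrite /A /half_weight /grad /= [w y x]edge_weight_sym.
  by field.
rewrite -(tsum_swap A); have [_ _ ->] := tsum_pair sA.
have -> (a : R) : 1 / 2 * (a + a) = a by field.
apply: eq_tsum => x; rewrite -mulrA mu_laplacian -tsumZ; last first.
  apply: (@edge_summableM x _ (K + K)) => y.
  by rewrite (le_trans (ler_normB _ _))// lerD.
by apply: eq_tsum => y; rewrite /A /=; ring.
Qed.

(** Without local finiteness [Lap g] can have infinite support, so summability of the right-hand
    side is part of the claim. *)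
Lemma greenr f (K : R) g : finitely_supported g -> (forall x, `|f x| <= K) ->
  abs_summable (fun x => f x * (Lap g x * mu x)) /\
  Q g f = tsum (fun x => f x * (Lap g x * mu x)).
Proof.
move=> gfs fK; have [K' gK] := fs_bounded gfs.
pose B (p : X * X) := w p.1 p.2 * g p.1 * f p.1.
pose C (p : X * X) := w p.1 p.2 * g p.1 * f p.2.
have sB : abs_summable B by exact: (@fs_edge_summable R X G g (fun p => f p.1) K gfs (fun p => fK p.1)).
have sC : abs_summable C by exact: (@fs_edge_summable R X G g (fun p => f p.2) K gfs (fun p => fK p.2)).
have sB' := abs_summable_swap sB; have sC' := abs_summable_swap sC.
pose A (p : X * X) := B p - C (p.2, p.1).
have sA : abs_summable A by exact: abs_summableB.
have sA' := abs_summable_swap sA.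
have [_ s2 tA] := tsum_pair sA.
have E x : tsum (fun y => A (x, y)) = f x * (Lap g x * mu x).
  rewrite mu_laplacian -tsumZ; last first.
    apply: (@edge_summableM x _ (K' + K')) => y.
    by rewrite (le_trans (ler_normB _ _))// lerD.
  apply: eq_tsum => y; rewrite /A /B /C /= [w y x]edge_weight_sym; ring.
split.
  by move: s2; rewrite (_ : (fun x => _) = (fun x => f x * (Lap g x * mu x)))//; apply/funext.
rewrite -(eq_tsum E) -tA.
have -> : Q g f = 1 / 2 * (tsum A + tsum (fun p : X * X => A (p.2, p.1))).
  rewrite -tsumD// -tsumZ; last exact: abs_summableD.
  apply: eq_tsum => -[x y]; rewrite /A /B /C /half_weight /grad /= [w y x]edge_weight_sym.
  by field.
by rewrite -(tsum_swap A); field.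
Qed.

(* The potential is the limit of the iteration of the mean value operator with
   value [1] at [o] and [0] outside the finite set of the [x] with index [< n]. *)
Lemma equilibrium_potential (n : nat) (o : X) : (pickle o < n)%N -> exists e : X -> R,
  [/\ forall x, ~~ (pickle x < n)%N -> e x = 0, forall x, 0 <= e x <= 1, e o = 1,
      forall x, (pickle x < n)%N -> x != o -> Lap e x = 0
    & forall x, x != o -> Lap e x <= 0].
Proof.
move=> on.
pose T (f : X -> R) x := if x == o then 1 else
  if (pickle x < n)%N then (deg x)^-1 * tsum (fun y => w x y * f y) else 0.
pose e_ k := iter k T (fun=> 0).
have T01 f : (forall x, 0 <= f x <= 1) -> forall x, 0 <= T f x <= 1.
  move=> f01 x; rewrite /T; case: ifP => _; first by rewrite ler01 lexx.
  case: ifP => _; last by rewrite lexx ler01.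
  have fK y : `|f y| <= 1 by have /andP[h1 h2] := f01 y; rewrite ger0_norm.
  have h0 : 0 <= tsum (fun y => w x y * f y).
    by apply: tsum_ge0 => y; rewrite mulr_ge0 ?edge_weight_ge0//; case/andP: (f01 y).
  apply/andP; split; first by rewrite mulr_ge0// invr_ge0 deg_ge0.
  have [d0|d0] := eqVneq (deg x) 0; first by rewrite d0 invr0 mul0r ler01.
  have dp : 0 < deg x by rewrite lt_def d0 deg_ge0.
  rewrite ler_pdivrMl// mulr1; apply: le_tsum; [exact: edge_summableM fK|exact: edge_summable|].
  by move=> y; rewrite ler_piMr ?edge_weight_ge0//; case/andP: (f01 y).
have e01 k x : 0 <= e_ k x <= 1.
  by elim: k x => [x|k IH]; [rewrite lexx ler01|exact: T01].
have eK k y : `|e_ k y| <= 1 by have /andP[h1 h2] := e01 k y; rewrite ger0_norm.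
have emono k x : e_ k x <= e_ k.+1 x.
  elim: k x => [x|k IH x]; first by case/andP: (e01 1%N x).
  rewrite /e_ !iterS -/(e_ k) -/(T (e_ k)) {1 2}/T; case: ifP => // _; case: ifP => // _.
  rewrite ler_wpM2l ?invr_ge0 ?deg_ge0//; apply: le_tsum; [exact: edge_summableM (eK k)|exact: edge_summableM (eK k.+1)|].
  by move=> y; rewrite ler_wpM2l ?edge_weight_ge0//; exact: IH.
have ecvg x : cvg (e_ k x @[k --> \oo]).
  apply: nondecreasing_is_cvgn; first by apply/nondecreasing_seqP => k; exact: emono.
  by exists 1 => _ [k _ <-]; case/andP: (e01 k x).
pose e x := lim (e_ k x @[k --> \oo]).
have e_lim x : e_ k x @[k --> \oo] --> e x by exact: ecvg.
have e1 x : 0 <= e x <= 1.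
  apply/andP; split.
    by apply: limr_ge (ecvg x) _; apply: nearW => k; case/andP: (e01 k x).
  by apply: limr_le (ecvg x) _; apply: nearW => k; case/andP: (e01 k x).
have eK' y : `|e y| <= 1 by have /andP[h1 h2] := e1 y; rewrite ger0_norm.
have eT x : e x = T e x.
  have h1 : e_ k.+1 x @[k --> \oo] --> e x by rewrite (cvg_shiftS (fun k => e_ k x)); exact: e_lim.
  have h2 : e_ k.+1 x @[k --> \oo] --> T e x.
    rewrite /e_ /=; under eq_fun do rewrite -/(e_ _).
    rewrite /T; case: ifP => _; first exact: cvg_cst.
    case: ifP => _; last exact: cvg_cst.
    apply: cvgM; first exact: cvg_cst.
    by apply: (@cvg_tsum_mul _ _ _ _ _ (w x) 1) => //; [exact: edge_weight_ge0|exact: edge_summable].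
  by rewrite -(cvg_lim _ h1)// -[RHS](cvg_lim _ h2).
have eout x : ~~ (pickle x < n)%N -> e x = 0.
  move=> xn; rewrite eT /T (negbTE xn); case: eqP => // xo.
  by move: xn; rewrite xo on.
have lapin x : (pickle x < n)%N -> x != o -> Lap e x = 0.
  move=> xn xo; rewrite (laplacianE x eK').
  have -> : deg x * e x = tsum (fun y => w x y * e y).
    rewrite {1}eT /T (negbTE xo) xn; have [d0|d0] := eqVneq (deg x) 0; last by rewrite mulVKf.
    rewrite d0 mul0r; apply/esym/tsum0 => y.
    have := @le_term_tsum _ _ (w x) y (edge_weight_ge0 G x) (edge_summable G x).
    rewrite -/(deg x) d0 => h; have -> : w x y = 0.
      by apply/eqP; rewrite eq_le h edge_weight_ge0.
    by rewrite mul0r.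
  by rewrite subrr mulr0.
exists e; split => //; first by rewrite eT /T eqxx.
(* Outside the finite set [e x = 0] is the minimum of [e], so the Laplacian is nonpositive there. *)
move=> x xo; have [xn|xn] := boolP (pickle x < n)%N; first by rewrite lapin.
rewrite (laplacianE x eK') (eout _ xn) mulr0 sub0r mulrN oppr_le0.
rewrite mulr_ge0 ?invr_ge0 ?mu0//; apply: tsum_ge0 => y.
by rewrite mulr_ge0 ?edge_weight_ge0//; case/andP: (e1 y).
Qed.

(** As [Lap e <= 0] away from [o], a function [0 <= f <= K] satisfies [Q e f <= K * c], where
    [c = Lap e o * mu o = Q e e]. The lower bound is the same inequality for [K - f], since [Q e]
    ignores constants. Finally [c <= d] by Cauchy-Schwarz against the function [h] given by
    recurrence. *)
Lemma recurrent_potential (o : X) (d : R) : recurrent G -> 0 < d -> exists e : X -> R,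
  [/\ finitely_supported e, forall x, 0 <= e x <= 1, e o = 1, Q e e <= d
    & forall f (K : R), (forall x, 0 <= f x <= K) -> `|Q e f| <= K * d].
Proof.
move=> rec d0; have [h [hfs hQ]] := rec o d d0.
have ho : h o != 0.
  apply: contraTneq hQ => ->; rewrite expr0n mulr0 -leNgt; exact: energy_ge0.
have [s us hs] := fs_seq hfs.
(* The finite set must contain [o] and the support of [h], so that [Qeh] applies to [h]. *)
pose n := (maxn (pickle o) (\max_(x <- s) pickle x)).+1.
have on : (pickle o < n)%N by rewrite ltnS leq_maxl.
have sn x : x \in s -> (pickle x < n)%N.
  move=> xs; rewrite ltnS; apply: leq_trans (leq_maxr _ _).
  exact: (leq_bigmax_seq (F := pickle)).
have [e [eout e01 eo lapin lapout]] := equilibrium_potential on.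
have efs : finitely_supported e.
  have := @exhaustion_fs R X n e; rewrite (_ : (fun x => _) = e)//.
  by apply/funext => x; case: ifPn => // /eout.
have eK y : `|e y| <= 1 by have /andP[h1 h2] := e01 y; rewrite ger0_norm.
pose c := Lap e o * mu o.
have hE := fs_fin_energy G hfs; have eE := fs_fin_energy G efs.
have Qeh g : finitely_supported g -> (forall x, ~~ (pickle x < n)%N -> g x = 0) ->
    Q g e = g o * c.
  move=> gfs gout; rewrite (greenl gfs eK).
  have [_ ->] := @tsum_finite _ _ (fun x => g x * Lap e x * mu x) [:: o] isT ltac:(
    by move=> x; rewrite inE => xo; have [xn|xn] := boolP (pickle x < n)%N;
       [rewrite lapin// mulr0 mul0r|rewrite gout// !mul0r]).
  by rewrite big_seq1 /c mulrA.
have hout x : ~~ (pickle x < n)%N -> h x = 0.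
  by move=> xn; apply: hs; apply: contra xn => /sn.
have Qee : Q e e = c by rewrite Qeh// eo mul1r.
have cd : c <= d.
  have := wdot_CS (@half_weight_ge0 R X G) hE eE; rewrite -/(Q h e) -/(Q h h) -/(Q e e) Qee Qeh//.
  have c0 : 0 <= c by rewrite -Qee; exact: energy_ge0.
  move: c0; rewrite le_eqVlt => /orP[/eqP <- _|c0]; first exact: ltW.
  rewrite exprMn expr2 [c ^+ 2]expr2 mulrA ler_pM2r// -expr2 => h1.
  have h2 : h o ^+ 2 * c < d * h o ^+ 2 by exact: le_lt_trans h1 hQ.
  by rewrite ltW//; move: h2; rewrite mulrC ltr_pM2r// exprn_even_gt0.
have c0 : 0 <= c by rewrite -Qee; exact: energy_ge0.
have up f (K : R) : (forall x, 0 <= f x <= K) -> Q e f <= K * d.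
  move=> fK; have fK' x : `|f x| <= K by have /andP[h1 h2] := fK x; rewrite ger0_norm.
  have [s1 ->] := greenr efs fK'.
  have [s2 t2] := @tsum_finite _ _ (fun x => if x == o then K * d else 0) [:: o] isT
    ltac:(by move=> x; rewrite inE => /negbTE ->).
  rewrite big_seq1 eqxx in t2; rewrite -t2; apply: le_tsum => // x.
  have /andP[f0 f1] := fK x; case: eqP => [->|/eqP xo].
    have /andP[fo0 fo1] := fK o.
    by apply: ler_pM => //.
  by rewrite mulr_ge0_le0// mulr_le0_ge0 ?lapout// mu0.
exists e; split => //; first by rewrite Qee.
move=> f K fK; rewrite ler_norml up// andbT lerNl.
have fK' x : `|f x| <= K by have /andP[h1 h2] := fK x; rewrite ger0_norm.
have K0 : 0 <= K by have /andP[h1 h2] := fK o; exact: le_trans h2.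
have := up (fun x => K - f x) K; have -> : Q e (fun x => K - f x) = - Q e f.
  by rewrite -tsumN; apply: eq_tsum => p; rewrite /grad; ring.
by apply=> x; have /andP[h1 h2] := fK x; apply/andP; split; lra.
Qed.

Hypothesis mu_finite : (total_measure G < +oo)%E.

Lemma mass_tsum f (K : R) : (forall x, 0 <= f x <= K) ->
  mass G f = (tsum (fun x => mu x * f x))%:E.
Proof.
move=> fK; rewrite -tsum_ge0_EFin.
- by apply: eq_esum => x _; rewrite mulrC.
- by move=> x; rewrite mulr_ge0 ?mu0//; case/andP: (fK x).
- apply: (abs_summableM (K := K)); first exact: mu_summable.
  by move=> x; have /andP[h1 h2] := fK x; rewrite ger0_norm.
Qed.

(** * Solutions on a recurrent graph conserve mass *)

Section Conservation.
Variables (phi : R -> R) (T : R) (u0 : X -> R) (u : R -> X -> R).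
Hypotheses (phi_I : nonlinearity phi) (rec : recurrent G).
Hypothesis sol : bp_solution G phi T u0 u.

(** The mean value theorem replaces integration in time: the tested mass [F], a finite sum, has
    derivative [- Q (e_ n) (phi \o u r)], of modulus at most [K / (n + 1)]. Dominated convergence
    removes the test function, since [e_ n] tends to [1] and the measure is finite. *)
Lemma recurrent_conserves : conserves_mass G T u0 u.
Proof.
have [[_ ucont uder ueq uinit] [[M uM] u_ge0]] := sol.
have [_ _ _ phi0] := phi_I.
move=> t /andP[t0 tT].
have uM' s x : 0 <= s <= T -> 0 <= u s x <= M.
  move=> sT; rewrite u_ge0//=; exact: le_trans (ler_norm _) (uM _ _ sT).
have T00 : 0 <= (0 : R) <= T by rewrite lexx (le_trans t0 tT).
have tT' : 0 <= t <= T by rewrite t0 tT.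
have u0E : u0 = u 0 by apply/funext => x; rewrite uinit.
rewrite u0E (mass_tsum (fun x => uM' t x tT')) (mass_tsum (fun x => uM' 0 x T00)).
congr EFin; apply/eqP; rewrite -subr_eq0 -normr_eq0 eq_le normr_ge0 andbT.
pose K := phi M.
have phiK s x : 0 <= s <= T -> 0 <= (phi \o u s) x <= K.
  move=> sT; have /andP[h1 h2] := uM' s x sT.
  by rewrite -{1}phi0 /= !(nonlinearity_le phi_I).
have [] := graph_nonempty G => o _.
have smu := mu_summable mu_finite.
have [e_ he] := choice (fun n : nat => recurrent_potential o rec
  (ltac:(by rewrite invr_gt0) : 0 < n.+1%:R^-1 :> R)).
have e01 n x : 0 <= e_ n x <= 1 by have [_ h _ _ _] := he n.
have efs n : finitely_supported (e_ n) by have [h _ _ _ _] := he n.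
have e_cvg x : e_ n x @[n --> \oo] --> (1 : R).
  apply: (@energy_cvg_ptwise R X G e_ o) => [n|n|].
  - exact: fs_fin_energy.
  - by have [_ _ h _ _] := he n.
  - apply: cvg_le0 (@invS_cvg0 R) => n; rewrite subr0 ger0_norm ?energy_ge0//.
    by have [_ _ _ h _] := he n.
have M0 : 0 <= M by have /andP[h1 h2] := uM' 0 o T00; exact: le_trans h2.
pose D x := u t x - u 0 x.
have DM x : `|D x| <= M.
  have /andP[h1 h2] := uM' t x tT'; have /andP[h3 h4] := uM' 0 x T00.
  by rewrite /D ler_norml; apply/andP; split; lra.
have smD : abs_summable (fun x => mu x * D x) by exact: abs_summableM smu DM.
have -> : tsum (fun x => mu x * u t x) - tsum (fun x => mu x * u 0 x) = tsum (fun x => mu x * D x).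
  rewrite -tsumB; first by apply: eq_tsum => x; rewrite /D mulrBr.
  - by apply: (abs_summableM smu (K := M)) => x; exact: uM.
  - by apply: (abs_summableM smu (K := M)) => x; exact: uM.
have test n : `|tsum (fun x => mu x * (e_ n x * D x))| <= K * n.+1%:R^-1 * t.
  have [s us es] := fs_seq (efs n).
  pose F r := \sum_(x <- s) e_ n x * mu x * u r x.
  have FE r : tsum (fun x => e_ n x * mu x * u r x) = F r.
    by apply: (tsum_finite us _).2 => x /es ->; rewrite !mul0r.
  have -> : tsum (fun x => mu x * (e_ n x * D x)) = F t - F 0.
    have [_ ->] := tsum_finite us (f := fun x => mu x * (e_ n x * D x)) ltac:(
      by move=> x /es ->; rewrite mul0r mulr0).
    by rewrite /F -sumrB; apply: eq_bigr => x _; rewrite /D; ring.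
  pose F' r := - Q (e_ n) (phi \o u r).
  have Fder r : r \in `]0, t[ -> is_derive r 1 F (F' r).
    rewrite in_itv /= => /andP[r0 rt].
    have rT : 0 < r < T by rewrite r0 (lt_le_trans rt).
    have rT' : 0 <= r <= T by rewrite (ltW r0) (ltW (lt_le_trans rt tT)).
    have -> : F' r = \sum_(x <- s) e_ n x * mu x *: derive1 (fun s => u s x) r.
      rewrite /F' (greenl (efs n) (K := K)); last first.
        by move=> x; have /andP[h1 h2] := phiK r x rT'; rewrite ger0_norm.
      rewrite (tsum_finite us _).2; last by move=> x /es ->; rewrite !mul0r.
      rewrite -sumrN; apply: eq_bigr => x _.
      have /eqP := ueq r x rT; rewrite addr_eq0 => /eqP ->.
      by rewrite /GRing.scale /=; ring.
    apply: is_derive_bigsum => x; have [dx _] := uder x r rT.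
    by apply: is_deriveZ; rewrite derive1E; exact: derivableP.
  have Fcont : {within `[0, t], continuous F}.
    have -> : F = fun r => \sum_(x <- s) e_ n x * mu x * u r x by [].
    move=> r; apply: cvg_big => [|x _]; first exact: add_continuous.
    apply: cvgM; first exact: cvg_cst.
    have cx : {within `[0, t], continuous (fun s => u s x)}.
      apply: continuous_subspaceW (ucont x); apply: subset_itvl.
      by rewrite bnd_simp.
    exact: cx.
  have [r rt ->] := MVT_segment t0 Fder Fcont.
  rewrite subr0 normrM (ger0_norm t0) ler_wpM2r// normrN.
  have [_ _ _ _ h] := he n; apply: h => x; apply: phiK.
  by move: rt; rewrite in_itv /= => /andP[-> /le_trans]; apply.
have lim1 : K * n.+1%:R^-1 * t @[n --> \oo] --> (0 : R).
  rewrite -[X in _ --> X](_ : K * 0 * t = 0); last by ring.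
  apply: cvgM; last exact: cvg_cst.
  by apply: cvgM; [exact: cvg_cst|exact: invS_cvg0].
have lim2 : tsum (fun x => mu x * (e_ n x * D x)) @[n --> \oo] --> tsum (fun x => mu x * D x).
  apply: (@cvg_tsum_mul _ _ _ _ _ mu M) => //; first exact: mu0.
    move=> n x; have /andP[h1 h2] := e01 n x; rewrite normrM ger0_norm//.
    by rewrite (le_trans _ (DM x))// ler_piMl.
  by move=> x; rewrite -[X in _ --> X]mul1r; apply: cvgM => //; exact: cvg_cst.
have lim3 : tsum (fun x => mu x * (e_ n x * D x)) @[n --> \oo] --> (0 : R).
  by apply: cvg_le0 lim1 => n; rewrite subr0; exact: test.
by rewrite -(cvg_lim _ lim2)// (cvg_lim _ lim3)// normr0.
Qed.

End Conservation.

End Laplacian.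

(** * Nonuniqueness *)

(* The infimum runs over shifts to the left only, and [phi] is replaced by [0] on
   the negative half-line: this gives an approximation from below that is
   nondecreasing, Lipschitz, and vanishes at [0]. *)
Section Approximation.
Variables (R : realType) (phi : R -> R).
Hypothesis phi_I : nonlinearity phi.

Let f s := phi (Num.max s 0).

Let f_le s t : s <= t -> f s <= f t.
Proof.
move=> st; apply: (nonlinearity_le phi_I); rewrite ge_max le_max st /= le_max lexx orbT//.
Qed.

Let f_ge0 s : 0 <= f s.
Proof.
by have [_ _ _ phi0] := phi_I; rewrite -phi0 (nonlinearity_le phi_I)// le_max lexx orbT.
Qed.

Let fE s : 0 <= s -> f s = phi s.
Proof. by move=> s0; rewrite /f max_l. Qed.

Let f_cont s (e : R) : 0 < e -> exists2 d, 0 < d & forall t, `|t - s| <= d -> `|f t - f s| <= e.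
Proof.
move=> e0; have [phi_c _ _ _] := phi_I.
have /cvgrPdist_le/(_ e e0) := phi_c (Num.max s 0).
move=> /nbhs_ballP[d /= d0 hd]; exists (d / 2); first by rewrite divr_gt0.
move=> t ts; rewrite distrC; apply: hd; rewrite -ball_normE /= distrC.
apply: le_lt_trans (_ : `|t - s| < d); last by apply: le_lt_trans ts _; rewrite ltr_pdivrMr// ltr_pMr// ltr1n.
have := ler_norm (t - s); have := ler_norm (s - t); rewrite [ `|s - t| ]distrC ler_norml.
by case: (leP t 0); case: (leP s 0) => *; apply/andP; split; lra.
Qed.

Definition lipschitz_below (n : nat) s :=
  inf [set f (s - h) + n%:R * h | h in [set h : R | 0 <= h]].
Local Notation psi := lipschitz_below.

Let psi_lb n s : has_lbound [set f (s - h) + n%:R * h | h in [set h : R | 0 <= h]].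
Proof. by exists 0 => _ [h h0 <-]; rewrite addr_ge0// mulr_ge0. Qed.

Let psi_inf n s : has_inf [set f (s - h) + n%:R * h | h in [set h : R | 0 <= h]].
Proof. by split; [exists (f (s - 0) + n%:R * 0), 0 => //=|exact: psi_lb]. Qed.

Let psi_le_term n s h : 0 <= h -> psi n s <= f (s - h) + n%:R * h.
Proof. by move=> h0; apply: ge_inf; [exact: psi_lb|exists h]. Qed.

Let le_psi n s c : (forall h, 0 <= h -> c <= f (s - h) + n%:R * h) -> c <= psi n s.
Proof. by move=> H; apply: lb_le_inf; [exact: (psi_inf n s).1|move=> _ [h h0 <-]; exact: H]. Qed.

Lemma lipschitz_below_le n s t : s <= t -> psi n s <= psi n t.
Proof.
move=> st; apply: le_psi => h h0; apply: le_trans (psi_le_term n s h0) _.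
by rewrite lerD2r f_le// lerB.
Qed.

Lemma lipschitz_below_lip n s t : s <= t -> psi n t <= psi n s + n%:R * (t - s).
Proof.
move=> st; rewrite -lerBlDr; apply: le_psi => h h0; rewrite lerBlDr.
have := @psi_le_term n t (h + (t - s)); rewrite (_ : t - (h + (t - s)) = s - h); last by ring.
by rewrite addr_ge0 ?subr_ge0// => /(_ isT); rewrite mulrDr addrA.
Qed.

Lemma lipschitz_below_ge0 n s : 0 <= psi n s.
Proof. by apply: le_psi => h h0; rewrite addr_ge0// mulr_ge0. Qed.

Lemma lipschitz_below_le_id n s : 0 <= s -> psi n s <= phi s.
Proof.
by move=> s0; have := @psi_le_term n s 0 (lexx 0); rewrite subr0 mulr0 addr0 fE.
Qed.

Lemma lipschitz_below0 n : psi n 0 = 0.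
Proof.
apply/eqP; rewrite eq_le lipschitz_below_ge0 andbT.
by have [_ _ _ {2}<-] := phi_I; exact: lipschitz_below_le_id.
Qed.

Let psi_ge n b K : (0 < n)%N -> f b <= K -> f (b - K / n%:R) <= psi n b.
Proof.
move=> n0 bK; have n0' : 0 < n%:R :> R by rewrite ltr0n.
have K0 : 0 <= K := le_trans (f_ge0 b) bK.
apply: le_psi => h h0; have [hK|hK] := leP h (K / n%:R).
  by rewrite -[leLHS]addr0 lerD ?mulr_ge0// f_le// lerB.
have h1 : K <= n%:R * h by rewrite mulrC -ler_pdivrMr// ltW.
have h2 : f (b - K / n%:R) <= f b by rewrite f_le// gerBl divr_ge0.
by have := f_ge0 (b - h); lra.
Qed.

(** The convergence is joint in [n] and in the argument, as [psi n] will be evaluated at values that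
    vary with [n]. A shift longer than [K / n] costs more than [K], so [psi n b] lies between values
    of [f] close to [a]. *)
Lemma lipschitz_below_cvg a e : 0 <= a -> 0 < e -> exists2 d, 0 < d &
  exists N, forall n, (N <= n)%N -> forall b, `|b - a| <= d -> `|psi n b - phi a| <= e.
Proof.
move=> a0 e0; have [d d0 hd] := f_cont a e0.
pose K := f (a + d); have K0 : 0 <= K by exact: f_ge0.
have d20 : 0 < d / 2 by rewrite divr_gt0.
exists (d / 2) => //; exists (Num.truncn (K / (d / 2))).+1 => n Nn b ab.
have n0 : (0 < n)%N by exact: leq_trans Nn.
have n0' : 0 < n%:R :> R by rewrite ltr0n.
have Kn : K / n%:R <= d / 2.
  rewrite ler_pdivrMr// mulrC -ler_pdivrMr//; apply: ltW.
  by apply: lt_le_trans (truncnS_gt _) _; rewrite ler_nat.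
move: ab; rewrite ler_norml => /andP[ab1 ab2].
have bK : f b <= K by apply: f_le; lra.
have h1 := psi_ge n0 bK.
have h2 : psi n b <= f b by have := @psi_le_term n b 0 (lexx 0); rewrite subr0 mulr0 addr0.
have h3 : `|f (a - d) - f a| <= e by apply: hd; rewrite addrAC subrr add0r normrN gtr0_norm.
have h4 : `|f (a + d) - f a| <= e by apply: hd; rewrite addrAC subrr add0r gtr0_norm.
have h5 : f (a - d) <= f (b - K / n%:R) by apply: f_le; lra.
have h6 : f b <= f (a + d) by apply: f_le; lra.
move: h3 h4; rewrite !ler_norml -(fE a0) => /andP[h31 h32] /andP[h41 h42].
by apply/andP; split; lra.
Qed.

End Approximation.

(* Explicit Euler scheme on the finite set of the vertices with index [< n], for
   the nonlinearity [psi], which takes the value [beta] outside that set. *)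
Section Euler.
Variables (R : realType) (X : countType) (G : graph R X).
Local Notation mu := (vertex_weight G).
Local Notation w := (edge_weight G).
Local Notation mu0 := (@mu_ge0 R X G).
Local Notation Lap := (laplacian G).
Variables (n : nat) (psi : R -> R) (L M delta : R) (v0 : X -> R).
Hypotheses (psi_le : forall s t, s <= t -> psi s <= psi t)
  (psi_lip : forall s t, s <= t -> psi t <= psi s + L * (t - s))
  (psi_0 : psi 0 = 0) (delta_gt0 : 0 < delta)
  (step_small : forall x, (pickle x < n)%N -> delta * (L * (deg G x / mu x)) <= 1)
  (v0_M : forall x, 0 <= v0 x <= M).

Let K := psi M.

(** The flux, that is, the function whose Laplacian drives a step. Accordingly [beta] is a value of
    the nonlinearity and not of the solution. *)
Definition extend beta (v : X -> R) y := if (pickle y < n)%N then psi (v y) else beta.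

Definition euler_step beta (v : X -> R) x :=
  if (pickle x < n)%N then v x - delta * Lap (extend beta v) x else v x.

Definition euler beta k := iter k (euler_step beta) v0.

Let extend_bd beta v : 0 <= beta <= K -> (forall x, 0 <= v x <= M) ->
  forall y, 0 <= extend beta v y <= K.
Proof.
move=> bK vM y; rewrite /extend; case: ifP => // _.
by have /andP[h1 h2] := vM y; rewrite -{1}psi_0 !psi_le.
Qed.

Let bd_norm (f : X -> R) (C : R) : (forall y, 0 <= f y <= C) -> forall y, `|f y| <= C.
Proof. by move=> fC y; have /andP[h1 h2] := fC y; rewrite ger0_norm. Qed.

(** The step depends on [v x] through [v x - delta * (deg x / mu x) * psi (v x)], which [step_small]
    makes nondecreasing, and it is nondecreasing in the values at the other vertices and in
    [beta]. *)
Lemma euler_step_le beta beta' v v' : 0 <= beta <= K -> 0 <= beta' <= K ->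
  (forall x, 0 <= v x <= M) -> (forall x, 0 <= v' x <= M) ->
  beta <= beta' -> (forall x, v x <= v' x) ->
  forall x, euler_step beta v x <= euler_step beta' v' x.
Proof.
move=> bK bK' vM vM' bb vv x; rewrite /euler_step; case: ifPn => // xn.
have e1 := bd_norm (extend_bd bK vM); have e2 := bd_norm (extend_bd bK' vM').
rewrite (laplacianE G x e1) (laplacianE G x e2) {1 3}/extend xn.
have h1 : tsum (fun y => w x y * extend beta v y) <= tsum (fun y => w x y * extend beta' v' y).
  apply: le_tsum; [exact: edge_summableM e1|exact: edge_summableM e2|].
  move=> y; rewrite ler_wpM2l ?edge_weight_ge0// /extend.
  by case: ifP => // _; exact: psi_le.
have h2 := psi_lip (vv x); have h3 := step_small xn; have h4 := vv x.
have dm : 0 <= delta * (mu x)^-1 by rewrite mulr_ge0 ?invr_ge0 ?mu0// ltW.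
have h5 : delta * (mu x)^-1 * tsum (fun y => w x y * extend beta v y) <=
   delta * (mu x)^-1 * tsum (fun y => w x y * extend beta' v' y) by rewrite ler_wpM2l.
have h6 : delta * (mu x)^-1 * deg G x * (psi (v' x) - psi (v x)) <= v' x - v x.
  apply: (@le_trans _ _ (delta * (mu x)^-1 * deg G x * (L * (v' x - v x)))).
    by apply: ler_wpM2l; [exact: mulr_ge0 dm (deg_ge0 G x)|rewrite lerBlDl].
  rewrite mulrA -[leRHS]mul1r ler_wpM2r ?subr_ge0//.
  by apply: le_trans h3; rewrite le_eqVlt; apply/orP; left; apply/eqP; ring.
move: h5 h6; move: (tsum _) (tsum _) => P' P h5 h6.
have -> : v x - delta * ((mu x)^-1 * (deg G x * psi (v x) - P)) =
   v x - delta * (mu x)^-1 * deg G x * psi (v x) + delta * (mu x)^-1 * P by ring.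
have -> : v' x - delta * ((mu x)^-1 * (deg G x * psi (v' x) - P')) =
   v' x - delta * (mu x)^-1 * deg G x * psi (v' x) + delta * (mu x)^-1 * P' by ring.
by move: h6; rewrite mulrBr; lra.
Qed.

Let tsum_deg x (c : R) : tsum (fun y => w x y * c) = deg G x * c.
Proof.
rewrite /deg mulrC -tsumZ; last exact: edge_summable.
by apply: eq_tsum => y; rewrite mulrC.
Qed.

Let summable_cst x (c : R) : abs_summable (fun y => w x y * c).
Proof. exact: (@edge_summableM R X G x (fun=> c) `|c| (fun=> lexx _)). Qed.

(** A constant whose flux is at most the boundary value is a subsolution. With comparison this
    yields lower barriers for the scheme, and the dual lemma yields upper ones; [0] and [M] are the
    barriers that confine it. *)
Lemma euler_step_const_ge beta (a : R) x : 0 <= beta <= K -> 0 <= a <= M -> psi a <= beta ->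
  a <= euler_step beta (fun=> a) x.
Proof.
move=> bK aM ab; rewrite /euler_step; case: ifPn => // xn.
have e1 := bd_norm (extend_bd (v := fun=> a) bK (fun=> aM)).
rewrite (laplacianE G x e1) {1}/extend xn lerBrDl gerDr -tsum_deg.
rewrite mulr_ge0_le0 ?(ltW delta_gt0)// mulr_ge0_le0 ?invr_ge0 ?mu0// subr_le0.
apply: le_tsum; [exact: summable_cst|exact: edge_summableM e1|].
by move=> y; rewrite ler_wpM2l ?edge_weight_ge0// /extend; case: ifP.
Qed.

Lemma euler_step_const_le beta (a : R) x : 0 <= beta <= K -> 0 <= a <= M -> beta <= psi a ->
  euler_step beta (fun=> a) x <= a.
Proof.
move=> bK aM ab; rewrite /euler_step; case: ifPn => // xn.
have e1 := bd_norm (extend_bd (v := fun=> a) bK (fun=> aM)).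
rewrite (laplacianE G x e1) {1}/extend xn gerBl -tsum_deg.
rewrite mulr_ge0 ?(ltW delta_gt0)// mulr_ge0 ?invr_ge0 ?mu0// subr_ge0.
apply: le_tsum; [exact: edge_summableM e1|exact: summable_cst|].
by move=> y; rewrite ler_wpM2l ?edge_weight_ge0// /extend; case: ifP.
Qed.

Lemma euler_bd beta k x : 0 <= beta <= K -> 0 <= euler beta k x <= M.
Proof.
move=> bK; have M0 : 0 <= M by have /andP[h1 h2] := v0_M x; exact: le_trans h2.
elim: k x => [//|k IH] x; rewrite /euler iterS -/(euler beta k).
have /andP[b0 b1] := bK.
have zM : 0 <= (0 : R) <= M by rewrite lexx. have MM : 0 <= M <= M by rewrite M0 lexx.
apply/andP; split.
  apply: (le_trans (euler_step_const_ge x bK zM _)); first by rewrite psi_0.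
  by apply: euler_step_le => // y; case/andP: (IH y).
apply: (le_trans _ (euler_step_const_le x bK MM b1)).
by apply: euler_step_le => // y; case/andP: (IH y).
Qed.

Lemma euler_ge beta a k x : 0 <= beta <= K -> 0 <= a <= M -> psi a <= beta ->
  (forall x, a <= v0 x) -> a <= euler beta k x.
Proof.
move=> bK aM ab av; elim: k x => [//|k IH] x; rewrite /euler iterS -/(euler beta k).
apply: (le_trans (euler_step_const_ge x bK aM ab)).
by apply: euler_step_le => // y; exact: euler_bd.
Qed.

Lemma euler_le beta a k x : 0 <= beta <= K -> 0 <= a <= M -> beta <= psi a ->
  (forall x, v0 x <= a) -> euler beta k x <= a.
Proof.
move=> bK aM ab av; elim: k x => [//|k IH] x; rewrite /euler iterS -/(euler beta k).
apply: (le_trans _ (euler_step_const_le x bK aM ab)).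
by apply: euler_step_le => // y; exact: euler_bd.
Qed.

Lemma euler_mono beta beta' k x : 0 <= beta <= K -> 0 <= beta' <= K -> beta <= beta' ->
  euler beta k x <= euler beta' k x.
Proof.
move=> bK bK' bb; elim: k x => [//|k IH] x; rewrite /euler !iterS -/(euler beta k) -/(euler beta' k).
by apply: euler_step_le => // y; exact: euler_bd.
Qed.

Lemma euler_extend_bd beta k y : 0 <= beta <= K -> 0 <= extend beta (euler beta k) y <= K.
Proof. by move=> bK; apply: extend_bd => // z; exact: euler_bd. Qed.

Lemma euler_lip beta k l x : 0 <= beta <= K ->
  `|euler beta (k + l) x - euler beta k x| <= l%:R * delta * (deg G x / mu x * K).
Proof.
move=> bK; elim: l => [|l IH]; first by rewrite addn0 subrr normr0 !mul0r.
rewrite addnS -(subrKA (euler beta (k + l) x)) (le_trans (ler_normD _ _))//.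
rewrite addrC -natr1 mulrDl mul1r mulrDl lerD//.
rewrite /euler iterS -/(euler beta (k + l)) /euler_step; case: ifPn => _; last first.
  rewrite subrr normr0 mulr_ge0 ?(ltW delta_gt0)// mulr_ge0 ?divr_ge0 ?deg_ge0 ?mu0//.
  by case/andP: bK => /le_trans; apply.
rewrite addrAC subrr add0r normrN normrM (gtr0_norm delta_gt0) ler_wpM2l ?(ltW delta_gt0)//.
by apply: laplacian_le => y; exact: euler_extend_bd.
Qed.

(** Telescoping against a fixed reference value [c], which will be the Laplacian of the limit: this
    is how the equation passes to the limit. *)
Lemma euler_taylor beta k l x (c e : R) : 0 <= beta <= K -> (pickle x < n)%N ->
  (forall j, (k <= j < k + l)%N -> `|Lap (extend beta (euler beta j)) x - c| <= e) ->
  `|euler beta (k + l) x - euler beta k x + l%:R * delta * c| <= l%:R * delta * e.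
Proof.
move=> bK xn; elim: l => [|l IH] H; first by rewrite addn0 subrr !mul0r addr0 normr0.
have {}IH := IH (fun j => ltac:(by move=> /andP[h1 h2]; apply: H; rewrite h1 addnS ltnW)).
have h := H (k + l)%N ltac:(by rewrite leq_addr addnS ltnSn).
rewrite addnS /euler iterS -/(euler beta (k + l)) -/(euler beta k) {1}/euler_step xn.
set D := Lap _ x in h *.
have -> : euler beta (k + l) x - delta * D - euler beta k x + l.+1%:R * delta * c =
    (euler beta (k + l) x - euler beta k x + l%:R * delta * c) - delta * (D - c).
  by rewrite -natr1; ring.
rewrite (le_trans (ler_normB _ _))// -natr1 mulrDl mul1r mulrDl lerD//.
by rewrite normrM (gtr0_norm delta_gt0) ler_wpM2l ?(ltW delta_gt0).
Qed.

Section Gap.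
Variables (beta1 beta2 cap : R) (o : X) (N : nat).
Hypotheses (beta1_K : 0 <= beta1 <= K) (beta2_K : 0 <= beta2 <= K)
  (beta12 : beta1 < beta2) (cap_gt0 : 0 < cap) (N_gt0 : (0 < N)%N)
  (mu_finite : (total_measure G < +oo)%E)
  (capacity : forall f, finitely_supported f -> cap * f o ^+ 2 <= energy G f f)
  (near_o : forall j, (j < N)%N ->
     psi (euler beta2 j o) - psi (euler beta1 j o) <= (beta2 - beta1) / 2)
  (o_n : (pickle o < n)%N).

Let theta j x := extend beta2 (euler beta2 j) x - extend beta1 (euler beta1 j) x.
Let V k x := delta * \sum_(j < k) theta j x.
Let z k x := euler beta2 k x - euler beta1 k x.

Let theta_ge0 j x : 0 <= theta j x.
Proof.
rewrite subr_ge0 /extend; case: ifP => _; last exact: ltW.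
by apply: psi_le; apply: euler_mono => //; exact: ltW.
Qed.

Let theta_K j x : `|theta j x| <= K.
Proof.
rewrite ger0_norm// /theta.
have /andP[h1 h2] := euler_extend_bd j x beta2_K.
by have /andP[h3 h4] := euler_extend_bd j x beta1_K; lra.
Qed.

Let V_bd k x : `|V k x| <= delta * (k%:R * K).
Proof.
rewrite normrM (gtr0_norm delta_gt0) ler_wpM2l ?(ltW delta_gt0)//.
rewrite (le_trans (ler_norm_sum _ _ _))// mulr_natl -[k in leRHS]card_ord -sumr_const.
by apply: ler_sum => j _; exact: theta_K.
Qed.

(** Summing the two schemes over the time steps and subtracting leaves only the Laplacian of the
    accumulated flux difference [V], because both start from [v0]. *)
Let z_lap k x : (pickle x < n)%N -> z k x = - Lap (V k) x.
Proof.
move=> xn; elim: k => [|k IH].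
  rewrite /z subrr (laplacianE G x (V_bd 0)) /V big_ord0 mulr0 tsum0 ?mulr0 ?subrr ?mulr0 ?oppr0//.
  by move=> y; rewrite big_ord0 !mulr0.
have b1 := bd_norm (fun y => euler_extend_bd k y beta1_K).
have b2 := bd_norm (fun y => euler_extend_bd k y beta2_K).
rewrite /z /euler !iterS -/(euler _ _) -/(euler beta1 _) /euler_step xn.
move: IH; rewrite /z => IH.
have -> : euler beta2 k x - delta * Lap (extend beta2 (euler beta2 k)) x -
   (euler beta1 k x - delta * Lap (extend beta1 (euler beta1 k)) x) =
   (euler beta2 k x - euler beta1 k x) - delta * (Lap (extend beta2 (euler beta2 k)) x -
     Lap (extend beta1 (euler beta1 k)) x) by ring.
rewrite IH (laplacianE G x (V_bd k)) (laplacianE G x (V_bd k.+1)) (laplacianE G x b1) (laplacianE G x b2).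
have VS y : V k.+1 y = V k y + delta * theta k y by rewrite /V big_ord_recr mulrDr.
have -> : tsum (fun y => w x y * V k.+1 y) = tsum (fun y => w x y * V k y) +
   delta * (tsum (fun y => w x y * extend beta2 (euler beta2 k) y) -
            tsum (fun y => w x y * extend beta1 (euler beta1 k) y)).
  rewrite -tsumB; [|exact: edge_summableM b2|exact: edge_summableM b1].
  rewrite -tsumZ; last by apply: abs_summableB; [exact: edge_summableM b2|exact: edge_summableM b1].
  rewrite -tsumD; first by apply: eq_tsum => y; rewrite VS /theta; ring.
    exact: edge_summableM (V_bd k).
  by apply: abs_summableZ; apply: abs_summableB; [exact: edge_summableM b2|exact: edge_summableM b1].
by rewrite VS /theta; ring.
Qed.

(** The chain is [cap * (tB / 2)^2 <= cap * W o ^+ 2 <= Q W W], and [Q W W] is at most [tB] times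
    the mass of the difference; division by [tB] gives the constant. The lower bound on [W o] is
    [near_o]: for short times the fluxes at [o] differ by at most half the gap at the boundary. *)
Lemma euler_gap : cap * (N%:R * delta * (beta2 - beta1)) / 4 <=
  tsum (fun x => mu x * (euler beta2 N x - euler beta1 N x)).
Proof.
pose B := beta2 - beta1; pose tB := N%:R * delta * B.
have B0 : 0 < B by rewrite subr_gt0.
have tB0 : 0 < tB by rewrite !mulr_gt0// ltr0n.
(* The discrete version of [t (phi b2 - phi b1) - int_0^t (phi u2 - phi u1)]. *)
pose W x := tB - V N x.
have WB x : `|W x| <= tB + delta * (N%:R * K).
  by rewrite (le_trans (ler_normB _ _))// (gtr0_norm tB0) lerD2l.
(* Outside the finite set the fluxes keep their boundary values, so that [V N x] is exactly [tB]. *)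
have Wout x : ~~ (pickle x < n)%N -> W x = 0.
  move=> xn; rewrite /W /V; under eq_bigr do rewrite /theta /extend (negbTE xn).
  by rewrite sumr_const card_ord -mulr_natl /tB /B; ring.
have Wfs : finitely_supported W.
  have := @exhaustion_fs R X n W; rewrite (_ : (fun x => _) = W)//.
  by apply/funext => x; case: ifPn => // /Wout.
have W_le x : W x <= tB.
  rewrite gerBl mulr_ge0 ?(ltW delta_gt0)// sumr_ge0// => j _; exact: theta_ge0.
have z0 x : 0 <= z N x by rewrite subr_ge0 euler_mono// ltW.
have zM x : `|z N x| <= M.
  have /andP[h1 h2] := euler_bd N x beta2_K; have /andP[h3 h4] := euler_bd N x beta1_K.
  by rewrite ger0_norm//; rewrite /z; lra.
have smu := mu_summable mu_finite.
have QW : energy G W W <= tB * tsum (fun x => mu x * z N x).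
  rewrite (greenl G Wfs WB) -tsumZ; last exact: abs_summableM smu zM.
  have -> : tsum (fun x => W x * Lap W x * mu x) = tsum (fun x => mu x * (W x * z N x)).
    (* [Lap W = z] is known inside the finite set only; outside it the factor [W x] vanishes. *)
    apply: eq_tsum => x; have [xn|/Wout ->] := boolP (pickle x < n)%N; last by rewrite !mul0r mulr0.
    rewrite (z_lap N xn) (laplacianE G x WB) (laplacianE G x (V_bd N)).
    have -> : tsum (fun y => w x y * W y) = deg G x * tB - tsum (fun y => w x y * V N y).
      rewrite -tsum_deg -tsumB; first by apply: eq_tsum => y; rewrite /W mulrBr.
        exact: summable_cst.
      exact: edge_summableM (V_bd N).
    by rewrite /W; ring.
  apply: le_tsum.
  - apply: (abs_summableM smu (K := (tB + delta * (N%:R * K)) * M)) => x.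
    by rewrite normrM ler_pM.
  - by apply: abs_summableZ; exact: abs_summableM smu zM.
  - by move=> x; rewrite mulrCA ler_wpM2r// mulr_ge0// mu0.
have Wo : tB / 2 <= W o.
  have : V N o <= tB / 2.
    rewrite /V /tB [N%:R * _]mulrC -!mulrA ler_pM2l//.
    rewrite mulr_natl -[N in leRHS]card_ord -sumr_const; apply: ler_sum => j _.
    by rewrite /theta /extend o_n; exact: near_o.
  by rewrite /W; lra.
have h1 := le_trans (capacity Wfs) QW.
have h2 : cap * (tB / 2) ^+ 2 <= cap * W o ^+ 2.
  by rewrite ler_pM2l// ler_pXn2r// ?nnegrE ?divr_ge0 ?(ltW tB0)// (le_trans _ Wo)// divr_ge0// ltW.
have h3 := le_trans h2 h1.
rewrite -(ler_pM2l tB0); apply: le_trans h3; rewrite -/B -/tB.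
by rewrite le_eqVlt; apply/orP; left; apply/eqP; field.
Qed.

End Gap.

End Euler.

(** * Passage to the limit in the scheme along an ultrafilter *)

Lemma ultra_fmap (S T : Type) (f : S -> T) (F : set_system S) :
  UltraFilter F -> UltraFilter (f @ F).
Proof.
move=> UF; split; first exact: fmap_proper_filter.
move=> H PH FH; apply/seteqP; split=> // A HA.
have [//|FA] := in_ultra_setVsetC (f @^-1` A) UF.
have HC : H (~` A) by exact: FH.
by have [t []] := filter_ex (filterI HA HC).
Qed.

(** Compactness of a segment, in ultrafilter form. It gives the limits at all vertices and at all of
    the uncountably many times simultaneously. *)
Lemma ultra_cvg_bounded (R : realType) (UF : set_system nat) (a : nat -> R) (A B : R) :
  UltraFilter UF -> (forall n, A <= a n <= B) -> cvg (a n @[n --> UF]).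
Proof.
move=> UU aAB; have := @segment_compact R A B; rewrite compact_ultra => H.
have [|p [_ hp]] := H (a n @[n --> UF]) (ultra_fmap a UU).
  by apply: (@filterS _ UF _ setT) filterT => n _ /=; rewrite in_itv /= aAB.
by apply/cvg_ex; exists p.
Qed.

(* Limit of the Euler schemes along an ultrafilter [UF] finer than [\oo]: no
   extraction of subsequences is needed. *)
Section Limit.
Variables (R : realType) (X : countType) (G : graph R X).
Local Notation mu := (vertex_weight G).
Local Notation w := (edge_weight G).
Local Notation mu0 := (@mu_ge0 R X G).
Local Notation Lap := (laplacian G).
Variables (phi : R -> R) (M : R) (u0 : X -> R) (UF : set_system nat).
Hypotheses (phi_I : nonlinearity phi) (u0_M : forall x, 0 <= u0 x <= M).
Hypotheses (UU : UltraFilter UF) (UFoo : \oo `<=` UF).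

Let K := phi M.
Let psi := lipschitz_below phi.
Let S n := \sum_(x <- pmap (@pickle_inv X) (iota 0 n)) deg G x / mu x.

(** [S n] dominates [deg x / mu x] at every vertex of index [< n], and [n] is the Lipschitz constant
    of [psi n]: the stability condition of the scheme holds, and the step is at most
    [1 / (n + 1)]. *)
Definition time_step (n : nat) : R := (n.+1%:R * (1 + S n))^-1.
Local Notation delta := time_step.

Let M_ge0 : 0 <= M.
Proof.
by have [] := graph_nonempty G => x _; have /andP[h1 h2] := u0_M x; exact: le_trans h2.
Qed.

Let S_ge0 n : 0 <= S n.
Proof. by apply: sumr_ge0 => x _; rewrite divr_ge0 ?deg_ge0 ?mu0. Qed.

Let delta_gt0 n : 0 < delta n.
Proof. by rewrite invr_gt0 mulr_gt0// ltr_wpDr. Qed.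

Let delta_le n : delta n <= n.+1%:R^-1.
Proof.
rewrite lef_pV2 ?posrE ?mulr_gt0 ?ltr_wpDr//.
by rewrite ler_peMr// lerDl.
Qed.

Let step_small n x : (pickle x < n)%N -> delta n * (n%:R * (deg G x / mu x)) <= 1.
Proof.
move=> xn; rewrite mulrC ler_pdivrMr ?mulr_gt0 ?ltr_wpDr// mul1r.
have h : deg G x / mu x <= S n.
  have xs : x \in pmap (@pickle_inv X) (iota 0 n).
    rewrite mem_pmap; apply/mapP.
    by exists (pickle x); [rewrite mem_iota|rewrite pickleK_inv].
  rewrite /S (big_rem x)//= lerDl sumr_ge0// => y _.
  by rewrite divr_ge0 ?deg_ge0 ?mu0.
apply: ler_pM => //; first by rewrite divr_ge0 ?deg_ge0 ?mu0.
  by rewrite ler_nat.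
by rewrite (le_trans h)// lerDr.
Qed.

Let psi_le n := fun s t => @lipschitz_below_le R phi phi_I n s t.
Let psi_lip n := fun s t => @lipschitz_below_lip R phi phi_I n s t.
Let psi_0 n : psi n 0 = 0 := lipschitz_below0 phi_I n.

Let psi_MK n : psi n M <= K.
Proof. exact: lipschitz_below_le_id. Qed.

Let delta_cvg : delta n @[n --> UF] --> (0 : R).
Proof.
apply: (@cvg_le0 _ _ _ _ _ (fun n => n.+1%:R^-1)).
  by move=> n; rewrite subr0 gtr0_norm.
exact: cvg_trans (cvg_app _ UFoo) (@invS_cvg0 R).
Qed.

Let near_oo (P : nat -> Prop) N : (forall n, (N <= n)%N -> P n) -> \forall n \near UF, P n.
Proof. by move=> H; apply: UFoo; exists N. Qed.

(** Negative times get the index [0]. The limit is then constant in the past and continuous on the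
    whole line, hence on the closed time interval. *)
Definition time_index n t : nat := Num.truncn (Num.max t 0 / delta n).
Local Notation idx := time_index.

Let idx_bounds n t : 0 <= t -> (idx n t)%:R * delta n <= t < (idx n t)%:R * delta n + delta n.
Proof.
move=> t0; rewrite /idx max_l//.
have /truncn_itv/andP[h1 h2] : 0 <= t / delta n by rewrite divr_ge0// ltW.
move: h1 h2; rewrite ler_pdivlMr// ltr_pdivrMr// -natr1 mulrDl mul1r => -> /=.
by [].
Qed.

Let idx_le n s t : s <= t -> (idx n s <= idx n t)%N.
Proof.
move=> st; apply: le_truncn; rewrite ler_pM2r; last by rewrite invr_gt0 delta_gt0.
by rewrite ge_max le_max st /= le_max lexx orbT.
Qed.

Let idx_cvg t : 0 <= t -> (idx n t)%:R * delta n @[n --> UF] --> t.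
Proof.
move=> t0; apply: cvg_le0 delta_cvg => n; have /andP[h1 h2] := idx_bounds n t0.
by rewrite ler_norml; apply/andP; split; have := delta_gt0 n; lra.
Qed.

Section Solution.
Variable b : R.
Hypothesis b_M : 0 <= b <= M.

(** The boundary value is the level [b] seen through [psi n], so that by monotonicity a constant [a]
    is a barrier for every [n] as soon as it is suitably ordered with [b] and with the initial
    datum. *)
Definition approx n k := euler G n (psi n) (delta n) u0 (psi n b) k.

Lemma level_bd n : 0 <= psi n b <= psi n M.
Proof.
by have /andP[h1 h2] := b_M; rewrite lipschitz_below_ge0//= psi_le.
Qed.

Lemma approx_bd n k x : 0 <= approx n k x <= M.
Proof.
exact: (euler_bd (psi_le n) (psi_lip n) (psi_0 n) (delta_gt0 n) (@step_small n) u0_M k x (level_bd n)).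
Qed.

Let flux n j := extend n (psi n) (psi n b) (approx n j).

Let flux_bd n j y : 0 <= flux n j y <= K.
Proof.
have /andP[h1 h2] := euler_extend_bd (psi_le n) (psi_lip n) (psi_0 n) (delta_gt0 n)
  (@step_small n) u0_M j y (level_bd n).
by rewrite h1 (le_trans h2).
Qed.

Let C x := deg G x / mu x * K.

Let K_ge0 : 0 <= K.
Proof. by have [_ _ _ <-] := phi_I; exact: (nonlinearity_le phi_I). Qed.

Let C_ge0 x : 0 <= C x.
Proof. by rewrite mulr_ge0// divr_ge0 ?deg_ge0 ?mu0. Qed.

(** The Lipschitz constant in time depends on the vertex but not on [n], because all fluxes lie
    between [0] and [K]. *)
Let approx_lip n j k x : `|approx n j x - approx n k x| <= `|j%:R * delta n - k%:R * delta n| * C x.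
Proof.
wlog jk : j k / (k <= j)%N => [H|].
  have [/H //|/ltnW/H] := leqP k j.
  by rewrite distrC [X in X * _]distrC.
have := euler_lip (psi_le n) (psi_lip n) (psi_0 n) (delta_gt0 n) (@step_small n) u0_M
  k (j - k) x (level_bd n).
rewrite subnKC// => h; apply: le_trans h _.
rewrite -mulrBl -natrB// normrM (gtr0_norm (delta_gt0 n)) ger0_norm//.
rewrite ler_wpM2l ?mulr_ge0 ?(ltW (delta_gt0 n))//.
by rewrite ler_wpM2l ?divr_ge0 ?deg_ge0 ?mu0.
Qed.

Let U n t := approx n (idx n t).

Definition limit_solution t x : R := lim (U n t x @[n --> UF]).
Local Notation u := limit_solution.

Let u_cvg t x : U n t x @[n --> UF] --> u t x.
Proof.
by apply: (@ultra_cvg_bounded R UF (fun n => U n t x) 0 M UU) => n; exact: approx_bd.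
Qed.

Let lim_ge (a : nat -> R) l c : a n @[n --> UF] --> l -> (forall n, c <= a n) -> c <= l.
Proof.
move=> al ca; rewrite -(cvg_lim _ al)//; apply: limr_ge; first by apply/cvg_ex; exists l.
exact: nearW.
Qed.

Let lim_le (a : nat -> R) l c : a n @[n --> UF] --> l -> (forall n, a n <= c) -> l <= c.
Proof.
move=> al ca; rewrite -(cvg_lim _ al)//; apply: limr_le; first by apply/cvg_ex; exists l.
exact: nearW.
Qed.

Lemma limit_solution_bd t x : 0 <= u t x <= M.
Proof.
apply/andP; split.
  by apply: (lim_ge (@u_cvg t x)) => n; case/andP: (approx_bd n (idx n t) x).
by apply: (lim_le (@u_cvg t x)) => n; case/andP: (approx_bd n (idx n t) x).
Qed.

Lemma limit_solution_ge a t x : 0 <= a <= M -> (forall x, a <= u0 x) -> a <= b -> a <= u t x.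
Proof.
move=> aM au ab; apply: (lim_ge (@u_cvg t x)) => n.
apply: (euler_ge (psi_le n) (psi_lip n) (psi_0 n) (delta_gt0 n) (@step_small n) u0_M
  _ x (level_bd n) aM) => //; exact: psi_le.
Qed.

Lemma limit_solution_le a t x : 0 <= a <= M -> (forall x, u0 x <= a) -> b <= a -> u t x <= a.
Proof.
move=> aM au ab; apply: (lim_le (@u_cvg t x)) => n.
apply: (euler_le (psi_le n) (psi_lip n) (psi_0 n) (delta_gt0 n) (@step_small n) u0_M
  _ x (level_bd n) aM) => //; exact: psi_le.
Qed.

Lemma limit_solution0 x : u 0 x = u0 x.
Proof.
apply: cvg_lim => //; rewrite (_ : (fun n => U n 0 x) = (fun=> u0 x)); first exact: cvg_cst.
by apply/funext => n; rewrite /U /idx maxxx mul0r truncn0.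
Qed.

Let phiu_bd t x : 0 <= (phi \o u t) x <= K.
Proof.
have /andP[h1 h2] := limit_solution_bd t x; have [_ _ _ phi0] := phi_I.
by rewrite -{1}phi0 /= !(nonlinearity_le phi_I).
Qed.

(** The estimate is uniform over all indices [j] whose time is close to [t0]: the Lipschitz bound
    keeps [approx n j y] near [u t0 y], and [lipschitz_below_cvg] accommodates the moving
    argument. *)
Let flux_near t0 y d : 0 <= t0 -> 0 < d -> exists2 eta, 0 < eta & \forall n \near UF,
  forall j, `|j%:R * delta n - t0| < eta -> `|flux n j y - phi (u t0 y)| <= d.
Proof.
move=> t00 d0; have /andP[a0 aM] := limit_solution_bd t0 y.
have [rho rho0 [N hN]] := lipschitz_below_cvg phi_I a0 d0.
pose C1 := C y + 1; have C10 : 0 < C1 by rewrite ltr_wpDl.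
(* The time error is at most [2 * eta], which contributes [rho / 2]; with [rho / 4] from the
   convergence at [t0] the total stays below [rho]. *)
pose eta := rho / (4 * C1); have eta0 : 0 < eta by rewrite divr_gt0// mulr_gt0.
exists eta => //.
have r40 : 0 < rho / 4 by rewrite divr_gt0.
have n1 : \forall n \near UF, (N <= n)%N by exact: (@near_oo _ N).
have n2 : \forall n \near UF, (pickle y < n)%N by exact: (@near_oo _ (pickle y).+1).
have /cvgrPdist_le/(_ _ r40) n3 := @u_cvg t0 y.
have /cvgrPdist_le/(_ _ eta0) n4 := delta_cvg.
near=> n => j hj.
have h1 : (N <= n)%N by near: n. have h2 : (pickle y < n)%N by near: n.
have h3 : `|u t0 y - U n t0 y| <= rho / 4 by near: n.
have h4 : `|0 - delta n| <= eta by near: n.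
rewrite sub0r normrN (gtr0_norm (delta_gt0 n)) in h4.
rewrite /flux /extend h2; apply: hN => //.
have h5 := approx_lip n j (idx n t0) y; rewrite -/(U n t0) in h5.
have /andP[k1 k2] := idx_bounds n t00.
have h6 : `|j%:R * delta n - (idx n t0)%:R * delta n| <= eta + eta.
  by move: hj; rewrite ltr_norml ler_norml => /andP[? ?]; apply/andP; split; lra.
have h7 : (eta + eta) * C y <= rho / 2.
  apply: (@le_trans _ _ ((eta + eta) * C1)).
    by rewrite ler_wpM2l ?addr_ge0 ?(ltW eta0)// /C1 lerDl.
  rewrite le_eqVlt; apply/orP; left; apply/eqP.
  by rewrite /eta; field; rewrite gt_eqF.
have h8 := le_trans h5 (le_trans (ler_wpM2r (C_ge0 y) h6) h7).
rewrite -(subrKA (U n t0 y)) (le_trans (ler_normD _ _))//.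
by move: h3; rewrite distrC; lra.
Unshelve. all: by end_near. Qed.

Let flux_near_seq t0 (s : seq X) d : 0 <= t0 -> 0 < d -> exists2 eta, 0 < eta &
  \forall n \near UF, forall j, `|j%:R * delta n - t0| < eta ->
    forall y, y \in s -> `|flux n j y - phi (u t0 y)| <= d.
Proof.
move=> t00 d0; elim: s => [|x s [eta eta0 IH]]; first by exists 1 => //; apply: nearW.
have [eta' eta'0 H] := flux_near x t00 d0.
exists (Num.min eta eta'); first by rewrite lt_min eta0 eta'0.
near=> n => j; rewrite lt_min => /andP[h1 h2] y; rewrite inE => /orP[/eqP ->|ys].
  have H' : forall j, `|j%:R * delta n - t0| < eta' -> `|flux n j x - phi (u t0 x)| <= d by near: n.
  exact: H'.
have IH' : forall j, `|j%:R * delta n - t0| < eta ->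
    forall y, y \in s -> `|flux n j y - phi (u t0 y)| <= d by near: n.
exact: IH'.
Unshelve. all: by end_near. Qed.

Let lap_diff (f g : X -> R) x : (forall y, 0 <= f y <= K) -> (forall y, 0 <= g y <= K) ->
  `|Lap f x - Lap g x| <= (mu x)^-1 * (deg G x * `|f x - g x| + tsum (fun y => w x y * `|f y - g y|)).
Proof.
move=> fK gK.
have fK' y : `|f y| <= K by have /andP[h1 h2] := fK y; rewrite ger0_norm.
have gK' y : `|g y| <= K by have /andP[h1 h2] := gK y; rewrite ger0_norm.
rewrite (laplacianE G x fK') (laplacianE G x gK') -mulrBr normrM ger0_norm ?invr_ge0 ?mu0//.
rewrite ler_wpM2l ?invr_ge0 ?mu0//.
have -> : deg G x * f x - tsum (fun y => w x y * f y) - (deg G x * g x - tsum (fun y => w x y * g y)) =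
   deg G x * (f x - g x) - tsum (fun y => w x y * (f y - g y)).
  rewrite (@eq_tsum _ _ (fun y => w x y * (f y - g y)) (fun y => w x y * f y - w x y * g y)).
    by rewrite tsumB; [ring|exact: edge_summableM fK'|exact: edge_summableM gK'].
  by move=> y; rewrite mulrBr.
rewrite (le_trans (ler_normB _ _))// lerD//.
  by rewrite normrM ger0_norm ?deg_ge0.
have s1 : abs_summable (fun y => w x y * (f y - g y)).
  apply: (@edge_summableM R X G x _ (K + K)) => y.
  by rewrite (le_trans (ler_normB _ _))// lerD.
apply: le_trans (ler_norm_tsum s1) _.
rewrite le_eqVlt; apply/orP; left; apply/eqP; apply: eq_tsum => y.
by rewrite normrM ger0_norm ?edge_weight_ge0.
Qed.

(** A vertex may have infinitely many neighbours. [tsum_small] makes all but finitely many of them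
    negligible, and these finitely many share one time window [eta]. *)
Let lap_near t0 x e : 0 <= t0 -> 0 < e -> exists2 eta, 0 < eta & \forall n \near UF,
  forall j, `|j%:R * delta n - t0| < eta ->
    `|Lap (flux n j) x - Lap (phi \o u t0) x| <= e.
Proof.
move=> t00 e0; have m0 := vertex_weight_gt0 G x.
have e20 : 0 < e * mu x / 2 by rewrite divr_gt0// mulr_gt0.
have [s us [d d0 hd]] := tsum_small K (edge_weight_ge0 G x) (edge_summable G x) e20.
pose d' := Num.min d (e * mu x / 2 / (deg G x + 1)).
have g0 : 0 < deg G x + 1 by rewrite ltr_wpDl ?deg_ge0.
have d'0 : 0 < d' by rewrite lt_min d0 divr_gt0.
have [eta eta0 H] := flux_near_seq (x :: s) t00 d'0; exists eta => //.
apply: filterS H => n H j hj; have {H}H := H j hj.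
apply: le_trans (lap_diff x (flux_bd n j) (phiu_bd t0)) _.
rewrite ler_pdivrMl// [mu x * e]mulrC (splitr (e * mu x)); apply: lerD.
  apply: (@le_trans _ _ ((deg G x + 1) * d')).
    by apply: ler_pM; rewrite ?deg_ge0 ?lerDl// H// inE eqxx.
  by rewrite mulrC -ler_pdivlMr// /d' ge_min lexx orbT.
apply: (hd (fun y => flux n j y - phi (u t0 y)) _ _).2 => y.
  have /andP[h1 h2] := flux_bd n j y; have /andP[h3 h4] := phiu_bd t0 y.
  by rewrite ler_norml; move: h3 h4 => /= h3 h4; apply/andP; split; lra.
by move=> ys; rewrite (le_trans (H y _))// ?inE ?ys ?orbT// /d' ge_min lexx.
Qed.

(** The limit of [euler_taylor]: between times close to [t0], every step sees a Laplacian within [e]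
    of its value at [t0]. As [t0] may be either end of the interval, the derivative is obtained from
    both sides. *)
Let taylor t0 x e : 0 <= t0 -> 0 < e -> exists2 eta, 0 < eta &
  forall s t, 0 <= s <= t -> t0 - eta < s -> t < t0 + eta ->
    `|u t x - u s x + (t - s) * Lap (phi \o u t0) x| <= (t - s) * e.
Proof.
move=> t00 e0; have [eta eta0 H] := lap_near x t00 e0.
have e20 : 0 < eta / 2 by rewrite divr_gt0.
exists (eta / 2) => // s t /andP[s0 st] h1 h2; have t_0 := le_trans s0 st.
set c := Lap _ x.
have L1 : `|U n t x - U n s x + ((idx n t)%:R * delta n - (idx n s)%:R * delta n) * c| @[n --> UF]
    --> `|u t x - u s x + (t - s) * c|.
  apply: cvg_norm; apply: cvgD; first by apply: cvgB; exact: u_cvg.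
  apply: cvgM; last exact: cvg_cst.
  by apply: cvgB; exact: idx_cvg.
have L2 : ((idx n t)%:R * delta n - (idx n s)%:R * delta n) * e @[n --> UF] --> (t - s) * e.
  apply: cvgM; last exact: cvg_cst.
  by apply: cvgB; exact: idx_cvg.
apply: (ler_cvg_to L1 L2).
have n2 : \forall n \near UF, (pickle x < n)%N by exact: (@near_oo _ (pickle x).+1).
have /cvgrPdist_lt/(_ _ e20) n4 := delta_cvg.
near=> n.
have k2 : (pickle x < n)%N by near: n.
have k4 : `|0 - delta n| < eta / 2 by near: n.
rewrite sub0r normrN (gtr0_norm (delta_gt0 n)) in k4.
have HH : forall j, `|j%:R * delta n - t0| < eta -> `|Lap (flux n j) x - c| <= e by near: n.
have st' := idx_le n st.
rewrite -mulrBl -natrB//.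
have := @euler_taylor R X G n (psi n) M (delta n) u0 (delta_gt0 n) (psi n b)
  (idx n s) (idx n t - idx n s) x c e (level_bd n) k2.
rewrite subnKC//; apply => j /andP[js jt]; apply: HH.
have /andP[a1 a2] := idx_bounds n s0; have /andP[a3 a4] := idx_bounds n t_0.
have b1 : (idx n s)%:R * delta n <= j%:R * delta n by rewrite ler_pM2r// ler_nat.
have b2 : j%:R * delta n <= (idx n t)%:R * delta n by rewrite ler_pM2r// ler_nat ltnW.
by rewrite ltr_norml; apply/andP; split; lra.
Unshelve. all: by end_near. Qed.

Let u_lip s t x : 0 <= s -> 0 <= t -> `|u t x - u s x| <= `|t - s| * C x.
Proof.
move=> s0 t0.
have L1 : `|U n t x - U n s x| @[n --> UF] --> `|u t x - u s x|.
  by apply: cvg_norm; apply: cvgB; exact: u_cvg.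
have L2 : `|(idx n t)%:R * delta n - (idx n s)%:R * delta n| * C x @[n --> UF] --> `|t - s| * C x.
  apply: cvgM; last exact: cvg_cst.
  by apply: cvg_norm; apply: cvgB; exact: idx_cvg.
by apply: (ler_cvg_to L1 L2); apply: nearW => n; exact: approx_lip.
Qed.

Let u_max t x : u t x = u (Num.max t 0) x.
Proof. by rewrite /u /U /idx -maxA maxxx. Qed.

Let u_cont x : continuous (fun t => u t x).
Proof.
move=> t; apply/cvgrPdist_le => e e0.
have C10 : 0 < C x + 1 by rewrite ltr_wpDl.
have e'0 : 0 < e / (C x + 1) by rewrite divr_gt0.
have near_t : \forall s \near t, `|t - s| < e / (C x + 1).
  by apply/nbhs_ballP; exists (e / (C x + 1)).
near=> s; have ts : `|t - s| < e / (C x + 1) by near: s.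
rewrite (u_max t) (u_max s) (le_trans (u_lip _ _ _))// ?le_max ?lexx ?orbT//.
apply: (@le_trans _ _ (`|t - s| * (C x + 1))).
  apply: ler_pM => //; last by rewrite lerDl.
  have := ler_norm (t - s); have := ler_norm (s - t); rewrite [ `|s - t| ]distrC ler_norml.
  by case: (leP t 0); case: (leP s 0) => *; apply/andP; split; lra.
by rewrite -ler_pdivlMr// ltW.
Unshelve. all: by end_near. Qed.

Let u_deriv t x : 0 < t ->
  h^-1 * (u (h + t) x - u t x) @[h --> 0^'] --> - Lap (phi \o u t) x.
Proof.
move=> t0; apply/cvgrPdist_le => e e0.
have [eta eta0 H] := taylor x (ltW t0) e0.
have d0 : 0 < Num.min eta t by rewrite lt_min eta0 t0.
near=> h.
have h0 : h != 0 by near: h; exact: nbhs_dnbhs_neq.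
have hd : `|h| < Num.min eta t.
  by near: h; apply: dnbhs0_lt.
move: hd; rewrite lt_min !ltr_norml => /andP[/andP[h1 h2] /andP[h3 h4]].
set c := Lap _ x in H *.
have -> : - c - h^-1 * (u (h + t) x - u t x) = - (h^-1 * (u (h + t) x - u t x + h * c)).
  by field.
rewrite normrN normrM normfV ler_pdivrMl ?normr_gt0//.
have [hp|hn] := leP 0 h.
  have := H t (h + t); rewrite addrK (ger0_norm hp); apply; first by apply/andP; split; lra.
    by lra.
  by lra.
have := H (h + t) t; rewrite opprD addrCA subrr addr0 (ltr0_norm hn) => K1.
have -> : u (h + t) x - u t x + h * c = - (u t x - u (h + t) x + - h * c) by ring.
rewrite normrN; apply: K1; first by apply/andP; split; lra.
  by lra.
by lra.
Unshelve. all: by end_near. Qed.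

Let u_derive1 t x : 0 < t -> derive1 (fun s => u s x) t = - Lap (phi \o u t) x.
Proof. by move=> t0; apply: cvg_lim => //; exact: u_deriv. Qed.

Let lap_cont x : continuous (fun t => Lap (phi \o u t) x).
Proof.
have phi_c : continuous phi by have [] := phi_I.
have pc y : continuous (fun t => phi (u t y)).
  by move=> t; apply: continuous_comp; [exact: u_cont|exact: phi_c].
have bd t y : `|(phi \o u t) y| <= K by have /andP[h1 h2] := phiu_bd t y; rewrite ger0_norm.
rewrite (_ : (fun t => _) = (fun t => (mu x)^-1 * (deg G x * phi (u t x) -
    tsum (fun y => w x y * (phi \o u t) y)))); last first.
  by apply/funext => t; rewrite (laplacianE G x (bd t)).
move=> t; apply: cvgM; first exact: cvg_cst.
apply: cvgB; first by apply: cvgM; [exact: cvg_cst|exact: pc].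
apply: (@cvg_tsum_mul _ _ _ _ _ (w x) K) => //.
- exact: edge_weight_ge0.
- exact: edge_summable.
- by move=> y; exact: pc.
Qed.

Lemma limit_solutionP T : bp_solution G phi T u0 u.
Proof.
have bd t y : `|(phi \o u t) y| <= K by have /andP[h1 h2] := phiu_bd t y; rewrite ger0_norm.
split; last first.
  split; last by move=> t x _; case/andP: (limit_solution_bd t x).
  by exists M => t x _; have /andP[h1 h2] := limit_solution_bd t x; rewrite ger0_norm.
split.
- move=> t _ x.
  have h : abs_summable (fun y => w x y * `|(phi \o u t) y|).
    by apply: edge_summableM => y; rewrite normr_id; exact: bd.
  apply/(@abs_summable_ge0 _ _ (fun y => w x y * `|(phi \o u t) y|)); last exact: h.
  by move=> y; apply: mulr_ge0; [exact: edge_weight_ge0|exact: normr_ge0].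
- by move=> x; apply: continuous_subspaceT; exact: u_cont.
- move=> x t /andP[t0 _]; split.
    apply/cvg_ex; exists (- Lap (phi \o u t) x).
    have := @u_deriv t x t0; rewrite /derivable /=.
    by under [X in _ -> X @ _ --> _]eq_fun do rewrite [_ *: 1]mulr1.
  move=> /=; rewrite /continuous_at (u_derive1 x t0).
  have h : - Lap (phi \o u s) x @[s --> t] --> - Lap (phi \o u t) x.
    by apply: cvgN; exact: lap_cont.
  apply: cvg_trans h; apply: near_eq_cvg.
  near=> s; rewrite u_derive1//; near: s; exact: lt_nbhsr.
- by move=> t x /andP[t0 _]; rewrite u_derive1// addNr.
- exact: limit_solution0.
Unshelve. all: by end_near. Qed.

Lemma approx_cvg t x : approx n (time_index n t) x @[n --> UF] --> limit_solution t x.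
Proof. exact: u_cvg. Qed.

Lemma approx_near0 n j x : `|approx n j x - u0 x| <= j%:R * delta n * (deg G x / mu x * K).
Proof.
have := approx_lip n j 0 x; by rewrite mul0r subr0 [ `|_ * _| ]ger0_norm// mulr_ge0// (ltW (delta_gt0 n)).
Qed.

End Solution.

(** [tau] is so short that both schemes stay within [rho] of [u0 o] at [o], where [psi n] is within
    [B / 8] of [phi (u0 o)]. The fluxes at [o] then differ by at most [B / 4], less than half the
    boundary gap. *)
Lemma limit_solution_gap b1 b2 cap o : 0 <= b1 <= M -> 0 <= b2 <= M -> phi b1 < phi b2 ->
  (total_measure G < +oo)%E -> 0 < cap ->
  (forall f, finitely_supported f -> cap * f o ^+ 2 <= energy G f f) ->
  exists2 tau, 0 < tau & forall t, 0 < t <= tau ->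
    cap * (t * ((phi b2 - phi b1) / 2)) / 4 <=
      tsum (fun x => mu x * (limit_solution b2 t x - limit_solution b1 t x)).
Proof.
move=> b1M b2M phib mu_fin cap0 capacity.
set B := phi b2 - phi b1; have B0 : 0 < B by rewrite subr_gt0.
have B8 : 0 < B / 8 by rewrite divr_gt0.
have /andP[b10 b1M'] := b1M; have /andP[b20 b2M'] := b2M; have /andP[uo0 _] := u0_M o.
have [rho rho0 [N0 H0]] := lipschitz_below_cvg phi_I uo0 B8.
have [d1 d10 [N1 H1]] := lipschitz_below_cvg phi_I b10 B8.
have [d2 d20 [N2 H2]] := lipschitz_below_cvg phi_I b20 B8.
pose Co := deg G o / mu o * K.
have K0 : 0 <= K by have [_ _ _ <-] := phi_I; exact: (nonlinearity_le phi_I).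
have Co0 : 0 <= Co by rewrite mulr_ge0// divr_ge0 ?deg_ge0 ?mu0.
have Co1 : 0 < Co + 1 by rewrite ltr_wpDl.
exists (rho / (Co + 1)); first by rewrite divr_gt0.
move=> t /andP[t0]; rewrite ler_pdivlMr// => trho.
have L1 : cap * ((time_index n t)%:R * delta n * (B / 2)) / 4 @[n --> UF] --> cap * (t * (B / 2)) / 4.
  apply: cvgM; last exact: cvg_cst.
  apply: cvgM; first exact: cvg_cst.
  apply: cvgM; last exact: cvg_cst.
  exact: (@idx_cvg t (ltW t0)).
have norm_sub (p q : R) : 0 <= p <= M -> 0 <= q <= M -> `|p - q| <= M + M.
  by move=> /andP[? ?] /andP[? ?]; rewrite ler_norml; apply/andP; split; lra.
have L2 : tsum (fun x => mu x * (approx b2 n (time_index n t) x - approx b1 n (time_index n t) x))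
    @[n --> UF] --> tsum (fun x => mu x * (limit_solution b2 t x - limit_solution b1 t x)).
  apply: (@cvg_tsum_mul _ _ _ _ _ mu (M + M)) => //.
  - exact: mu0.
  - exact: mu_summable.
  - by move=> n x; apply: norm_sub; exact: approx_bd.
  - by move=> x; apply: norm_sub; exact: limit_solution_bd.
  - by move=> x; apply: cvgB; exact: approx_cvg.
apply: (ler_cvg_to L1 L2).
have m0 : \forall n \near UF, (N0 <= n)%N by exact: (@near_oo _ N0).
have m1 : \forall n \near UF, (N1 <= n)%N by exact: (@near_oo _ N1).
have m2 : \forall n \near UF, (N2 <= n)%N by exact: (@near_oo _ N2).
have m3 : \forall n \near UF, (pickle o < n)%N by exact: (@near_oo _ (pickle o).+1).
have /cvgrPdist_lt/(_ _ t0) m4 := delta_cvg.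
near=> n.
have n0 : (N0 <= n)%N by near: n. have n1 : (N1 <= n)%N by near: n.
have n2 : (N2 <= n)%N by near: n. have n3 : (pickle o < n)%N by near: n.
have n4 : `|0 - delta n| < t by near: n.
rewrite sub0r normrN (gtr0_norm (delta_gt0 n)) in n4.
have /andP[k1 k2] := idx_bounds n (ltW t0).
have N_gt0 : (0 < time_index n t)%N.
  by rewrite lt0n; apply/eqP => N_0; move: k2; rewrite N_0 mul0r add0r ltNge ltW.
have q1 : `|psi n b1 - phi b1| <= B / 8 by apply: H1 => //; rewrite subrr normr0 ltW.
have q2 : `|psi n b2 - phi b2| <= B / 8 by apply: H2 => //; rewrite subrr normr0 ltW.
(* At least [3 B / 4] of the gap [B] survives the approximation of [phi]; half of it, [3 B / 8],
   exceeds the [B / 4] allowed at [o], and the final bound retains [B / 2]. *)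
have B34 : B / 2 + B / 4 <= psi n b2 - psi n b1.
  move: B0 q1 q2; rewrite !ler_norml /B.
  move: (psi n b1) (psi n b2) (phi b1) (phi b2) => p1 p2 f1 f2 ? /andP[? ?] /andP[? ?]; lra.
have near_b b j : 0 <= b <= M -> (j < time_index n t)%N -> `|psi n (approx b n j o) - phi (u0 o)| <= B / 8.
  move=> bM jN; apply: H0 => //; apply: le_trans (approx_near0 bM n j o) _.
  apply: le_trans trho; apply: (@le_trans _ _ (t * Co)).
    rewrite ler_wpM2r//; apply: le_trans k1.
    by rewrite ler_pM2r// ler_nat ltnW.
  by rewrite ler_pM2l// lerDl.
have near_o j : (j < time_index n t)%N ->
    psi n (euler G n (psi n) (delta n) u0 (psi n b2) j o) -
    psi n (euler G n (psi n) (delta n) u0 (psi n b1) j o) <= (psi n b2 - psi n b1) / 2.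
  move=> jN; have := near_b _ _ b2M jN; have := near_b _ _ b1M jN; rewrite /approx.
  move: (psi n (euler _ _ _ _ _ (psi n b1) _ _)) (psi n (euler _ _ _ _ _ (psi n b2) _ _)) => p1 p2.
  move: B0 B34; move: (phi (u0 o)) (psi n b2 - psi n b1) (B) => f b B' ? ?.
  by rewrite !ler_norml => /andP[? ?] /andP[? ?]; lra.
have psi12 : psi n b1 < psi n b2.
  by rewrite -subr_gt0; apply: lt_le_trans B34; rewrite addr_gt0// divr_gt0.
apply: le_trans (euler_gap (psi_le n) (psi_lip n) (psi_0 n) (delta_gt0 n) (@step_small n) u0_M
  (level_bd b1M n) (level_bd b2M n) psi12 cap0 N_gt0 mu_fin capacity near_o n3).
rewrite ler_pM2r ?invr_gt0// ler_pM2l// ler_wpM2l ?mulr_ge0 ?(ltW (delta_gt0 n))//.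
by apply: le_trans B34; rewrite lerDl divr_ge0// ltW.
Unshelve. all: by end_near. Qed.

End Limit.

(** * Loss of conservation on graphs that are not recurrent, and the equivalences *)

Section Theorem75.
Variables (R : realType) (X : countType) (G : graph R X) (phi : R -> R).
Local Notation mu := (vertex_weight G).
Hypotheses (mu_finite : (total_measure G < +oo)%E) (phi_I : nonlinearity phi).

Lemma not_recurrent_capacity : ~ recurrent G -> exists o cap, 0 < cap /\
  forall f, finitely_supported f -> cap * f o ^+ 2 <= energy G f f.
Proof.
move=> H; apply: contrapT => N; apply: H => o e e0; apply: contrapT => N'.
apply: N; exists o, e; split=> // f ff; rewrite leNgt; apply/negP => h.
by apply: N'; exists f.
Qed.

Lemma mass_lt (f g : X -> R) (K : R) : (forall x, 0 <= f x <= K) -> (forall x, 0 <= g x <= K) ->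
  0 < tsum (fun x => mu x * (g x - f x)) -> (mass G f < mass G g)%E.
Proof.
move=> fK gK; have sm h : (forall x, 0 <= h x <= K) -> abs_summable (fun x => mu x * h x).
  move=> hK; apply: (abs_summableM (mu_summable mu_finite) (K := K)) => x.
  by have /andP[h1 h2] := hK x; rewrite ger0_norm.
rewrite (mass_tsum mu_finite fK) (mass_tsum mu_finite gK) lte_fin.
rewrite (@eq_tsum _ _ _ (fun x => mu x * g x - mu x * f x)) => [|x]; last by rewrite mulrBr.
by rewrite tsumB; [rewrite subr_gt0|exact: sm|exact: sm].
Qed.

Lemma limit_solution_mass M u0 (UF : set_system nat) b1 b2 (T : R) :
  ~ recurrent G -> (forall x, 0 <= u0 x <= M) -> UltraFilter UF -> \oo `<=` UF ->
  0 <= b1 <= M -> 0 <= b2 <= M -> phi b1 < phi b2 -> 0 < T ->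
  exists2 t, 0 < t <= T & (mass G (limit_solution G phi u0 UF b1 t) <
                           mass G (limit_solution G phi u0 UF b2 t))%E.
Proof.
move=> nrec u0M UU UFoo b1M b2M b12 T0.
have [] := not_recurrent_capacity nrec => o [cap [cap0 capacity]].
have [tau tau0 H] := limit_solution_gap phi_I u0M UU UFoo b1M b2M b12 mu_finite cap0 capacity.
exists (Num.min tau T); first by rewrite lt_min tau0 T0 ge_min lexx orbT.
set t := Num.min tau T.
have t0 : 0 < t by rewrite lt_min tau0 T0.
have ttau : 0 < t <= tau by rewrite t0 ge_min lexx.
have {}H := H t ttau.
have bd b : 0 <= b <= M -> forall x, 0 <= limit_solution G phi u0 UF b t x <= M.
  by move=> bM x; exact: limit_solution_bd.
apply: mass_lt (bd b1 b1M) (bd b2 b2M) (lt_le_trans _ H).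
by rewrite divr_gt0// mulr_gt0// mulr_gt0// divr_gt0// subr_gt0.
Qed.

Lemma mass_cst (c : R) : 0 <= c -> mass G (fun=> c) = (c%:E * total_measure G)%E.
Proof.
move=> c0; rewrite (mass_tsum mu_finite (K := c)); last by rewrite c0 lexx.
rewrite /total_measure tsum_ge0_EFin; last exact: mu_summable.
  rewrite -EFinM -tsumZ; last exact: mu_summable.
  by congr EFin; apply: eq_tsum => x; rewrite mulrC.
by move=> x; exact: mu_ge0.
Qed.

Lemma cst0_Dplus : in_Dplus G (fun=> 0).
Proof.
split; first by [].
  rewrite /in_l1 (_ : (fun x => _) = fun=> 0%E) ?esum1//.
  by apply/funext => x; rewrite normr0 mul0r.
by exists 0 => x; rewrite normr0.
Qed.

End Theorem75.

Theorem corollary7p5 (R : realType) (X : countType) (G : graph R X)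
    (phi : R -> R)
    (mu_finite : (total_measure G < +oo)%E)
    (phi_I : nonlinearity phi)
    (phi_pos : phi @^-1` `]0, +oo[ !=set0) :
  [/\ stochastically_complete G <->
        (forall T : R, 0 < T -> forall (u0 : X -> R) (u : R -> X -> R),
           in_Dplus G u0 -> bp_solution G phi T u0 u ->
           conserves_mass G T u0 u),
      stochastically_complete G <->
        (exists (T0 : R) (ustar : X -> R),
           [/\ 0 < T0, exists x, ustar x != 0, positive ustar,
               finitely_supported ustar
             & forall u : R -> X -> R, bp_solution G phi T0 ustar u ->
                 conserves_mass G T0 ustar u]),
      stochastically_complete G <->
        (exists T0 : R, 0 < T0 /\
           forall u : R -> X -> R, bp_solution G phi T0 (fun _ => 0) u ->
             conserves_mass G T0 (fun _ => 0) u)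
    & ~ stochastically_complete G ->
        forall T : R, 0 < T -> forall c : R, 0 < c ->
          0 < phi c ->
          ((phi c)%:E < ereal_sup (range (fun s => (phi s)%:E)))%E ->
          exists (um up : R -> X -> R) (tm tp : R),
            [/\ bp_solution G phi T (fun _ => c) um,
                bp_solution G phi T (fun _ => c) up,
                0 < tm <= T /\ 0 < tp <= T,
                forall t x, 0 <= t <= T -> 0 <= um t x <= c /\ c <= up t x
              & (mass G (um tm) < c%:E * total_measure G)%E /\
                (c%:E * total_measure G < mass G (up tp))%E]].
Proof.
have [UF [UU UFoo]] := @ultraFilterLemma nat \oo eventually_filter.
have [_ _ _ phi0] := phi_I.
have complete_conserves T u0 u : stochastically_complete G -> bp_solution G phi T u0 u ->
    conserves_mass G T u0 u.
  by move=> sc; apply: recurrent_conserves => //; exact: complete_recurrent.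
have incomplete : ~ stochastically_complete G -> ~ recurrent G.
  by move=> nsc rec; apply: nsc; exact: recurrent_complete.
have phi_lt s t : phi s < phi t -> s < t.
  by rewrite !ltNge; apply: contraNN => ts; exact: (nonlinearity_le phi_I).
have [d] := phi_pos; rewrite /= in_itv /= andbT => phid.
have d0 : 0 < d by apply: phi_lt; rewrite phi0.
(* The boundary levels [0] and [d] give two solutions with the same datum whose masses differ at
   some time, so they cannot both conserve it. The bound [M'] admits the datum and both levels. *)
have not_all_conserve T u0 M : ~ stochastically_complete G -> 0 < T -> 
    (forall x, 0 <= u0 x <= M) ->
    ~ (forall u, bp_solution G phi T u0 u -> conserves_mass G T u0 u).
  move=> nsc T0 u0M cons; pose M' := Num.max M d.
  have u0M' x : 0 <= u0 x <= M' by have /andP[h1 h2] := u0M x; rewrite h1 le_max h2.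
  have bM' : 0 <= (0 : R) <= M' by rewrite lexx le_max (ltW d0) orbT.
  have dM' : 0 <= d <= M' by rewrite (ltW d0) le_max lexx orbT.
  have phi0d : phi 0 < phi d by rewrite phi0.
  have [t tT lt_mass] := limit_solution_mass mu_finite phi_I (incomplete nsc) u0M' UU UFoo bM' dM' phi0d T0.
  have tT' : 0 <= t <= T by case/andP: tT => /ltW -> ->.
  have s1 := cons _ (limit_solutionP G phi_I u0M' UU UFoo bM' T).
  have s2 := cons _ (limit_solutionP G phi_I u0M' UU UFoo dM' T).
  have s12 := etrans (s1 t tT') (esym (s2 t tT')).
  exact: (elimF eqP (lt_eqF lt_mass) s12).
have zero_bd (x : X) : 0 <= (0 : R) <= 0 by rewrite lexx.
split.
- split=> [sc T T0 u0 u _ sol|H]; first exact: complete_conserves.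
  apply: contrapT => nsc; apply: (not_all_conserve _ _ _ nsc ltr01 zero_bd) => u.
  by apply: H => //; exact: cst0_Dplus.
- split=> [sc|[T0 [ustar [T00 _ ustar0 ustar_fs H]]]].
    have [] := graph_nonempty G => o _.
    exists 1, (fun x => if x == o then 1 else 0); split => //.
    + by exists o; rewrite eqxx oner_eq0.
    + by move=> x; case: ifP.
    + apply: (sub_finite_set _ (finite_set1 o)) => x /=.
      by case: ifP => [/eqP //|]; rewrite eqxx.
    + by move=> u sol; exact: complete_conserves.
  apply: contrapT => nsc; have [M hM] := fs_bounded ustar_fs.
  apply: (not_all_conserve _ _ M nsc T00 _ H) => x.
  by rewrite ustar0 (le_trans (ler_norm _)).
- split=> [sc|[T0 [T00 H]]]; last first.
    by apply: contrapT => nsc; exact: (not_all_conserve _ _ _ nsc T00 zero_bd).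
  by exists 1; split=> // u sol; exact: complete_conserves.
- move=> nsc T T0 c c0 phic /ereal_sup_gt[_ [s _ <-]]; rewrite lte_fin => phics.
  have cs := phi_lt _ _ phics; have s0 := lt_trans c0 cs.
  have cc (x : X) : 0 <= c <= c by rewrite lexx ltW.
  have cS (x : X) : 0 <= c <= s by rewrite !ltW.
  have zc : 0 <= (0 : R) <= c by rewrite lexx ltW.
  have cc' : 0 <= c <= c by rewrite lexx ltW.
  have cs' : 0 <= c <= s by rewrite !ltW.
  have ss' : 0 <= s <= s by rewrite lexx ltW.
  have zs : 0 <= (0 : R) <= s by rewrite lexx ltW.
  have phi0c : phi 0 < phi c by rewrite phi0.
  have nrec := incomplete nsc.
  (* The level [c] reproduces the constant [c]. Compared with it, the level [0] has lost mass at
     time [tm], and the level [s], where [phi s > phi c], has gained mass at time [tp]. *)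
  have [tm tmT hm] := limit_solution_mass mu_finite phi_I nrec cc UU UFoo zc cc' phi0c T0.
  have [tp tpT hp] := limit_solution_mass mu_finite phi_I nrec cS UU UFoo cs' ss' phics T0.
  exists (limit_solution G phi (fun=> c) UF 0), (limit_solution G phi (fun=> c) UF s), tm, tp; split.
  + exact: (limit_solutionP G phi_I cc UU UFoo zc T).
  + exact: (limit_solutionP G phi_I cS UU UFoo ss' T).
  + by [].
  + move=> t x _; split.
      apply/andP; split.
        by apply: (limit_solution_ge G phi_I cc UU zc t x zc) => // ?; exact: ltW.
      by apply: (limit_solution_le G phi_I cc UU zc t x cc') => //; exact: ltW.
    by apply: (limit_solution_ge G phi_I cS UU ss' t x cs') => //; exact: ltW.
  + rewrite -(mass_cst mu_finite (ltW c0)); split.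
      (* Barriers from both sides identify the solution of level [c] with the constant [c], here
         with the bound [c] and below with the bound [s]. *)
      apply: lt_le_trans hm _; rewrite le_eqVlt; apply/orP; left; apply/eqP; congr (mass G).
      apply/funext => x; apply/eqP; rewrite eq_le.
      rewrite (limit_solution_le G phi_I cc UU cc' tm x cc')//.
      by rewrite (limit_solution_ge G phi_I cc UU cc' tm x cc').
    apply: le_lt_trans hp; rewrite le_eqVlt; apply/orP; left; apply/eqP; congr (mass G).
    apply/funext => x; apply/eqP; rewrite eq_le.
    rewrite (limit_solution_ge G phi_I cS UU cs' tp x cs')//.
    by rewrite (limit_solution_le G phi_I cS UU cs' tp x cs').
Qed.
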